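(* Let $M,\pi,\mathcal H,\Xi,\Xi^*,\theta$ be as in the standing setting described in the context. Let $\phi\in\mathcal H_\infty\setminus\{0\}$, put $\Phi:=\mathcal W(\phi,\phi)\in\mathcal S(\Xi^* )$, and let $p_1,p_2,p,q_1,q_2,q\in[1,\infty]$ be such that $\frac1{p_1}+\frac1{p_2}=\frac1p$ and $\frac1{q_1}+\frac1{q_2}=1+\frac1q$. Then the Moyal product $\#^\theta$ defines a continuous bilinear map $$M^{p_1,q_1}_{\Phi}(\pi^\#,\theta\times\theta)\times M^{p_2,q_2}_{\Phi}(\pi^\#,\theta\times\theta)\to M^{p,q}_{\Phi}(\pi^\#,\theta\times\theta).$$
   Context: Inner products are linear in the first variable. $\mathcal B(\mathcal H)$ denotes the bounded operators, $\mathfrak S_2(\mathcal H)$ the Hilbert-Schmidt operators, $\mathcal L(\cdot,\cdot)$ continuous linear maps. Standing setting. $M$ is a locally convex Lie group with Lie algebra $\mathfrak m$ and smooth exponential map $\exp_M:\mathfrak m\to M$. $\pi:M\to\mathcal B(\mathcal H)$ is a unitary representation on a complex Hilbert space. $\mathcal H_\infty$ is the space of smooth vectors ($\phi\in\mathcal H$ with $\pi(\cdot)\phi$ smooth), with the derived representation $d\pi$ of $\mathfrak m$, extended to the enveloping algebra $U(\mathfrak m_{\mathbb C})$, and with the topology of the seminorms $\phi\mapsto\|d\pi(u)\phi\|$, $u\in U(\mathfrak m_{\mathbb C})$. $\mathcal H_{-\infty}$ is the space of continuous antilinear functionals on $\mathcal H_\infty$ with the topology of uniform convergence on bounded sets;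 $\mathcal H_\infty\hookrightarrow\mathcal H\hookrightarrow\mathcal H_{-\infty}$ and the pairing $(\cdot\mid\cdot):\mathcal H_{-\infty}\times\mathcal H_\infty\to\mathbb C$ extends the scalar product. A unitary representation is nuclearly smooth if its space of smooth vectors is dense and is a nuclear Fréchet space, and the maps $(m,\phi)\mapsto\pi(m)\phi$ and $(X,\phi)\mapsto d\pi(X)\phi$ are continuous on $M\times\mathcal H_\infty$ and $\mathfrak m\times\mathcal H_\infty$, with values in $\mathcal H_\infty$. It is assumed that $\pi$ is twice nuclearly smooth: both $\pi$ and the representation $(m_1,m_2)\mapsto(T\mapsto\pi(m_1)T\pi(m_2)^{-1})$ of $M\times M$ on $\mathfrak S_2(\mathcal H)$ are nuclearly smooth, and the space $\mathcal B(\mathcal H)_\infty$ of smooth vectors of the latter is naturally isomorphic to $\mathcal H_\infty\widehat\otimes\overline{\mathcal H_\infty}\simeq\mathcal L(\mathcal H_{-\infty},\mathcal H_\infty)$. $\Xi$ is a finite-dimensional real vector space with a Lebesgue measure. $\Xi^*$ is a manifold with a polynomial structure (global charts onto some $\mathbb R^d$ with polynomial transition maps, which define the Schwartz space $\mathcal S(\Xi^* )$) and a Radon measure, with a function $\langle\cdot,\cdot\rangle:\Xi^*\times\Xi\to\mathbb R$ linear in the second variable, such that $b\mapsto\widehat b=\int_\Xi e^{-i\langle\cdot,x\rangle}b(x)\,dx$ gives a linear topological isomorphism $\mathcal S(\Xi)\to\mathcal S(\Xi^* )$ and a unitary operator $L^2(\Xi)\to L^2(\Xi^* )$; its inverse is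 $a\mapsto\check a$. $\mathcal S'(\Xi^* )$ is the space of tempered distributions, and $(F\mid\Phi)$, linear in $F\in\mathcal S'(\Xi^* )$ and antilinear in $\Phi\in\mathcal S(\Xi^* )$, is the pairing extending the $L^2$ scalar product. $\theta:\Xi\to\mathfrak m$ is linear. Write $\pi_X:=\pi(\exp_M(\theta(X)))$ for $X\in\Xi$. For $\phi\in\mathcal H_\infty$, $f\in\mathcal H_{-\infty}$ (also for $\phi,f\in\mathcal H$) the ambiguity function is $(\mathcal A_\phi f)(X)=(f\mid\pi_X\phi)$. The localized Weyl calculus is $\mathrm{Op}^\theta(a)=\int_\Xi\check a(X)\pi_X\,dX$ (weakly convergent) for $a\in\widehat{L^1(\Xi)}$. It is assumed that: (a) orthogonality relations along $\theta$: $(\mathcal A_{\phi_1}f_1\mid\mathcal A_{\phi_2}f_2)_{L^2(\Xi)}=(f_1\mid f_2)(\phi_2\mid\phi_1)$ for all $f_1,f_2,\phi_1,\phi_2\in\mathcal H$; (b) density condition along $\theta$: the functions $\mathcal A_\phi f$ ($f,\phi\in\mathcal H$) span a dense subspace of $L^2(\Xi)$; (c) regularity: $\mathrm{Op}^\theta$ gives a linear topological isomorphism $\mathcal S(\Xi^* )\to\mathcal B(\mathcal H)_\infty$; (d) for every $u\in U(\mathfrak m_{\mathbb C})$ and $\phi_0\in\mathcal H_\infty$, the function $X\mapsto\|d\pi(u)\pi_X\phi_0\|$ has polynomial growth. Consequently $\mathrm{Op}^\theta$ extends to a unitary operator $L^2(\Xi^* )\to\mathfrak S_2(\mathcal H)$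 and to a linear topological isomorphism $\mathcal S'(\Xi^* )\to\mathcal L(\mathcal H_\infty,\mathcal H_{-\infty})$, given by $(\mathrm{Op}^\theta(a)f\mid g)=(a\mid\mathcal W(g,f))$ for $f,g\in\mathcal H_\infty$. Here the cross-Wigner distribution $\mathcal W(f,\phi)$ is the Fourier transform of $\mathcal A_\phi f$; equivalently $\mathrm{Op}^\theta(\mathcal W(f,\phi))=(\cdot\mid\phi)f$; and $\mathcal W(f,\phi)\in\mathcal S(\Xi^* )$ for $f,\phi\in\mathcal H_\infty$. Moyal product: for $a_1,a_2\in\mathcal S'(\Xi^* )$, if the product $\mathrm{Op}^\theta(a_1)\mathrm{Op}^\theta(a_2)\in\mathcal L(\mathcal H_\infty,\mathcal H_{-\infty})$ is well defined, $a_1\#^\theta a_2\in\mathcal S'(\Xi^* )$ is determined by $\mathrm{Op}^\theta(a_1\#^\theta a_2)=\mathrm{Op}^\theta(a_1)\mathrm{Op}^\theta(a_2)$. The product is understood in the weak sense $$(\mathrm{Op}^\theta(a_1)\mathrm{Op}^\theta(a_2)f\mid g)=\|\phi\|^{-2}\int_\Xi(\mathrm{Op}^\theta(a_2)f\mid\phi_Y)\,(\mathrm{Op}^\theta(a_1)\phi_Y\mid g)\,dY,\quad f,g\in\mathcal H_\infty,\ \phi_Y:=\pi_Y\phi,$$ with absolutely convergent integral (this agrees with composition when both operators are bounded on $\mathcal H$). Representation $\pi^\#$: $M\ltimes M$ is $M\times M$ with $(m_1,m_2)(n_1,n_2)=(m_1n_1,n_1^{-1}m_2n_1n_2)$, acting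 on $\mathfrak S_2(\mathcal H)$ by $\pi^\ltimes(m_1,m_2)T=\pi(m_1m_2)T\pi(m_1)^{-1}$; $\pi^\#$ is the equivalent representation on $L^2(\Xi^* )$ obtained via the unitary $\mathrm{Op}^\theta$. Thus $\mathrm{Op}^\theta\big(\pi^\#(\exp_{M\ltimes M}(\theta(X_1),\theta(X_2)))F\big)=\pi_{X_1+X_2}\mathrm{Op}^\theta(F)\pi_{X_1}^{-1}$. Modulation spaces of symbols: for $F\in\mathcal S'(\Xi^* )$ and $0\neq\Phi\in\mathcal S(\Xi^* )$, $(\mathcal A^{\pi^\#,\theta\times\theta}_\Phi F)(X_1,X_2)=(F\mid\pi^\#(\exp_{M\ltimes M}(\theta(X_1),\theta(X_2)))\Phi)$; for $r,s\in[1,\infty]$, $$\|F\|_{M^{r,s}_\Phi(\pi^\#,\theta\times\theta)}=\Big(\int_\Xi\Big(\int_\Xi|(\mathcal A^{\pi^\#,\theta\times\theta}_\Phi F)(X_1,X_2)|^r\,dX_1\Big)^{s/r}dX_2\Big)^{1/s}$$ (usual conventions for $\infty$), and $M^{r,s}_\Phi(\pi^\#,\theta\times\theta)$ is the set of $F\in\mathcal S'(\Xi^* )$ for which this is finite. *)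

(* Defs.v *)
From HB Require Import structures.
From mathcomp Require Import all_boot all_order all_algebra.
From mathcomp Require Import all_classical all_reals all_analysis.
From mathcomp.real_closed Require Import complex.
From mathcomp Require mpoly.

Set Implicit Arguments.
Unset Strict Implicit.
Unset Printing Implicit Defensive.

Import Order.TTheory GRing.Theory Num.Theory numFieldNormedType.Exports.

Local Open Scope classical_set_scope.
Local Open Scope ring_scope.

Definition creal (R : realType) (t : R) : R[i] := Complex t 0.

Definition cabs (R : realType) (z : R[i]) : R := complex.Re `|z|.

(* [open.-sigma] is the Borel sigma-algebra. *)
Notation borel T := (g_sigma_algebraType (@open T)).

Section ComplexIntegral.
Context d (T : measurableType d) (R : realType).
Variable mu : {measure set T -> \bar R}.
Implicit Types f g : T -> R[i].

Definition cmeasurable f :=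
  measurable_fun setT (fun x => complex.Re (f x)) /\
  measurable_fun setT (fun x => complex.Im (f x)).

Definition cintegrable f :=
  mu.-integrable setT (fun x => (complex.Re (f x))%:E) /\
  mu.-integrable setT (fun x => (complex.Im (f x))%:E).

Definition cint f : R[i] :=
  Complex (\int[mu]_x complex.Re (f x)) (\int[mu]_x complex.Im (f x)).

Definition L2norm f : \bar R := Lnorm mu 2%:E (fun x => (cabs (f x))%:E).

Definition L2 f := cmeasurable f /\ (L2norm f < +oo)%E.

Definition L2dot f g : R[i] := cint (fun x => f x * (g x)^*%C).

End ComplexIntegral.

(* A Lebesgue measure is a nonzero translation-invariant Borel measure that is
   finite on compact sets; it is unique up to a positive factor. *)
Definition is_lebesgue (R : realType) (V : normedModType R)
    (mu : {measure set (borel V) -> \bar R}) : Prop :=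
  [/\ forall (x : V) (A : set (borel V)), measurable A ->
        mu [set (x + y : V) | y in A] = mu A,
      forall K : set V, compact K -> (mu K < +oo)%E &
      mu setT != 0%E].

Definition is_radon (R : realType) (T : ptopologicalType)
    (mu : {measure set (borel T) -> \bar R}) : Prop :=
  (forall K : set T, compact K -> (mu K < +oo)%E) /\
  (forall A : set (borel T), measurable A ->
     mu A = ereal_sup [set mu K | K in [set K : set T | compact K /\ K `<=` A]]).

Definition finite_dimensional (R : realType) (V : normedModType R) : Prop :=
  exists n (b : 'I_n -> V), forall x, exists c : 'I_n -> R,
    x = \sum_(i < n) c i *: b i.

(* The space is the subset [ldom] of the ambient vector space [lvec] (a linear
   subspace in all the instances below), with the locally convex topology of
   the seminorms [lsn j]. Values of the seminorms outside [ldom] are junk. *)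
Record lcs (R : realType) := Lcs {
  lvec :> lmodType R[i];
  ldom : set lvec;
  lidx : Type;
  lsn : lidx -> lvec -> R }.

Section Lcs.
Variable R : realType.
Implicit Types E F : lcs R.

Definition lnbhs E (x : E) : set_system E := [set A |
  exists n (s : 'I_n -> lidx E) (e : R), 0 < e /\
    forall y, ldom (y - x) -> (forall j, lsn (s j) (y - x) < e) -> A y].

Definition ldense E (D : set E) : Prop :=
  forall x, ldom x -> forall A, lnbhs x A -> exists2 y, D y & A y.

Definition llinear E F (T : E -> F) : Prop :=
  forall (k : R[i]) x y, ldom x -> ldom y -> T (k *: x + y) = k *: T x + T y.

Definition lcontinuous E F (T : E -> F) : Prop :=
  forall x, ldom x -> T @ lnbhs x `=>` lnbhs (T x).

Definition top_iso E F (T : E -> F) : Prop :=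
  [/\ set_bij (@ldom R E) (@ldom R F) T, llinear T, lcontinuous T &
      forall x A, ldom x -> lnbhs x A -> lnbhs (T x) (T @` A)].

Definition continuous_bilinear E1 E2 F (B : E1 -> E2 -> F) : Prop :=
  [/\ forall x y, ldom x -> ldom y -> ldom (B x y),
      forall y, ldom y -> llinear (B ^~ y),
      forall x, ldom x -> llinear (B x) &
      forall x y, ldom x -> ldom y ->
        (fun z => B z.1 z.2) @ filter_prod (lnbhs x) (lnbhs y)
          `=>` lnbhs (B x y)].

Definition continuous_seminorm E (p : E -> R) : Prop :=
  [/\ forall x, ldom x -> 0 <= p x,
      forall (k : R[i]) x, ldom x -> p (k *: x) = cabs k * p x,
      forall x y, ldom x -> ldom y -> p (x + y) <= p x + p y &
      forall e : R, 0 < e -> lnbhs 0 [set x : E | p x < e]].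

Definition lhausdorff E : Prop :=
  forall x : E, ldom x -> (forall j, lsn j x = 0) -> x = 0.

Definition lfirst_countable E : Prop :=
  exists B : nat -> set E, (forall n, lnbhs 0 (B n)) /\
    forall A : set E, lnbhs 0 A -> exists n, B n `&` @ldom R E `<=` A.

Definition lseq_complete E : Prop :=
  forall u : nat -> E, (forall n, ldom (u n)) ->
    (forall j (e : R), 0 < e -> exists N, forall n m, (N <= n)%N -> (N <= m)%N ->
       lsn j (u n - u m) < e) ->
    exists2 l, ldom l & u @ \oo `=>` lnbhs l.

Definition is_frechet E : Prop :=
  [/\ lhausdorff E, lfirst_countable E & lseq_complete E].

(* For every p there is q such that the canonical map from E normed by q to E
   normed by p is nuclear: x = \sum_n lam_n a_n(x) y_n for the seminorm p. The
   vectors y_n of a nuclear representation, a priori in the completion of E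
   normed by p, can be taken in E since E is dense in that completion. *)
Definition is_nuclear E : Prop :=
  forall p : E -> R, continuous_seminorm p ->
  exists q : E -> R, continuous_seminorm q /\
  exists (lam : nat -> R) (a : nat -> E -> R[i]) (y : nat -> E),
    [/\ cvgn (series (fun n => `|lam n|)),
        forall n (k : R[i]) x z, ldom x -> ldom z ->
          a n (k *: x + z) = k * a n x + a n z,
        forall n x, ldom x -> cabs (a n x) <= q x,
        forall n, ldom (y n) /\ p (y n) <= 1 &
        forall x, ldom x ->
          (fun N => p (x - \sum_(n < N) (creal (lam n) * a n x) *: y n))
            @ \oo --> (0 : R)].

Definition lbounded E (B : set E) : Prop :=
  B `<=` @ldom R E /\ forall j, exists c : R, forall x, B x -> lsn j x <= c.

Definition scalar_lcs : lcs R :=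
  @Lcs R (R[i] : lmodType R[i]) setT unit (fun _ => @cabs R).

(* The functions in the ambient space [E -> R[i]] are made to vanish outside
   [ldom], so that equality of functionals is equality of functions. *)
Definition antidual E : lcs R :=
  @Lcs R (E -> R[i] : lmodType R[i])
    [set l : E -> R[i] |
      [/\ forall (k : R[i]) x y, ldom x -> ldom y ->
            l (k *: x + y) = (k^*)%C * l x + l y,
          forall x, ~ ldom x -> l x = 0 &
          @lcontinuous E scalar_lcs l]]
    {B : set E | lbounded B}
    (fun B l => sup [set cabs (l x) | x in proj1_sig B]).

(* L(E, F) with the topology of uniform convergence on bounded sets *)
Definition Lb E F : lcs R :=
  @Lcs R (E -> F : lmodType R[i])
    [set T : E -> F |
      [/\ llinear T, forall x, ldom x -> ldom (T x),
          forall x, ~ ldom x -> T x = 0 & lcontinuous T]]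
    ({B : set E | lbounded B} * lidx F)%type
    (fun i T => sup [set lsn i.2 (T x) | x in proj1_sig i.1]).

End Lcs.

Section Calculus.
Variables (R : realType) (F : zmodType) (sc : R -> F -> F).
Variable nb : F -> set_system F.

Fixpoint Ck (k : nat) : forall (E : tvsType R), set E -> (E -> F) -> Prop :=
  match k with
  | 0 => fun E U f => forall x, U x -> f @ nbhs x `=>` nb (f x)
  | k'.+1 => fun E U f =>
      (forall x, U x -> f @ nbhs x `=>` nb (f x)) /\
      exists df : E * E -> F,
        (forall x v, U x ->
           (fun t : R => sc t^-1 (f (x + t *: v) - f x)) @ (0 : R)^'
             `=>` nb (df (x, v))) /\
        Ck k' (U `*` setT) df
  end.

End Calculus.

Definition tvs_Ck (R : realType) (F : tvsType R) (k : nat) (E : tvsType R) :=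
  @Ck R F *:%R (@nbhs F F) k E.

Definition lcs_Ck (R : realType) (F : lcs R) (k : nat) (E : tvsType R) :=
  @Ck R F (fun t v => creal t *: v) (@lnbhs R F) k E.

Record chart (R : realType) (G : topologicalType) (E : tvsType R) := Chart {
  cdom : set G;
  cmap : G -> E;
  cinv : E -> G }.

Section Manifolds.
Variable R : realType.

Definition prod_chart (G G' : topologicalType) (E E' : tvsType R)
    (c : chart G E) (c' : chart G' E') : chart (G * G')%type (E * E')%type :=
  Chart (cdom c `*` cdom c') (fun x => (cmap c x.1, cmap c' x.2))
    (fun y => (cinv c y.1, cinv c' y.2)).

Definition prod_atlas (G G' : topologicalType) (E E' : tvsType R)
    (A : set (chart G E)) (A' : set (chart G' E')) :=
  [set prod_chart c c' | c in A & c' in A'].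

Definition model_atlas (E : tvsType R) : set (chart E E) :=
  [set Chart setT id id].

Definition smooth_map (G G' : topologicalType) (E E' : tvsType R)
    (A : set (chart G E)) (A' : set (chart G' E')) (f : G -> G') : Prop :=
  continuous f /\ forall c c' k, A c -> A' c' ->
    tvs_Ck k (cmap c @` (cdom c `&` f @^-1` cdom c')) (cmap c' \o f \o cinv c).

Definition smooth_to_lcs (G : topologicalType) (E : tvsType R)
    (A : set (chart G E)) (K : lcs R) (f : G -> K) : Prop :=
  forall c k, A c -> lcs_Ck k (cmap c @` cdom c) (f \o cinv c).

Definition is_atlas (G : topologicalType) (E : tvsType R)
    (A : set (chart G E)) : Prop :=
  [/\ forall c, A c ->
        [/\ open (cdom c), open (cmap c @` cdom c),
            forall x, cdom c x -> cinv c (cmap c x) = x,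
            forall x, cdom c x -> cmap c @ x --> cmap c x &
            forall x, cdom c x -> cinv c @ cmap c x --> x],
      forall x, exists2 c, A c & cdom c x &
      smooth_map A A id].

End Manifolds.

#[short(type="topGroupType")]
HB.structure Definition TopGroup := {G of Group G & Topological G}.

Section LieGroups.
Variables (R : realType) (G : topGroupType) (E : tvsType R).
Variables (A : set (chart G E)) (c1 : chart G E) (ex : E -> G).

(* The chart c1 around 1 identifies the Lie algebra, i.e. the tangent space at
   1, with the model space E. *)
Definition is_lie_group : Prop :=
  [/\ hausdorff_space G, hausdorff_space E, is_atlas A,
      smooth_map (prod_atlas A A) A (fun x : G * G => (x.1 * x.2)%g) &
      smooth_map A A (fun x : G => (x^-1)%g)] /\
  A c1 /\ cdom c1 1%g.

Definition is_smooth_exponential : Prop :=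
  [/\ smooth_map (@model_atlas R E) A ex,
      forall (X : E) (s t : R), ex ((s + t) *: X) = (ex (s *: X) * ex (t *: X))%g &
      forall X : E,
        (fun t : R => t^-1 *: (cmap c1 (ex (t *: X)) - cmap c1 1%g)) @ (0 : R)^'
          --> X].

(* M |>< M : M * M with the multiplication below. *)
Definition sdmul (m n : G * G) : G * G :=
  ((m.1 * n.1)%g, (n.1^-1 * m.2 * n.1 * n.2)%g).

(* The isomorphism (m1, m2) |-> (m1 m2, m1) from M |>< M onto M * M has tangent
   map (X1, X2) |-> (X1 + X2, X1), whence the exponential map of M |>< M. *)
Definition sdexp (X : E * E) : G * G :=
  (ex X.1, (ex (- X.1) * ex (X.1 + X.2))%g).

Lemma sdexpD (X : E * E) (s t : R) : is_smooth_exponential ->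
  sdexp ((s + t) *: X) = sdmul (sdexp (s *: X)) (sdexp (t *: X)).
Proof.
move=> [_ exD _]; case: X => X1 X2; rewrite /sdexp /sdmul /=.
have ex0 : ex 0 = 1%g.
  have /(congr1 (fun y : G => ((ex 0)^-1 * y)%g)) := exD 0 0 0.
  by rewrite addr0 scale0r mulKg mulVg => <-.
have exN (Y : E) r : ex (- (r *: Y)) = ((ex (r *: Y))^-1)%g.
  apply: (@mulgI _ (ex (r *: Y))); rewrite mulgV -scaleNr -exD subrr scale0r.
  exact: ex0.
rewrite !exN -!scalerDr !exD invgM; congr pair.
by rewrite -!mulgA mulVKg.
Qed.

End LieGroups.

Section SmoothVectors.
Variables (R : realType) (G : topologicalType) (E : tvsType R).
Variables (A : set (chart G E)) (ex : E -> G) (K : lcs R) (rho : G -> K -> K).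

Definition smooth_vector : set K :=
  [set v | ldom v /\ smooth_to_lcs A (fun g => rho g v)].

Definition drep (X : E) (v : K) : K :=
  xget 0 [set w | ldom w /\
    (fun t : R => creal t^-1 *: (rho (ex (t *: X)) v - v)) @ (0 : R)^'
      `=>` lnbhs w].

(* Every element of the complexified enveloping algebra is a complex linear
   combination of products of elements of E; the list u of pairs (coefficient,
   word) stands for such a combination and [denv u] is its action. *)
Definition denv (u : seq (R[i] * seq E)) (v : K) : K :=
  \sum_(p <- u) p.1 *: foldr drep v p.2.

Definition smooth_lcs : lcs R :=
  @Lcs R (lvec K) smooth_vector (lidx K * seq (R[i] * seq E))%type
    (fun i v => lsn i.1 (denv i.2 v)).

Definition nuclearly_smooth : Prop :=
  [/\ ldense smooth_vector,
      is_frechet smooth_lcs /\ is_nuclear smooth_lcs,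
      (forall g v, smooth_vector v -> smooth_vector (rho g v)) /\
      (forall X v, smooth_vector v -> smooth_vector (drep X v)),
      forall g v, smooth_vector v ->
        (fun z : G * K => rho z.1 z.2)
          @ filter_prod (nbhs g) (@lnbhs R smooth_lcs v)
          `=>` @lnbhs R smooth_lcs (rho g v) &
      forall X v, smooth_vector v ->
        (fun z : E * K => drep z.1 z.2)
          @ filter_prod (nbhs X) (@lnbhs R smooth_lcs v)
          `=>` @lnbhs R smooth_lcs (drep X v)].

End SmoothVectors.

Section Hilbert.
Variables (R : realType) (H : completeNormedModType R[i]).
Variable ip : {dot H for (@conjc R)}.

Definition hnorm (f : H) : R := complex.Re `|f|.

Definition hilbert_lcs : lcs R :=
  @Lcs R (H : lmodType R[i]) setT unit (fun _ => hnorm).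

Definition orthonormal_basis (B : set H) : Prop :=
  [/\ forall e, B e -> ip e e = 1,
      forall e e', B e -> B e' -> e <> e' -> ip e e' = 0 &
      forall x, (forall e, B e -> ip x e = 0) -> x = 0].

Definition hs_sum (B : set H) (T : H -> H) : \bar R :=
  \esum_(e in B) ((hnorm (T e)) ^+ 2)%:E.

Definition hilbert_schmidt : set (H -> H) := [set T |
  [/\ forall (k : R[i]) x y, T (k *: x + y) = k *: T x + T y,
      exists c : R, forall x, hnorm (T x) <= c * hnorm x &
      exists2 B, orthonormal_basis B & (hs_sum B T < +oo)%E]].

(* The value does not depend on the orthonormal basis. *)
Definition hs_norm (T : H -> H) : R :=
  Num.sqrt (fine (hs_sum (xget set0 orthonormal_basis) T)).

Definition hs_lcs : lcs R :=
  @Lcs R (H -> H : lmodType R[i]) hilbert_schmidt unit (fun _ => hs_norm).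

Definition rank1 (f g : H) : H -> H := fun h => ip h g *: f.

Definition is_unitary_rep (G : topGroupType) (rho : G -> H -> H) : Prop :=
  [/\ forall g (k : R[i]) x y, rho g (k *: x + y) = k *: rho g x + rho g y,
      forall g x y, ip (rho g x) (rho g y) = ip x y,
      forall g h x, rho (g * h)%g x = rho g (rho h x),
      forall x, rho 1%g x = x &
      forall x, continuous (fun g => rho g x)].

End Hilbert.

Section Schwartz.
Variables (R : realType) (V : normedModType R).

Definition iterD (vs : seq V) (g : V -> R) : V -> R :=
  foldr (fun v h x => 'D_v h x) g vs.

Definition iterDc (vs : seq V) (f : V -> R[i]) (x : V) : R[i] :=
  Complex (iterD vs (fun y => complex.Re (f y)) x)
          (iterD vs (fun y => complex.Im (f y)) x).

Definition schwartz_weight (N : nat) (vs : seq V) (f : V -> R[i]) (x : V) : R :=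
  (1 + `|x|) ^+ N * cabs (iterDc vs f x).

Definition schwartz_fun (f : V -> R[i]) : Prop :=
  (forall vs x,
     differentiable (iterD vs (fun y => complex.Re (f y))) x /\
     differentiable (iterD vs (fun y => complex.Im (f y))) x) /\
  (forall N vs, exists c : R, forall x, schwartz_weight N vs f x <= c).

Definition schwartz_sn (i : nat * seq V) (f : V -> R[i]) : R :=
  sup (range (schwartz_weight i.1 i.2 f)).

Definition schwartz_lcs : lcs R :=
  @Lcs R (V -> R[i] : lmodType R[i]) schwartz_fun (nat * seq V)%type schwartz_sn.

End Schwartz.

Definition polynomial_map (R : realType) (d : nat)
    (g : 'rV[R]_d -> 'rV[R]_d) : Prop :=
  forall i, exists p : mpoly.mpoly d R,
    forall x, g x ord0 i = mpoly.meval (fun k => x ord0 k) p.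

Record polyManifold (R : realType) := PolyManifold {
  pm_car :> ptopologicalType;
  pm_dim : nat;
  pm_idx : Type;
  pm_idx0 : inhabited pm_idx;
  pm_chart : pm_idx -> pm_car -> 'rV[R]_pm_dim;
  pm_inv : pm_idx -> 'rV[R]_pm_dim -> pm_car;
  pm_chartK : forall j, cancel (pm_chart j) (pm_inv j);
  pm_invK : forall j, cancel (pm_inv j) (pm_chart j);
  pm_chart_continuous : forall j, continuous (pm_chart j);
  pm_inv_continuous : forall j, continuous (pm_inv j);
  pm_transition : forall j k, polynomial_map (pm_chart k \o pm_inv j) }.

(* The polynomial transition maps make the conditions for the different charts
   equivalent, and the topologies they define equal. *)
Definition pm_schwartz_lcs (R : realType) (X : polyManifold R) : lcs R :=
  @Lcs R (X -> R[i] : lmodType R[i])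
    [set a : X -> R[i] | forall j, schwartz_fun (a \o pm_inv j)]
    (@pm_idx R X * (nat * seq 'rV[R]_(pm_dim X)))%type
    (fun i a => schwartz_sn i.2 (a \o pm_inv i.1)).

(* A norm on the finite-dimensional space Xi only serves to give it its
   topology. *)
Record weyl_data (R : realType) := WeylData {
  wM : topGroupType;
  wLie : tvsType R;
  wAtlas : set (chart wM wLie);
  wChart1 : chart wM wLie;
  wExp : wLie -> wM;
  wH : completeNormedModType R[i];
  wIp : {dot wH for (@conjc R)};
  wPi : wM -> wH -> wH;
  wXi : normedModType R;
  wdX : {measure set (borel wXi) -> \bar R};
  wXis : polyManifold R;
  wdXis : {measure set (borel wXis) -> \bar R};
  wPair : wXis -> wXi -> R;
  wTheta : {linear wXi -> wLie} }.

Arguments wAtlas {R} w.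
Arguments wChart1 {R} w.
Arguments wExp {R} w _.
Arguments wIp {R} w.
Arguments wPi {R} w _ _.
Arguments wPair {R} w _ _.

Section WeylCalculus.
Variables (R : realType) (W : weyl_data R).
Local Notation M := (wM W).
Local Notation mm := (wLie W).
Local Notation H := (wH W).
Local Notation Xi := (wXi W).
Local Notation Xis := (wXis W).
Local Notation ip := (wIp W).
Local Notation pi := (wPi W).
Local Notation expM := (wExp W).
Local Notation dX := (wdX W).
Local Notation dXis := (wdXis W).
Local Notation theta := (wTheta W).

Definition Hinf : lcs R :=
  @smooth_lcs R M mm (wAtlas W) expM (hilbert_lcs H) pi.

Definition dpi (u : seq (R[i] * seq mm)) (f : H) : H :=
  @denv R M mm expM (hilbert_lcs H) pi u f.

Definition embH (f : H) : H -> R[i] :=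
  fun g => if `[< @ldom R Hinf g >] then ip f g else 0.

Definition rep2 (m : M * M) (T : H -> H) : H -> H :=
  pi m.1 \o T \o pi m.2^-1%g.

Definition exp2 (X : mm * mm) : M * M := (expM X.1, expM X.2).

Definition atlas2 := prod_atlas (wAtlas W) (wAtlas W).

Definition Binf : lcs R :=
  @smooth_lcs R (M * M)%type (mm * mm)%type atlas2 exp2 (hs_lcs ip) rep2.

(* The algebraic tensor product of H_oo with its complex conjugate, realized as
   the span of the operators (. | g) f, with the projective topology. *)
Definition proj_sn (p q : H -> R) (T : H -> H) : R :=
  inf [set r | exists n (f g : 'I_n -> H),
    [/\ forall i, @ldom R Hinf (f i) /\ @ldom R Hinf (g i),
        T = (fun h => \sum_(i < n) rank1 ip (f i) (g i) h) &
        r = \sum_(i < n) p (f i) * q (g i)]].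

Definition proj_lcs : lcs R :=
  @Lcs R (H -> H : lmodType R[i])
    [set T : H -> H | exists n (f g : 'I_n -> H),
       (forall i, @ldom R Hinf (f i) /\ @ldom R Hinf (g i)) /\
       T = (fun h => \sum_(i < n) rank1 ip (f i) (g i) h)]
    ({p : H -> R | @continuous_seminorm R Hinf p} *
     {q : H -> R | @continuous_seminorm R Hinf q})%type
    (fun i => proj_sn (proj1_sig i.1) (proj1_sig i.2)).

(* [Binf], i.e. B(H)_oo, is the completion of [proj_lcs], i.e. the completed
   projective tensor product, and restriction from H_{-oo} to H (embedded by
   [embH]) identifies L(H_{-oo}, H_oo) with B(H)_oo. *)
Definition natural_isomorphisms : Prop :=
  [/\ @ldom R proj_lcs `<=` @ldom R Binf,
      @ldense R Binf (@ldom R proj_lcs),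
      forall T : H -> H, @ldom R proj_lcs T ->
        @lnbhs R proj_lcs T = within (@ldom R proj_lcs) (@lnbhs R Binf T),
      lseq_complete Binf &
      @top_iso R (Lb (antidual Hinf) Hinf) Binf (fun T f => T (embH f))].

Definition twice_nuclearly_smooth : Prop :=
  [/\ @nuclearly_smooth R M mm (wAtlas W) expM (hilbert_lcs H)
        pi,
      @nuclearly_smooth R (M * M)%type (mm * mm)%type atlas2 exp2
        (hs_lcs ip) rep2 &
      natural_isomorphisms].

Definition SXi : lcs R := schwartz_lcs Xi.

Definition SXis : lcs R := pm_schwartz_lcs Xis.

Definition tempered : lcs R := antidual SXis.

Definition fourier (b : Xi -> R[i]) (xi : Xis) : R[i] :=
  cint dX (fun x : Xi =>
    Complex (cos (wPair W xi x)) (- sin (wPair W xi x)) * b x).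

Definition fourier_unitary : Prop :=
  exists U : (Xi -> R[i]) -> (Xis -> R[i]),
    [/\ forall b, L2 dX b ->
          L2 dXis (U b) /\ L2norm dXis (U b) = L2norm dX b,
        forall (k : R[i]) b c, L2 dX b -> L2 dX c ->
          {ae dXis, forall xi, U (k *: b + c) xi = k * U b xi + U c xi},
        forall a, L2 dXis a ->
          exists2 b, L2 dX b & {ae dXis, forall xi, U b xi = a xi} &
        forall b, cintegrable dX b -> L2 dX b ->
          {ae dXis, forall xi, U b xi = fourier b xi}].

Definition piX (X : Xi) : H -> H := pi (expM (theta X)).

Definition ambiguity (phi f : H) (X : Xi) : R[i] := ip f (piX X phi).

(* For f and phi in H_oo, where this Fourier integral is absolutely
   convergent. *)
Definition wigner (f phi : H) : Xis -> R[i] := fourier (ambiguity phi f).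

(* The inverse of the Fourier isomorphism between the Schwartz spaces; Op, the
   weak integral of fourier_inv a against pi_X, is only used on S(Xi^* ), and
   Opd below is its extension to tempered distributions. *)
Definition fourier_inv (a : Xis -> R[i]) : Xi -> R[i] :=
  xget 0 [set b | @ldom R SXi b /\ fourier b = a].

Definition Op (a : Xis -> R[i]) (f : H) : H :=
  xget 0 [set h | forall g, ip h g =
    cint dX (fun X : Xi => fourier_inv a X * ip (piX X f) g)].

Definition orthogonality_relations : Prop :=
  (forall phi f, L2 dX (ambiguity phi f)) /\
  (forall f1 f2 phi1 phi2,
    L2dot dX (ambiguity phi1 f1) (ambiguity phi2 f2) =
      ip f1 f2 * ip phi2 phi1).

Definition density_condition : Prop :=
  forall h : Xi -> R[i], L2 dX h -> forall e : R, 0 < e ->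
  exists n (c : 'I_n -> R[i]) (phi f : 'I_n -> H),
    (L2norm dX
      (fun X : Xi => h X - \sum_(i < n) c i * ambiguity (phi i) (f i) X)%R
     < e%:E)%E.

Definition polynomial_growth : Prop :=
  forall u phi0, @ldom R Hinf phi0 ->
  exists (c : R) (N : nat), forall X : Xi,
    hnorm (dpi u (piX X phi0)) <= c * (1 + `|X|) ^+ N.

Record standing_setting : Prop := StandingSetting {
  ss_lie_group : is_lie_group (wAtlas W) (wChart1 W);
  ss_exponential : is_smooth_exponential (wAtlas W) (wChart1 W) expM;
  ss_hilbert : forall f : H, `|f| ^+ 2 = ip f f;
  ss_unitary : is_unitary_rep ip pi;
  ss_twice_nuclearly_smooth : twice_nuclearly_smooth;
  ss_finite_dimensional : finite_dimensional Xi;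
  ss_lebesgue : is_lebesgue dX;
  ss_radon : is_radon dXis;
  ss_pair_linear : forall (xi : Xis) (k : R) x y,
    wPair W xi (k *: x + y) = k * wPair W xi x + wPair W xi y;
  ss_fourier_schwartz : @top_iso R SXi SXis fourier;
  ss_fourier_unitary : fourier_unitary;
  ss_orthogonality : orthogonality_relations;
  ss_density : density_condition;
  ss_regularity : @top_iso R SXis Binf Op;
  ss_growth : polynomial_growth }.

(* Op^theta(a) for a tempered distribution a, as the map
   f |-> (g |-> (Op(a) f | g)) from H_oo to H_{-oo}, extended by 0. *)
Definition Opd (a : (Xis -> R[i]) -> R[i]) (f g : H) : R[i] :=
  if `[< @ldom R Hinf f /\ @ldom R Hinf g >] then a (wigner g f) else 0.

(* The pairing of H_{-oo} with H_oo extends the inner product, so that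
   (Op(a2) f | phi_Y) is [Opd a2 f (piX Y phi)]. *)
Definition weak_integrand (phi : H) (a1 a2 : (Xis -> R[i]) -> R[i]) (f g : H)
    (Y : Xi) : R[i] :=
  Opd a2 f (piX Y phi) * Opd a1 (piX Y phi) g.

Definition weak_product (phi : H) (a1 a2 : (Xis -> R[i]) -> R[i]) (f g : H) :
    R[i] :=
  if `[< @ldom R Hinf f /\ @ldom R Hinf g >] then
    creal (hnorm phi ^- 2) * cint dX (weak_integrand phi a1 a2 f g)
  else 0.

(* Op(a1) Op(a2) is a well-defined element of L(H_oo, H_{-oo}). *)
Definition weak_product_defined (phi : H) (a1 a2 : (Xis -> R[i]) -> R[i]) :
    Prop :=
  (forall f g, @ldom R Hinf f -> @ldom R Hinf g ->
     cintegrable dX (weak_integrand phi a1 a2 f g)) /\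
  @ldom R (Lb Hinf (antidual Hinf)) (weak_product phi a1 a2).

Definition is_moyal (phi : H) (a1 a2 a : (Xis -> R[i]) -> R[i]) : Prop :=
  @ldom R tempered a /\ Opd a = weak_product phi a1 a2.

Definition moyal (phi : H) (a1 a2 : (Xis -> R[i]) -> R[i]) :
    (Xis -> R[i]) -> R[i] :=
  xget 0 (is_moyal phi a1 a2).

Definition rep_sd (m : M * M) (T : H -> H) : H -> H :=
  pi (m.1 * m.2)%g \o T \o pi m.1^-1%g.

(* Only the restriction of pi^# to S(Xi^* ) is needed, and there the unitary
   extension of Op to L^2 is not involved. *)
Definition rep_sharp (m : M * M) (F : Xis -> R[i]) : Xis -> R[i] :=
  xget 0 [set F' | @ldom R SXis F' /\ Op F' = rep_sd m (Op F)].

Definition ambiguity_sharp (Phi : Xis -> R[i]) (F : (Xis -> R[i]) -> R[i])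
    (X1 X2 : Xi) : R[i] :=
  F (rep_sharp (sdexp expM (theta X1, theta X2)) Phi).

Definition modulation_norm (r s : \bar R) (Phi : Xis -> R[i])
    (F : (Xis -> R[i]) -> R[i]) : \bar R :=
  Lnorm dX s (fun X2 : Xi =>
    Lnorm dX r (fun X1 : Xi => (cabs (ambiguity_sharp Phi F X1 X2))%:E)).

Definition modulation_space (r s : \bar R) (Phi : Xis -> R[i]) : lcs R :=
  @Lcs R ((Xis -> R[i]) -> R[i] : lmodType R[i])
    [set F | @ldom R tempered F /\ (modulation_norm r s Phi F < +oo)%E]
    unit (fun _ F => fine (modulation_norm r s Phi F)).

End WeylCalculus.

(* Main.v *)
Require Import Defs.
From HB Require Import structures.
From mathcomp Require Import all_boot all_order all_algebra.
From mathcomp Require Import all_classical all_reals all_analysis.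
From mathcomp Require Import measurable_realfun ess_sup_inf.
From mathcomp.real_closed Require Import complex.
From mathcomp Require Import ring lra.

(** Write [phi_X] for [piX X phi], [r] for [1 / |phi|^2] and, for a tempered
    distribution [a], [w_a f g = (Op a f | g)]. As [Op] maps
    [W (phi_(X1 + X2), phi_X1)] to the rank one operator of these two vectors,
    the ambiguity function of [a] for [pi^#] is
    [A_a (X1, X2) = w_a phi_X1 phi_(X1 + X2)] ([rep_sharp_wigner]). The modulation
    norm of [a] is thus a mixed Lebesgue norm of the kernel
    [(X, Y) |-> w_a phi_X phi_Y], written in the first point [X] and the
    displacement [Y - X].

    The orthogonality relations say that the orbit [phi_X] is a continuous
    resolution of the identity, so that the composition of operators becomes the
    composition of kernels. With [Y = X + V] one gets
    [A_c (X, U) = r * int A_a2 (X, V) A_a1 (X + V, U - V) dV] for the product [c]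
    of [a1] and [a2]. For fixed [V] Hoelder's inequality applies in [X], since
    [1 / p1 + 1 / p2 = 1 / p]; Minkowski's inequality moves the [p]-norm inside
    the integral over [V], and what remains is a convolution of the norms of the
    sections as functions of the displacement, to which Young's inequality applies,
    since [1 / q1 + 1 / q2 = 1 + 1 / q]. This is [twisted_convolution_estimate]. The
    norm of the product is hence at most a constant times the product of the norms,
    which gives continuity.

    The larger part of the work makes the weak integral meaningful and identifies
    it with a distribution. It concerns bounded forms, the sesquilinear forms on
    smooth vectors with a bound by seminorms.

    - [Op] carries the topology of the Schwartz space to the projective topology on
      finite rank operators, so that [W (f, g)] depends continuously on [f] and [g]
      ([wigner_small]). Consequently the forms [w_a] are bounded, and the matrix
      coefficients of smooth vectors decay rapidly ([ambiguity_decay]), faster than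
      the seminorms of [phi_X] grow.

    - Every continuous functional [l] satisfies
      [l f = r * int (f | phi_X) l phi_X dX] ([reproducing]). For inner products this is
      the orthogonality relation, and the functionals of the form [Q (., h)], where
      [Q] is a semi-inner product defining a continuous seminorm, are inner products
      because [dpi] has formal adjoints. These functionals approximate all others
      by a Riesz argument without completeness ([approximate_riesz]).

    - Applied to both arguments of the two forms, this formula bounds the weak
      integrand by an integral over [X], [Y] and [Z] of the two kernels with rapidly
      decreasing weights in [X] and [Z]. By Peetre's inequality the product of these
      weights is at most a product of weights in [X] and in the displacement
      [Z - X], so that mixed Hoelder inequalities and the estimate for the twisted
      convolution apply ([weighted_composition_bound]). The weak product of symbols
      in modulation spaces is therefore a bounded form.

    - Every bounded form [w] is [w_a] for some [a] ([kernel_theorem]), namely for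
      [a Psi = r * int w phi_X (Op Psi phi_X) dX]; this converges since [Op Psi] extends
      continuously to the antidual, where the vectors [phi_X] multiplied by any power
      of [1 + |X|] form a bounded set. The distribution [a] is unique because finite
      rank operators are dense ([tempered_ext]). *)


Set Implicit Arguments.
Unset Strict Implicit.
Unset Printing Implicit Defensive.

Import Order.TTheory GRing.Theory Num.Theory numFieldNormedType.Exports.

Local Open Scope classical_set_scope.
Local Open Scope ring_scope.

(** * Finite-dimensional spaces *)

Lemma sum_continuous (R : realType) (T : topologicalType) (E : tvsType R)
    (I : Type) (r : seq I) (f : I -> T -> E) :
  (forall i, continuous (f i)) -> continuous (fun x => \sum_(i <- r) f i x).
Proof.
move=> cf; elim: r => [|i r IH] x.
  by rewrite (_ : (fun _ => _) = cst 0); [exact: cvg_cst|apply/funext => y; rewrite big_nil].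
rewrite (_ : (fun _ => _) = fun y => f i y + \sum_(j <- r) f j y); last first.
  by apply/funext => y; rewrite big_cons.
apply: (@continuous2_cvg _ _ _ _ _ _ (f i) (fun x => \sum_(j <- r) f j x)
  (fun a b : E => a + b)); [|exact: cf|exact: IH].
exact: (@add_continuous E (f i x, _)).
Qed.

Section FiniteDimensional.
Variables (R : realType) (V : normedModType R).

Definition lin_comb n (b : 'I_n -> V) (c : 'rV[R]_n) : V := \sum_(i < n) c 0 i *: b i.

Lemma lin_combD n (b : 'I_n -> V) c d :
  lin_comb b (c + d) = lin_comb b c + lin_comb b d.
Proof. by rewrite /lin_comb -big_split; apply: eq_bigr => i _; rewrite mxE scalerDl. Qed.

Lemma lin_combZ n (b : 'I_n -> V) k c : lin_comb b (k *: c) = k *: lin_comb b c.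
Proof. by rewrite /lin_comb scaler_sumr; apply: eq_bigr => i _; rewrite mxE scalerA. Qed.

Lemma lin_combB n (b : 'I_n -> V) c d :
  lin_comb b (c - d) = lin_comb b c - lin_comb b d.
Proof. by rewrite lin_combD -scaleN1r lin_combZ scaleN1r. Qed.

Lemma lin_comb_continuous n (b : 'I_n -> V) : continuous (lin_comb b).
Proof.
apply: (@sum_continuous R _ V) => i c.
by apply: (@cvgZr_tmp R V _ (nbhs c) _ (fun d : 'rV[R]_n => d 0 i)); exact: (@coord_continuous R 1 n 0 i).
Qed.

(** A nontrivial relation expresses one member of a spanning family by the
    others, which span as well. *)
Lemma exists_basis : finite_dimensional V ->
  exists n (b : 'I_n -> V), (forall x, exists c, x = lin_comb b c) /\
    (forall c, lin_comb b c = 0 -> c = 0).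
Proof.
case=> n [b hb].
have [k] := ubnP n; elim: k n b hb => // k IH n b hb nk.
have sp x : exists c, x = lin_comb b c.
  case: (hb x) => c ->; exists (\row_i c i).
  by apply: eq_bigr => i _; rewrite mxE.
have [inj|] := pselect (forall c, lin_comb b c = 0 -> c = 0); first by exists n, b.
move=> /existsNP[c /not_implyP[c0 cN0]].
have [i ci] : exists i, c 0 i != 0.
  apply: contrapT => /forallNP ci; apply: cN0; apply/rowP => i; rewrite mxE.
  by apply/eqP/negPn/negP.
case: n b hb nk sp c c0 cN0 i ci => [b hb nk sp c c0 cN0 []//|n b hb nk sp c c0 cN0 i ci].
apply: (IH n (fun j => b (lift i j))); last exact: nk.
move=> x; case: (sp x) => d dx.
pose e := d - (d 0 i / c 0 i) *: c.
have xe : x = lin_comb b e by rewrite lin_combB lin_combZ c0 scaler0 subr0.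
have ei : e 0 i = 0 by rewrite !mxE divfK ?subrr.
exists (fun j => e 0 (lift i j)).
by rewrite xe /lin_comb (bigD1_ord i)//= ei scale0r add0r.
Qed.

(** On a finite-dimensional space the coordinates are bounded: the norm of a
    linear combination has a positive minimum on the compact unit sphere. *)
Lemma bounded_coordinates : finite_dimensional V ->
  exists n (b : 'I_n -> V) (co : V -> 'rV[R]_n) (c0 : R),
    [/\ 0 < c0, cancel co (lin_comb b), cancel (lin_comb b) co &
        forall x, `|co x| <= c0 * `|x|].
Proof.
move=> /exists_basis[n [b [sp inj]]].
have /choice[co coK] : forall x, exists c, lin_comb b c = x.
  by move=> x; case: (sp x) => c ->; exists c.
have Kco : cancel (lin_comb b) co.
  move=> c; apply/eqP; rewrite -subr_eq0; apply/eqP; apply: inj.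
  by rewrite lin_combB coK subrr.
pose S : set 'rV[R]_n := [set c | `|c| = 1].
have [[c Sc]|S0] := pselect (S !=set0).
- have cS : compact S.
    apply: bounded_closed_compact.
      exists 1; split=> // M M1 x Sx /=; rewrite -(Sx : `|x| = 1) in M1; exact: ltW.
    rewrite (_ : S = (fun c : 'rV[R]_n => `|c|) @^-1` [set 1])//.
    apply: closed_comp => // x _; exact: norm_continuous.
  have [d Sd dmin] : exists2 d, d \in S & forall t, t \in S ->
      `|lin_comb b d| <= `|lin_comb b t|.
    apply: (@EVT_min_rV R n (fun c => `|lin_comb b c|)) => //; first by exists c.
    apply: continuous_subspaceT => x.
    apply: (@continuous_comp _ _ _ (lin_comb b) (fun y => `|y|)).
      exact: lin_comb_continuous.
    exact: norm_continuous.
  have m0 : 0 < `|lin_comb b d|.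
    rewrite normr_gt0; apply/eqP => /inj d0; move: Sd; rewrite inE /S/= d0 normr0 => /eqP.
    by rewrite eq_sym oner_eq0.
  exists n, b, co, `|lin_comb b d|^-1; split => //; first by rewrite invr_gt0.
  move=> x; rewrite mulrC ler_pdivlMr//.
  have [->|cx] := eqVneq (co x) 0; first by rewrite normr0 mul0r.
  have := dmin (`|co x|^-1 *: co x); rewrite lin_combZ coK normrZ normfV normr_id.
  rewrite mulrC ler_pdivlMr ?normr_gt0// mulrC; apply.
  by rewrite inE /S/= normrZ normfV normr_id mulVf// normr_eq0.
(* there are no unit vectors in dimension zero *)
- exists n, b, co, 1; split => // x.
  have [->|cx] := eqVneq (co x) 0; first by rewrite normr0 mul1r.
  case: S0; exists (`|co x|^-1 *: co x).
  by rewrite /S/= normrZ normfV normr_id mulVf// normr_eq0.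
Qed.

End FiniteDimensional.

(** * Nonnegative integrals and Borel sets *)

Section NonnegativeIntegrals.
Context d (T : measurableType d) (R : realType).
Variable mu : {measure set T -> \bar R}.
Local Open Scope ereal_scope.

(** The integral of a nonnegative function is a supremum over simple functions
    below it, so its monotonicity is independent of measurability. *)
Lemma le_ge0_integral (f g : T -> \bar R) :
  (forall x, 0 <= f x) -> (forall x, f x <= g x) ->
  \int[mu]_x f x <= \int[mu]_x g x.
Proof.
move=> f0 fg.
have g0 x : 0 <= g x by exact: le_trans (f0 x) (fg x).
rewrite !ge0_integralTE//; apply: le_ereal_sup => _ [h hf <-].
by exists h => // x; exact: le_trans (hf x) (fg x).
Qed.

End NonnegativeIntegrals.

Section SigmaFiniteAlias.
Context d (T : measurableType d) (R : realType).
Variables (mu : {measure set T -> \bar R}) (sf : sigma_finite setT mu).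

(** An alias of a measure carrying a proof that it is sigma-finite, as the
    theory of product measures asks for a sigma-finite structure. *)
Definition sigma_finite_alias (_ : sigma_finite setT mu) : set T -> \bar R := mu.

HB.instance Definition _ := Measure.on (sigma_finite_alias sf).
HB.instance Definition _ :=
  @Measure_isSigmaFinite.Build _ _ _ (sigma_finite_alias sf) sf.

End SigmaFiniteAlias.

Section Tonelli.
Context d1 d2 (T1 : measurableType d1) (T2 : measurableType d2) (R : realType).
Variables (m1 : {measure set T1 -> \bar R}) (m2 : {measure set T2 -> \bar R}).
Hypothesis sf1 : sigma_finite setT m1.
Hypothesis sf2 : sigma_finite setT m2.
Local Open Scope ereal_scope.
Variable f : T1 * T2 -> \bar R.
Hypothesis mf : measurable_fun [set: T1 * T2] f.
Hypothesis f0 : forall x, 0 <= f x.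

Lemma tonelli : \int[m1]_x \int[m2]_y f (x, y) = \int[m2]_y \int[m1]_x f (x, y).
Proof.
exact: (@fubini_tonelli _ _ _ _ _ (sigma_finite_alias sf1) (sigma_finite_alias sf2)).
Qed.

Lemma measurable_partial_integral : measurable_fun setT (fun x => \int[m2]_y f (x, y)).
Proof.
exact: (@measurable_fun_fubini_tonelli_F _ _ _ _ _ (sigma_finite_alias sf2)).
Qed.

End Tonelli.

Section BorelMeasurability.
Variable R : realType.

Lemma open_measurable_borel (T : ptopologicalType) (U : set T) :
  open U -> measurable (U : set (borel T)).
Proof. exact: sub_sigma_algebra. Qed.

Lemma closed_measurable_borel (T : ptopologicalType) (U : set T) :
  closed U -> measurable (U : set (borel T)).
Proof.
move=> cU; rewrite -[X in measurable X]setCK; apply: measurableC.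
by apply: open_measurable_borel; exact: closed_openC.
Qed.

Lemma measurable_fun_real_open d (T : measurableType d) (f : T -> R) :
  (forall U : set R, open U -> measurable (f @^-1` U)) -> measurable_fun setT f.
Proof.
move=> h; apply: (measurability _ (RGenOpens.measurableE R)).
move=> _ [_ [a [b ->] <-]]; rewrite setTI; apply: h; exact: interval_open.
Qed.

Lemma measurable_fun_borel_open d (T : measurableType d) (S : ptopologicalType)
    (f : T -> borel S) :
  (forall U : set S, open U -> measurable (f @^-1` U)) -> measurable_fun setT f.
Proof.
move=> h. refine (@measurability _ _ _ (borel S) setT f (@open S) _ _); first by [].
by move=> _ [U oU <-]; rewrite setTI; exact: h.
Qed.

Lemma continuous_measurable_borel (T : ptopologicalType) (f : T -> R) :
  continuous f -> measurable_fun setT (f : borel T -> R).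
Proof.
move=> cf; apply: measurable_fun_real_open => U oU.
apply: open_measurable_borel; by apply: open_comp => // x _; exact: cf.
Qed.

Lemma continuous_measurable_borel2 (T S : ptopologicalType) (f : T -> S) :
  continuous f -> measurable_fun setT (f : borel T -> borel S).
Proof.
move=> cf; apply: measurable_fun_borel_open => U oU.
apply: open_measurable_borel; by apply: open_comp => // x _; exact: cf.
Qed.

End BorelMeasurability.

Section BorelProduct.
Variables (R : realType) (V : normedModType R).
Hypothesis hfd : finite_dimensional V.

Lemma exists_dense_sequence :
  exists d : nat -> V, forall x e, 0 < e -> exists n, `|x - d n| < e.
Proof.
have [n [b [co [c0 [_ coK _ _]]]]] := bounded_coordinates hfd.
exists (fun k => lin_comb b (map_mx ratr (odflt (0 : 'rV[rat]_n) (unpickle k)))).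
move=> x e e0.
pose M := \sum_(i < n) `|b i| + 1.
have M0 : 0 < M by rewrite ltr_pwDr// sumr_ge0.
have /choice[q hq] : forall i : 'I_n, exists q : rat, `|co x 0 i - ratr q| < e / M.
  move=> i; have eM : 0 < e / M by rewrite divr_gt0.
  have [|q hq] := @rat_in_itvoo R (co x 0 i - e / M) (co x 0 i + e / M); first by lra.
  by exists q; move: hq; rewrite in_itv/= ltr_norml => /andP[? ?]; lra.
exists (pickle (\row_i q i)); rewrite pickleK/= -{1}(coK x) -lin_combB /lin_comb.
apply: le_lt_trans (ler_norm_sum _ _ _) _.
apply: (@le_lt_trans _ _ (\sum_(i < n) (e / M) * `|b i|)).
  apply: ler_sum => i _; rewrite normrZ !mxE ler_wpM2r//; exact: ltW.
rewrite -mulr_sumr -mulrA gtr_pMr// mulrC ltr_pdivrMr// mul1r /M ltrDl//.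
Qed.

(** A finite-dimensional space is second countable, so that an open subset of
    the product is a countable union of rectangles. *)
Lemma open_measurable_prod (U : set (V * V)) :
  open U -> measurable (U : set (borel V * borel V)).
Proof.
move=> oU; have [d hd] := exists_dense_sequence.
pose Q i j k : set (borel V * borel V) :=
  if `[< ball (d i) k.+1%:R^-1 `*` ball (d j) k.+1%:R^-1 `<=` U >]
  then (ball (d i) k.+1%:R^-1 `*` ball (d j) k.+1%:R^-1) else set0.
rewrite (_ : U = \bigcup_i \bigcup_j \bigcup_k Q i j k); last first.
  apply/seteqP; split => [[x y] Uxy|z [i _ [j _ [k _]]]]; last first.
    by rewrite /Q; case: asboolP => // h; exact: h.
  have /nbhs_ballP[e /= e0 he] : nbhs (x, y) U by exact: open_nbhs_nbhs.
  have [k hk] : exists k : nat, k.+1%:R^-1 < e / 2.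
    have e2 : 0 < e / 2 by rewrite divr_gt0.
    have [k _ hk] := near_infty_natSinv_lt (PosNum e2).
    by exists k; exact: (hk k (leqnn k)).
  have k0 : (0 : R) < k.+1%:R^-1 by rewrite invr_gt0.
  have [i hi] := hd x _ k0; have [j hj] := hd y _ k0.
  exists i => //; exists j => //; exists k => //.
  rewrite /Q; case: asboolP; last first.
    case=> -[x' y'] [/=]; rewrite -!ball_normE /= => hx hy.
    apply: he; split; rewrite /= -ball_normE /=.
      rewrite -(subrKA (d i)); apply: le_lt_trans (ler_normD _ _) _.
      by rewrite (splitr e); apply: ltrD; apply: lt_trans hk.
    rewrite -(subrKA (d j)); apply: le_lt_trans (ler_normD _ _) _.
    by rewrite (splitr e); apply: ltrD; apply: lt_trans hk.
  by move=> _; split; rewrite /= -ball_normE /= distrC.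
apply: bigcup_measurable => i _; apply: bigcup_measurable => j _.
apply: bigcup_measurable => k _; rewrite /Q; case: ifP => // _.
by apply: measurableX; apply: open_measurable_borel; exact: ball_open.
Qed.

Lemma continuous_measurable_prod (f : V * V -> R) :
  continuous f -> measurable_fun setT (f : borel V * borel V -> R).
Proof.
move=> cf; apply: measurable_fun_real_open => U oU; apply: open_measurable_prod.
by apply: open_comp => // x _; exact: cf.
Qed.

Lemma continuous_measurable_prod_borel (S : ptopologicalType) (f : V * V -> S) :
  continuous f -> measurable_fun setT (f : borel V * borel V -> borel S).
Proof.
move=> cf; apply: measurable_fun_borel_open => U oU; apply: open_measurable_prod.
by apply: open_comp => // x _; exact: cf.
Qed.

End BorelProduct.

Section SectionContinuity.
Variables (R : realType) (V : normedModType R).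

Lemma continuous_section (B : V -> V -> R) x :
  continuous (fun z : V * V => B z.1 z.2) -> continuous (B x).
Proof.
move=> cB y; apply: (@continuous_comp _ _ _ (fun y => (x, y)) (fun z : V * V => B z.1 z.2)).
  by apply: cvg_pair; [exact: cvg_cst|exact: cvg_id].
exact: cB.
Qed.

Lemma continuous_cosection (B : V -> V -> R) y :
  continuous (fun z : V * V => B z.1 z.2) -> continuous (B ^~ y).
Proof.
move=> cB x; apply: (@continuous_comp _ _ _ (fun x => (x, y)) (fun z : V * V => B z.1 z.2)).
  by apply: cvg_pair; [exact: cvg_id|exact: cvg_cst].
exact: cB.
Qed.

Lemma continuous_displacement (B : V -> V -> R) :
  continuous (fun z : V * V => B z.1 z.2) ->
  continuous (fun z : V * V => B z.1 (z.1 + z.2)%R).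
Proof.
move=> cB z; apply: (@continuous_comp _ _ _ (fun z : V * V => (z.1, z.1 + z.2)%R) (fun z : V * V => B z.1 z.2)).
  by apply: cvg_pair; [exact: cvg_fst|exact: add_continuous].
exact: cB.
Qed.

End SectionContinuity.

(** * Lebesgue measures *)

Section LebesgueMeasure.
Variables (R : realType) (V : normedModType R).
Variable mu : {measure set (borel V) -> \bar R}.
Hypothesis hfd : finite_dimensional V.
Hypothesis hleb : is_lebesgue mu.

(** Images of the balls of the coordinate space; their symmetry serves in the
    proof that a Lebesgue measure is invariant under reflection. *)
Lemma exists_compact_exhaustion : exists K : nat -> set V,
  [/\ forall k, compact (K k), forall k x, K k x -> K k (- x) &
      forall x, exists k, K k x].
Proof.
have [n [b [co [c0 [c00 coK Kco hco]]]]] := bounded_coordinates hfd.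
pose S k : set 'rV[R]_n := [set c | `|c| <= k%:R].
exists (fun k => lin_comb b @` S k); split.
- move=> k; apply: continuous_compact.
    by apply: continuous_subspaceT; exact: lin_comb_continuous.
  apply: bounded_closed_compact.
    exists k%:R; split; first exact: realn.
    by move=> M kM c Sc /=; apply: le_trans Sc _; exact: ltW.
  rewrite (_ : S k = (fun c : 'rV[R]_n => `|c|) @^-1` [set t | t <= k%:R])//.
  by apply: closed_comp => [c _|]; [exact: norm_continuous|exact: closed_le].
- move=> k _ [c Sc <-]; exists (- c); first by rewrite /S/= normrN.
  by rewrite -scaleN1r lin_combZ scaleN1r.
- move=> x; exists (Num.truncn `|co x|).+1; exists (co x) => //.
  by rewrite /S/= ltW// truncnS_gt.
Qed.

Lemma lebesgue_compact_lty (K : set V) :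
  compact K -> measurable (K : set (borel V)) /\ (mu K < +oo)%E.
Proof.
case: hleb => _ h _ cK; split; last exact: h.
by apply: closed_measurable_borel; exact: compact_closed.
Qed.

Lemma lebesgue_sigma_finite : sigma_finite setT mu.
Proof.
have [K [cK _ covK]] := exists_compact_exhaustion.
exists K; last by move=> k; exact: lebesgue_compact_lty.
by apply/seteqP; split => // x _; case: (covK x) => k Kx; exists k.
Qed.

Lemma exists_symmetric_compact : exists K : set V,
  [/\ measurable (K : set (borel V)), forall x, K x -> K (- x),
      (0 < mu K)%E & (mu K < +oo)%E].
Proof.
have [K [cK sK covK]] := exists_compact_exhaustion.
suff [k k0] : exists k, (0 < mu (K k))%E.
  by exists (K k); have [mK Ky] := lebesgue_compact_lty (cK k); split => // x; exact: sK.
apply: contrapT => /forallNP h.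
have K0 k : mu (K k) = 0%E.
  apply/eqP; rewrite eq_le measure_ge0 andbT leNgt; apply/negP; exact: h.
case: hleb => _ _ /eqP; apply; apply/eqP; rewrite eq_le measure_ge0 andbT.
have : (mu setT <= \sum_(k <oo) mu (K k))%E.
  apply: measure_sigma_subadditive => //.
    by move=> k; have [] := lebesgue_compact_lty (cK k).
  by move=> x _; case: (covK x) => k Kx; exists k.
by rewrite eseries0.
Qed.

Lemma measurable_translation (a : V) :
  measurable_fun setT ((fun x : V => a + x) : borel V -> borel V).
Proof.
apply: continuous_measurable_borel2 => x; exact: (@cvgD R V _ (nbhs x) _ (cst a) id _ _ (cvg_cst _) cvg_id).
Qed.

Lemma measurable_reflection :
  measurable_fun setT ((fun x : V => - x) : borel V -> borel V).
Proof. by apply: continuous_measurable_borel2 => x; exact: opp_continuous. Qed.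

Lemma lebesgue_translation (a : V) (A : set (borel V)) :
  measurable A -> mu ((fun x : V => a + x) @^-1` A) = mu A.
Proof.
move=> mA; case: hleb => /(_ (- a) A mA) <- _ _; congr (mu _).
apply/seteqP; split => [x Ax|_ [y Ay <-]]; last by rewrite /= addNKr.
by exists (a + x) => //; rewrite addKr.
Qed.

Lemma integral_translation (a : V) (f : V -> \bar R) :
  measurable_fun setT (f : borel V -> \bar R) -> (forall x, 0 <= f x)%E ->
  (\int[mu]_x f (a + x)%R = \int[mu]_x f x)%E.
Proof.
move=> mf f0.
rewrite -[LHS](@ge0_integral_pushforward _ _ _ _ _ _ (measurable_translation a) mu setT f)//.
apply: eq_measure_integral => [|? A mA _]; first exact: measurable_translation.
exact: lebesgue_translation.
Qed.

Lemma integral_translation_to (a : V) (f : V -> \bar R) :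
  measurable_fun setT (f : borel V -> \bar R) -> (forall x, 0 <= f x)%E ->
  (\int[mu]_x f (x - a)%R = \int[mu]_x f x)%E.
Proof.
move=> mf f0; rewrite -[RHS](integral_translation (- a) mf f0).
by apply: eq_integral => x _; rewrite addrC.
Qed.

(** A Lebesgue measure is invariant under reflection: by Tonelli and
    translation invariance, the integrals of [f x] and [f (- x)] agree up to
    the factor relating those of [g], and [g] can be chosen symmetric. *)
Lemma integral_reflection (f : V -> \bar R) :
  measurable_fun setT (f : borel V -> \bar R) -> (forall x, 0 <= f x)%E ->
  (\int[mu]_x f (- x)%R = \int[mu]_x f x)%E.
Proof.
move=> mf f0.
have [K [mK sK K0 Koo]] := exists_symmetric_compact.
pose g (x : V) : \bar R := (\1_K x)%:E.
have mg : measurable_fun setT (g : borel V -> \bar R).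
  by apply/measurable_EFinP; exact: measurable_indic.
have g0 x : (0 <= g x)%E by rewrite lee_fin.
have gN x : g (- x) = g x.
  rewrite /g !indicE; congr ((nat_of_bool _)%:R%:E); apply/idP/idP; rewrite !inE => /sK //.
  by rewrite opprK.
have Ig : (\int[mu]_x g x = mu K)%E by rewrite integral_indic// setIT.
have sf := lebesgue_sigma_finite.
have mfN : measurable_fun setT ((fun x => f (- x)%R) : borel V -> \bar R).
  exact: (measurableT_comp mf measurable_reflection).
have m2 : measurable_fun setT (fun z : borel V * borel V => f ((z.1 : V) - (z.2 : V))%R : \bar R).
  apply: (@measurableT_comp _ _ _ (borel V * borel V)%type (borel V) _ f) => //.
  apply: continuous_measurable_prod_borel => //; exact: sub_continuous.
have m1 : measurable_fun setT (fun z : borel V * borel V => (f ((z.1 : V) - (z.2 : V))%R * g z.2)%E).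
  apply: emeasurable_funM => //; exact: (measurableT_comp mg measurable_snd).
have e1 : (\int[mu]_y \int[mu]_x (f (x - y)%R * g y) = (\int[mu]_x f x) * mu K)%E.
  rewrite -Ig -ge0_integralZl//; last exact: integral_ge0.
  apply: eq_integral => y _; rewrite ge0_integralZr//; first by rewrite (integral_translation_to y).
  exact: (measurableT_comp m2 (measurable_pair2 y)).
have e2 : (\int[mu]_x \int[mu]_y (f (x - y)%R * g y) = (\int[mu]_x f (- x)%R) * mu K)%E.
  transitivity (\int[mu]_x \int[mu]_y (f (- y)%R * g (x + y)%R))%E.
    apply: eq_integral => x _.
    rewrite -(integral_translation x (f := fun y => f (x - y)%R * g y)%E); first last.
    - by move=> y; exact: mule_ge0.
    - exact: (measurableT_comp m1 (measurable_pair1 x)).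
    by apply: eq_integral => y _; rewrite opprD addNKr.
  have m3 : measurable_fun setT (fun z : borel V * borel V => (f (- (z.2 : V))%R * g ((z.1 : V) + (z.2 : V))%R)%E).
    apply: emeasurable_funM; first exact: (measurableT_comp mfN measurable_snd).
    apply: (@measurableT_comp _ _ _ (borel V * borel V)%type (borel V) _ g) => //.
    apply: continuous_measurable_prod_borel => //; exact: add_continuous.
  have := @tonelli _ _ _ _ _ _ _ sf sf _ m3 (fun z => mule_ge0 (f0 _) (g0 _)).
  move=> /= ->.
  rewrite -ge0_integralZr//; apply: eq_integral => y _.
  rewrite ge0_integralZl//; last first.
    apply: (measurableT_comp mg); have := measurable_translation y.
    by under eq_fun do rewrite addrC.
  congr (_ * _)%E; rewrite -Ig -(integral_translation y mg g0).
  by apply: eq_integral => x _; rewrite addrC.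
have := @tonelli _ _ _ _ _ _ _ sf sf _ m1 (fun z => mule_ge0 (f0 _) (g0 _)).
rewrite /= e1 e2 => h.
have Kfin : mu K \is a fin_num by rewrite ge0_fin_numE// ltW.
have K0' : mu K != 0%E by rewrite gt_eqF.
have := congr1 (fun t => t * (mu K)^-1)%E h.
by rewrite -!muleA divee// !mule1.
Qed.

(** An open set of measure zero would have null translates along a dense
    sequence, and these cover the space. *)
Lemma lebesgue_open_gt0 (U : set V) : open U -> U !=set0 -> (0 < mu U)%E.
Proof.
move=> oU [x Ux]; rewrite lt0e measure_ge0 andbT; apply/eqP => U0.
have /nbhs_ballP[e /= e0 he] : nbhs x U by exact: open_nbhs_nbhs.
have mB y : measurable (ball (y : V) e : set (borel V)).
  by apply: open_measurable_borel; exact: ball_open.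
have B0 : mu (ball x e) = 0%E.
  apply/eqP; rewrite eq_le measure_ge0 andbT -U0; apply: le_measure => //; rewrite inE //.
  exact: open_measurable_borel.
have [d hd] := exists_dense_sequence hfd.
have Bd k : mu (ball (d k) e) = 0%E.
  rewrite -B0 -(@lebesgue_translation (x - d k) (ball x e))//; congr (mu _).
  have E y : x - (x - d k + y) = d k - y.
    by rewrite opprD opprB addrA (addrC x) subrK.
  by apply/seteqP; split => y; rewrite -!ball_normE /= E.
case: hleb => _ _ /eqP; apply; apply/eqP; rewrite eq_le measure_ge0 andbT.
have : (mu setT <= \sum_(k <oo) mu (ball (d k) e))%E.
  apply: measure_sigma_subadditive => //.
  by move=> y _; case: (hd y e e0) => k hk; exists k => //=; rewrite -ball_normE /= distrC.
by rewrite eseries0.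
Qed.

End LebesgueMeasure.

(** * Polynomial weights *)

Definition poly_weight (R : realType) (V : normedModType R) (N : nat) (x : V) : R :=
  (1 + `|x|) ^- N.

Section PolynomialWeights.
Variables (R : realType) (V : normedModType R).
Implicit Types (x y : V) (N M : nat).

Lemma poly_weight_base_ge1 x : 1 <= 1 + `|x|.
Proof. by rewrite lerDl. Qed.

Lemma poly_weight_base_gt0 x : 0 < 1 + `|x|.
Proof. exact: lt_le_trans ltr01 (poly_weight_base_ge1 x). Qed.

Lemma poly_weight_gt0 N x : 0 < poly_weight N x.
Proof. by rewrite invr_gt0 exprn_gt0// poly_weight_base_gt0. Qed.

Lemma poly_weight_ge0 N x : 0 <= poly_weight N x.
Proof. exact: ltW (poly_weight_gt0 N x). Qed.

Lemma poly_weight_le1 N x : poly_weight N x <= 1.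
Proof. by rewrite invf_le1 ?exprn_gt0 ?poly_weight_base_gt0// exprn_ege1// poly_weight_base_ge1. Qed.

Lemma poly_weightD N M x : poly_weight (N + M) x = poly_weight N x * poly_weight M x.
Proof. by rewrite /poly_weight exprD invfM. Qed.

Lemma poly_weightK N x : (1 + `|x|) ^+ N * poly_weight N x = 1.
Proof. by rewrite /poly_weight divff// gt_eqF// exprn_gt0// poly_weight_base_gt0. Qed.

Lemma poly_weight_base_shift x y : 1 + `|x + y| <= (1 + `|x|) * (1 + `|y|).
Proof.
have := ler_normD x y; have := mulr_ge0 (normr_ge0 x) (normr_ge0 y).
set a := `|x|; set b := `|y|; nra.
Qed.

(** Peetre's inequality, by which the weights survive translations: it is the
    submultiplicativity of [1 + |x|]. *)
Lemma poly_weight_shift N x y :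
  poly_weight N x * poly_weight N (x + y) <= poly_weight N y.
Proof.
rewrite /poly_weight -invfM -exprMn lef_pV2 ?posrE ?exprn_gt0 ?mulr_gt0 ?poly_weight_base_gt0//.
rewrite lerXn2r ?nnegrE ?mulr_ge0 ?(ltW (poly_weight_base_gt0 _))//.
have := poly_weight_base_shift (- x) (x + y).
by rewrite addKr normrN.
Qed.

Lemma poly_weight_continuous N : continuous (@poly_weight R V N).
Proof.
move=> x; apply: cvgV; first by rewrite gt_eqF// exprn_gt0// poly_weight_base_gt0.
have h : (fun y : V => 1 + `|y|) @ x --> 1 + `|x|.
  by apply: cvgD; [exact: cvg_cst|exact: norm_continuous].
exact: (cvg_comp _ _ h (@exprn_continuous R N _)).
Qed.

Lemma measurable_poly_weight N : measurable_fun setT (poly_weight N : borel V -> R).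
Proof. apply: continuous_measurable_borel; exact: poly_weight_continuous. Qed.

End PolynomialWeights.

Section WeightIntegrable.
Variables (R : realType) (V : normedModType R).
Variable mu : {measure set (borel V) -> \bar R}.
Hypothesis hfd : finite_dimensional V.
Hypothesis hleb : is_lebesgue mu.

(** The measure of a box grows polynomially with its size: a box of twice the
    size is covered by [2 ^ n] translates, one for each orthant. *)
Lemma lebesgue_box_growth : exists n (D : nat -> set V) (c : R),
  [/\ 1 <= c, forall j, measurable (D j : set (borel V)) /\ (mu (D j) < +oo)%E,
      forall j, (mu (D j) <= (2 ^+ (n * j))%:E * mu (D 0%N))%E,
      forall x, exists j, D j x &
      forall j x, ~ D j x -> 2 ^+ j <= c * (1 + `|x|)].
Proof.
have [n [b [co [c0 [c00 coK Kco hco]]]]] := bounded_coordinates hfd.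
pose box (r : R) : set V := lin_comb b @` [set c | `|c| <= r].
have boxP r x : box r x <-> `|co x| <= r.
  split => [[c cr <-]|xr]; first by rewrite Kco.
  by exists (co x).
have mbox r : measurable (box r : set (borel V)) /\ (mu (box r) < +oo)%E.
  apply: lebesgue_compact_lty => //; apply: continuous_compact.
    by apply: continuous_subspaceT; exact: lin_comb_continuous.
  apply: bounded_closed_compact.
    exists r; split; first exact: num_real.
    by move=> M kM c Sc /=; apply: le_trans Sc _; exact: ltW.
  rewrite (_ : mkset _ = (fun c : 'rV[R]_n => `|c|) @^-1` [set t | t <= r])//.
  by apply: closed_comp => [c _|]; [exact: norm_continuous|exact: closed_le].
have dbl (r : R) : 0 <= r -> (mu (box (r * 2)%R) <= (2 ^+ n)%:E * mu (box r))%E.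
  move=> r0; pose E := {ffun 'I_n -> bool}.
  pose s (e : E) : V := lin_comb b (\row_i (if e i then r else - r)).
  pose F k := (fun x : V => - s (nth [ffun=> true] (enum E) k) + x) @^-1` box r.
  have -> : ((2 ^+ n)%:E * mu (box r) = \sum_(k < #|E|) mu (F k))%E.
    rewrite (eq_bigr (fun=> mu (box r))); last first.
      by move=> k _; apply: lebesgue_translation => //; case: (mbox r).
    rewrite -natrX -[in LHS](card_ord n) -card_bool -card_ffun.
    elim: #|E| => [|m IH]; first by rewrite big_ord0 mul0e.
    by rewrite big_ord_recr/= -IH -addn1 natrD EFinD ge0_muleDl ?lee_fin// mul1e.
  apply: content_subadditive.
  - move=> k _; rewrite -[X in measurable X]setTI; apply: (measurable_translation) => //.
    by case: (mbox r).
  - by case: (mbox (r * 2)).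
  (* the signs of the coordinates of [x] select the translate that contains it *)
  - move=> x /boxP xr; pose e : E := [ffun i => 0 <= co x 0 i].
    rewrite -bigcup_mkord; exists (index e (enum E)).
      by rewrite /= cardE index_mem mem_enum.
    rewrite /F /= nth_index ?mem_enum//; apply/boxP.
    rewrite (_ : - s e + x = lin_comb b (co x - \row_i (if e i then r else - r))); last first.
      by rewrite lin_combB coK addrC.
    rewrite Kco [leLHS]/Num.norm /= mx_normrE; apply/bigmax_leP; split => // -[i j] _ /=.
    have : `|co x i j| <= r * 2.
      apply: le_trans xr; rewrite [leRHS]/Num.norm /= mx_normrE.
      by apply/bigmax_geP; right => /=; exists (i, j).
    rewrite !mxE ffunE (ord1 i) !ler_norml; case: ifP => [h|/negbT]; first lra.
    by rewrite -ltNge => h; lra.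
exists n, (fun j => box (2 ^+ j)), (Num.max 1 c0); split.
- by rewrite le_max lexx.
- by move=> j; exact: mbox.
- elim=> [|j IH]; first by rewrite muln0 expr0 mul1e.
  rewrite exprSr; apply: le_trans (dbl _ (exprn_ge0 _ _)) _ => //.
  rewrite mulnS exprD EFinM -muleA lee_pmul2l//.
- move=> x; exists (Num.truncn `|co x|).+1; apply/boxP.
  apply: ltW; apply: lt_le_trans (truncnS_gt _) _.
  by rewrite -natrX ler_nat ltnW// ltn_expl.
- move=> j x /boxP/negP; rewrite -ltNge => h; apply: ltW.
  apply: (lt_le_trans h); apply: le_trans (hco x) _.
  have := normr_ge0 x; have : c0 <= Num.max 1 c0 by rewrite le_max lexx orbT.
  have : 1 <= Num.max 1 c0 by rewrite le_max lexx.
  set m := Num.max _ _; set t := `|x|; nra.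
Qed.

(** Outside the box of size [2 ^ j] the weight of degree [n + 1] is of order
    [2 ^ - ((n + 1) j)], while the measure of that box is of order [2 ^ (n j)]:
    the integral is dominated by a geometric series. *)
Lemma poly_weight_integrable :
  exists N, (\int[mu]_x (poly_weight N x)%:E < +oo)%E.
Proof.
have [n [D [c [c1 mD gD cD hD]]]] := lebesgue_box_growth.
have c0 : 0 < c by exact: lt_le_trans ltr01 c1.
exists n.+1.
pose C : R := (2 * c) ^+ n.+1.
have C1 : 1 <= C by rewrite exprn_ege1//; lra.
pose a (j : nat) : R := C * 2 ^- (n.+1 * j).
have a0 j : 0 <= a j by rewrite mulr_ge0// ?invr_ge0 ?exprn_ge0//; lra.
have wa x : exists2 j, D j x & poly_weight n.+1 x <= a j.
  have ex : exists j, `[< D j x >] by case: (cD x) => j Dj; exists j; exact/asboolP.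
  case: (ex_minnP ex) => -[|j] /asboolP Dj minj.
    exists 0%N => //; rewrite /a muln0 expr0 invr1 mulr1.
    exact: le_trans (poly_weight_le1 _ _) C1.
  exists j.+1 => //.
  have /hD h : ~ D j x by move=> /asboolP /minj; rewrite ltnn.
  have x0 := poly_weight_base_gt0 x.
  rewrite /a /C /poly_weight mulnC exprM -exprVn -exprVn -exprMn -[leLHS]exprVn lerXn2r//.
  - by rewrite nnegrE invr_ge0 ltW.
  - by rewrite nnegrE mulr_ge0 ?invr_ge0 ?exprn_ge0//; lra.
  rewrite exprVn -[leLHS]mul1r ler_pdivrMr//.
  rewrite exprS invfM mulrACA mulfV ?pnatr_eq0// mul1r mulrAC ler_pdivlMr ?exprn_gt0//.
  by rewrite mul1r.
have ma j : measurable_fun setT (fun x : borel V => (a j * \1_(D j) x)%:E).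
  apply/measurable_EFinP; apply: measurable_funM => //.
  by apply: measurable_indic; case: (mD j).
have b0 j x : (0 <= (a j * \1_(D j) x)%:E)%E by rewrite lee_fin mulr_ge0// indicE.
apply: (@le_lt_trans _ _ (\int[mu]_x \sum_(j <oo) (a j * \1_(D j) x)%:E)%E).
  apply: le_ge0_integral => [x|x]; first by rewrite lee_fin poly_weight_ge0.
  case: (wa x) => j Dj xj.
  apply: le_trans (nneseries_lim_ge j.+1 _) => //.
  rewrite big_nat_recr//= indicE mem_set// mulr1.
  rewrite -[leLHS]add0e; apply: leeD; last by rewrite lee_fin.
  by apply: sume_ge0.
rewrite integral_nneseries//.
have Dfin : mu (D 0%N) \is a fin_num by rewrite ge0_fin_numE//; case: (mD 0%N).
pose r := C * fine (mu (D 0%N)) * 2.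
apply: (@le_lt_trans _ _ (\sum_(j <oo) (r / (2 ^ (j + 1))%:R)%:E)%E); last first.
  have /cvg_lim -> // := @cvg_geometric_eseries_half R r 0.
  by rewrite ltry.
apply: lee_nneseries => [j _ _|j _]; first exact: integral_ge0.
under eq_integral do rewrite EFinM.
rewrite ge0_integralZl//; last 2 first.
- by apply/measurable_EFinP; apply: measurable_indic; case: (mD j).
- by rewrite lee_fin.
rewrite integral_indic//; last by case: (mD j).
rewrite setIT; apply: le_trans (lee_wpmul2l _ (gD j)) _; first by rewrite lee_fin.
rewrite -[mu (D 0%N)]fineK// -!EFinM lee_fin /r addn1 expnS natrM natrX.
rewrite [leRHS](_ : _ = C * fine (mu (D 0%N)) / 2 ^+ j); last first.
  by rewrite invfM mulrA -[X in X / _]mulrA mulfV ?mulr1.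
rewrite /a mulSn exprD le_eqVlt; apply/orP; left; apply/eqP.
have : (2 : R) ^+ j != 0 by rewrite expf_neq0.
have : (2 : R) ^+ (n * j) != 0 by rewrite expf_neq0.
by set u := _ ^+ j; set v := _ ^+ (n * j) => v0 u0; field; rewrite u0 v0.
Qed.
End WeightIntegrable.

(** * Inequalities for Lebesgue norms *)

Local Open Scope ereal_scope.

Section PowerMeans.
Variable R : realType.
Implicit Types (x y : \bar R) (a b r : R).

Lemma le_poweR x y r : (0 <= r)%R -> 0 <= x -> x <= y -> x `^ r <= y `^ r.
Proof.
move=> r0 x0 xy; apply: gt0_ler_poweR => //; rewrite in_itv/= leey andbT//.
exact: le_trans x0 xy.
Qed.

Lemma poweRK x r : (r != 0)%R -> 0 <= x -> (x `^ r) `^ r^-1 = x.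
Proof. by move=> r0 x0; rewrite -poweRrM divff// poweRe1. Qed.

Lemma poweRVK x r : (r != 0)%R -> 0 <= x -> (x `^ r^-1) `^ r = x.
Proof. by move=> r0 x0; rewrite -poweRrM mulVf// poweRe1. Qed.

Lemma weighted_am_gm x y a b : 0 <= x -> 0 <= y -> (0 < a)%R -> (0 < b)%R ->
  (a + b = 1)%R -> x `^ a * y `^ b <= a%:E * x + b%:E * y.
Proof.
case: x y => [x| |] [y| |]// x0 y0 a0 b0 ab; last 3 first.
- by rewrite [X in _ <= _ + X]gt0_muley ?lte_fin// addey ?leey// -ltNye ltNyr.
- by rewrite [X in _ <= X + _]gt0_muley ?lte_fin// addye ?leey// -ltNye ltNyr.
- by rewrite !gt0_muley ?lte_fin//= leey.
rewrite !poweR_EFin -!EFinM -EFinD lee_fin.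
have := @conjugate_powR R (x `^ a)%R (y `^ b)%R a^-1%R b^-1%R.
rewrite !invrK -!powRrM !divff ?gt_eqF// !powRr1// ![(_ * a)%R]mulrC ![(_ * b)%R]mulrC.
by apply; rewrite ?powR_ge0 ?invr_gt0.
Qed.

End PowerMeans.

Section Hoelder.
Context d (T : measurableType d) (R : realType).
Variable mu : {measure set T -> \bar R}.
Implicit Types f g h : T -> \bar R.

Lemma measurable_fun_poweR f (r : R) :
  measurable_fun setT f -> measurable_fun setT (fun x => f x `^ r).
Proof. exact: (measurableT_comp (measurable_poweR r)). Qed.

Lemma integral_eq0_ae f : measurable_fun setT f -> (forall x, 0 <= f x) ->
  \int[mu]_x f x = 0 -> {ae mu, forall x, f x = 0}.
Proof.
move=> mf f0 If.
have /(ae_eq_integral_abs mu measurableT mf) : \int[mu]_x `|f x| = 0.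
  by rewrite -If; apply: eq_integral => x _; rewrite gee0_abs.
by apply: filterS => x; apply.
Qed.

Lemma integral0_ae f : measurable_fun setT f -> (forall x, 0 <= f x) ->
  {ae mu, forall x, f x = 0} -> \int[mu]_x f x = 0.
Proof.
move=> mf f0 fae; rewrite (@ge0_ae_eq_integral _ _ _ mu setT f (cst 0))//.
  by rewrite integral0.
by apply: filterS fae => x ->.
Qed.

(** Hoelder's inequality in weighted form: the geometric mean of two
    normalized functions lies below their arithmetic mean. *)
Lemma weighted_hoelder f g (a b : R) :
  measurable_fun setT f -> measurable_fun setT g ->
  (forall x, 0 <= f x) -> (forall x, 0 <= g x) ->
  (0 <= a)%R -> (0 <= b)%R -> (a + b = 1)%R ->
  \int[mu]_x (f x `^ a * g x `^ b) <= (\int[mu]_x f x) `^ a * (\int[mu]_x g x) `^ b.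
Proof.
move=> mf mg f0 g0 a0 b0 ab.
have [a00|aN0] := eqVneq a 0%R.
  have b1 : b = 1%R by rewrite -ab a00 add0r.
  rewrite a00 b1 poweRe0 mul1e poweRe1 ?integral_ge0//.
  by apply: le_ge0_integral => x; rewrite poweRe0 mul1e poweRe1.
have [b00|bN0] := eqVneq b 0%R.
  have a1 : a = 1%R by rewrite -ab b00 addr0.
  rewrite b00 a1 poweRe0 mule1 poweRe1 ?integral_ge0//.
  by apply: le_ge0_integral => x; rewrite poweRe0 mule1 poweRe1.
have {a0 aN0}a0 : (0 < a)%R by rewrite lt_neqAle eq_sym aN0.
have {b0 bN0}b0 : (0 < b)%R by rewrite lt_neqAle eq_sym bN0.
have If0 : 0 <= \int[mu]_x f x by exact: integral_ge0.
have Ig0 : 0 <= \int[mu]_x g x by exact: integral_ge0.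
have mfg : measurable_fun setT (fun x => f x `^ a * g x `^ b).
  by apply: emeasurable_funM; exact: measurable_fun_poweR.
have fg0 x : 0 <= f x `^ a * g x `^ b by rewrite mule_ge0 ?poweR_ge0.
(* degenerate cases, in which the integrals cannot be normalized to 1 *)
have [A0|A0] := eqVneq (\int[mu]_x f x) 0.
  rewrite integral0_ae ?mule_ge0 ?poweR_ge0//.
  apply: filterS (integral_eq0_ae mf f0 A0) => x ->.
  by rewrite poweR0r ?gt_eqF// mul0e.
have [B0|B0] := eqVneq (\int[mu]_x g x) 0.
  rewrite integral0_ae ?mule_ge0 ?poweR_ge0//.
  apply: filterS (integral_eq0_ae mg g0 B0) => x ->.
  by rewrite poweR0r ?gt_eqF// mule0.
have [Ay|Ay] := eqVneq (\int[mu]_x f x) +oo.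
  rewrite Ay poweRyr ?gt_eqF// gt0_mulye ?leey//.
  by rewrite poweR_gt0// lt0e B0.
have [By|By] := eqVneq (\int[mu]_x g x) +oo.
  rewrite By poweRyr ?gt_eqF// gt0_muley ?leey//.
  by rewrite poweR_gt0// lt0e A0.
have Afin : \int[mu]_x f x \is a fin_num by rewrite ge0_fin_numE// ltey.
have Bfin : \int[mu]_x g x \is a fin_num by rewrite ge0_fin_numE// ltey.
set A := \int[mu]_x f x in If0 A0 Ay Afin *.
set B := \int[mu]_x g x in Ig0 B0 By Bfin *.
have fA0 : (0 < fine A)%R by rewrite fine_gt0// lt0e A0 If0/= ltey.
have fB0 : (0 < fine B)%R by rewrite fine_gt0// lt0e B0 Ig0/= ltey.
have AB0 : 0 <= A `^ a * B `^ b by rewrite mule_ge0 ?poweR_ge0.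
have ptw x : f x `^ a * g x `^ b <=
    (A `^ a * B `^ b) * ((a / fine A)%:E * f x + (b / fine B)%:E * g x).
  have iA : 0 <= (fine A)^-1%:E * f x by rewrite mule_ge0// lee_fin invr_ge0 ltW.
  have iB : 0 <= (fine B)^-1%:E * g x by rewrite mule_ge0// lee_fin invr_ge0 ltW.
  have -> : f x `^ a * g x `^ b = (A `^ a * B `^ b) *
      (((fine A)^-1%:E * f x) `^ a * ((fine B)^-1%:E * g x) `^ b).
    rewrite muleACA -!poweRM//.
    by rewrite !muleA -{1}(fineK Afin) -{1}(fineK Bfin) -!EFinM !mulfV ?gt_eqF// !mul1e.
  apply: (lee_wpmul2l AB0).
  by rewrite !EFinM -!muleA; apply: weighted_am_gm.
apply: le_trans (le_ge0_integral mu fg0 ptw) _.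
have h1 : measurable_fun setT (fun x => (a / fine A)%:E * f x).
  by apply: emeasurable_funM => //; exact: measurable_cst.
have h2 : measurable_fun setT (fun x => (b / fine B)%:E * g x).
  by apply: emeasurable_funM => //; exact: measurable_cst.
have c1 : (0 <= a / fine A)%R by rewrite divr_ge0// ltW.
have c2 : (0 <= b / fine B)%R by rewrite divr_ge0// ltW.
rewrite ge0_integralZl//; last 2 first.
- exact: emeasurable_funD.
- by move=> x _; rewrite adde_ge0// mule_ge0// lee_fin.
rewrite ge0_integralD//; last 2 first.
- by move=> x _; rewrite mule_ge0// lee_fin.
- by move=> x _; rewrite mule_ge0// lee_fin.
rewrite !ge0_integralZl ?lee_fin// -/A -/B -{3}(fineK Afin) -{3}(fineK Bfin).
by rewrite -!EFinM !divfK ?gt_eqF// -EFinD ab mule1.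
Qed.

(** The first two factors are merged into one, with exponents rescaled so that
    they sum up to 1. *)
Lemma weighted_hoelder3 f g h (a b c : R) :
  measurable_fun setT f -> measurable_fun setT g -> measurable_fun setT h ->
  (forall x, 0 <= f x) -> (forall x, 0 <= g x) -> (forall x, 0 <= h x) ->
  (0 <= a)%R -> (0 <= b)%R -> (0 <= c)%R -> (a + b + c = 1)%R ->
  \int[mu]_x (f x `^ a * g x `^ b * h x `^ c) <=
  (\int[mu]_x f x) `^ a * (\int[mu]_x g x) `^ b * (\int[mu]_x h x) `^ c.
Proof.
move=> mf mg mh f0 g0 h0 a0 b0 c0 abc.
have [ab0|abN0] := eqVneq (a + b)%R 0%R.
  have c1 : c = 1%R by rewrite -abc ab0 add0r.
  have [a00 b00] : a = 0%R /\ b = 0%R by split; lra.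
  rewrite a00 b00 c1 !poweRe0 !mul1e poweRe1 ?integral_ge0//.
  by apply: le_ge0_integral => x; rewrite !poweRe0 !mul1e poweRe1.
have ab0 : (0 < a + b)%R by rewrite lt_neqAle eq_sym abN0 addr_ge0.
have pw x y : 0 <= x -> 0 <= y ->
    x `^ a * y `^ b = (x `^ (a / (a + b)) * y `^ (b / (a + b))) `^ (a + b).
  by move=> x0 y0; rewrite poweRM ?poweR_ge0// -!poweRrM !divfK.
under eq_integral do rewrite pw//.
apply: le_trans (weighted_hoelder _ mh _ h0 (ltW ab0) c0 abc) _.
- by apply: emeasurable_funM; exact: measurable_fun_poweR.
- by move=> x; rewrite mule_ge0 ?poweR_ge0.
apply: lee_wpmul2r; first exact: poweR_ge0.
rewrite pw ?integral_ge0//; apply: le_poweR; first exact: ltW.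
  by apply: integral_ge0 => x _; rewrite mule_ge0 ?poweR_ge0.
apply: weighted_hoelder => //; rewrite ?divr_ge0// ?(ltW ab0)//.
by rewrite -mulrDl divff.
Qed.

End Hoelder.

Section Exponents.
Variable R : realType.

(** The solutions of [1 / p1 + 1 / p2 = 1 / p], with the infinite exponents
    separated from the finite ones. *)
Variant hoelder_exponents (p1 p2 p : \bar R) : Prop :=
| HoelderFin (r1 r2 r : R) of (0 < r1)%R & (0 < r2)%R & (0 < r)%R &
    (r1^-1 + r2^-1 = r^-1)%R & p1 = r1%:E & p2 = r2%:E & p = r%:E
| HoelderInftyL (r : R) of (0 < r)%R & p1 = +oo & p2 = r%:E & p = r%:E
| HoelderInftyR (r : R) of (0 < r)%R & p1 = r%:E & p2 = +oo & p = r%:E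
| HoelderInfty of p1 = +oo & p2 = +oo & p = +oo.

Lemma hoelder_exponentsP (p1 p2 p : \bar R) : 1 <= p1 -> 1 <= p2 -> 1 <= p ->
  p1^-1 + p2^-1 = p^-1 -> hoelder_exponents p1 p2 p.
Proof.
have pos (r : R) : 1 <= r%:E -> (0 < r)%R by rewrite lee_fin => /(lt_le_trans ltr01).
have inv (r : R) : (0 < r)%R -> (r%:E)^-1 = r^-1%:E.
  by move=> r0; rewrite inver gt_eqF.
case: p1 p2 p => [r1| |] [r2| |] [r| |]// h1 h2 h; rewrite ?invey ?(inv _ (pos _ h1))
  ?(inv _ (pos _ h2)) ?(inv _ (pos _ h)) ?adde0 ?add0e.
- by rewrite -EFinD => -[e]; apply: (@HoelderFin _ _ _ r1 r2 r) => //; exact: pos.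
- rewrite -EFinD => -[e]; have : (0 < r1^-1 + r2^-1)%R by rewrite addr_gt0// invr_gt0 pos.
  by rewrite e ltxx.
- by move=> [/invr_inj e]; apply: (@HoelderInftyR _ _ _ r) => //; [exact: pos|rewrite e].
- by move=> [/eqP]; rewrite invr_eq0 gt_eqF// pos.
- by move=> [/invr_inj e]; apply: (@HoelderInftyL _ _ _ r) => //; [exact: pos|rewrite e].
- by move=> [/eqP]; rewrite invr_eq0 gt_eqF// pos.
- by move=> [/esym/eqP]; rewrite invr_eq0 gt_eqF// pos.
- by move=> _; exact: HoelderInfty.
Qed.

End Exponents.

Section LnormLemmas.
Context d (T : measurableType d) (R : realType).
Variable mu : {measure set T -> \bar R}.
Hypothesis mu0 : 0 < mu setT.
Implicit Types f g h : T -> \bar R.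
Local Notation "'N_ p [ f ]" := (Lnorm mu p f).

Lemma LnormE (r : R) f : 'N_r%:E[f] = (\int[mu]_x (`|f x| `^ r)) `^ r^-1.
Proof. by rewrite unlock. Qed.

Lemma LnormyE f : Lnorm mu +oo f = ess_sup mu (abse \o f).
Proof. by rewrite unlock mu0. Qed.

Lemma ge0_LnormE (r : R) f : (forall x, 0 <= f x) ->
  'N_r%:E[f] = (\int[mu]_x (f x `^ r)) `^ r^-1.
Proof. by move=> f0; rewrite LnormE; under eq_integral do rewrite gee0_abs//. Qed.

Lemma ae_le_Lnormy f : {ae mu, forall x, `|f x| <= Lnorm mu +oo f}.
Proof. by rewrite LnormyE; exact: (ess_sup_ge mu (abse \o f)). Qed.

Lemma Lnormy_le f (M : \bar R) : {ae mu, forall x, `|f x| <= M} -> Lnorm mu +oo f <= M.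
Proof. by move=> h; rewrite LnormyE; apply/ess_supP. Qed.

Lemma le_Lnorm (p : \bar R) f g : 0 < p -> (forall x, `|f x| <= `|g x|) ->
  'N_p[f] <= 'N_p[g].
Proof.
case: p => [r| |]// r0 fg.
- have r0' : (0 < r)%R by rewrite lte_fin in r0.
  rewrite !LnormE; apply: le_poweR; first by rewrite invr_ge0 ltW.
    by apply: integral_ge0 => x _; exact: poweR_ge0.
  apply: le_ge0_integral => x; first exact: poweR_ge0.
  by apply: le_poweR => //; exact: ltW.
- by apply: Lnormy_le; apply: filterS (ae_le_Lnormy g) => x; apply: le_trans.
Qed.

Lemma LnormZ_ge0 (p : \bar R) f (c : R) : 0 < p -> (0 <= c)%R ->
  measurable_fun setT f -> 'N_p[(fun x => c%:E * f x)] = c%:E * 'N_p[f].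
Proof.
case: p => [r| |]// r0 c0 mf.
- have r0' : (0 < r)%R by rewrite lte_fin in r0.
  rewrite !LnormE.
  under eq_integral do rewrite abseM gee0_abs ?lee_fin// poweRM// ?lee_fin//.
  rewrite ge0_integralZl//; last 3 first.
  - by apply: measurable_fun_poweR; exact: measurableT_comp.
  - by move=> x _; exact: poweR_ge0.
  - exact: poweR_ge0.
  rewrite poweRM ?poweR_ge0//; last by apply: integral_ge0 => x _; exact: poweR_ge0.
  by rewrite poweRK ?lee_fin// gt_eqF.
- rewrite !LnormyE -(ess_supZl _ mu0 c0); congr ess_sup; apply/funext => x /=.
  by rewrite abseM gee0_abs.
Qed.

(** Hoelder's inequality for all exponents, infinite ones included. *)
Lemma hoelder_Lnorm (p1 p2 p : \bar R) f g : hoelder_exponents p1 p2 p ->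
  measurable_fun setT f -> measurable_fun setT g ->
  'N_p[(fun x => f x * g x)] <= 'N_p1[f] * 'N_p2[g].
Proof.
move=> hp mf mg.
have main (r : R) (f' g' : T -> \bar R) : (0 < r)%R -> measurable_fun setT f' ->
    measurable_fun setT g' -> 'N_r%:E[(fun x => f' x * g' x)] <= Lnorm mu +oo f' * 'N_r%:E[g'].
  move=> r0 mf' mg'; rewrite [X in X * _](_ : _ = (Lnorm mu +oo f' `^ r) `^ r^-1); last first.
    by rewrite poweRK ?gt_eqF// Lnorm_ge0.
  have mg'r : measurable_fun setT (fun x => `|g' x| `^ r).
    by apply: measurable_fun_poweR; exact: measurableT_comp.
  rewrite !LnormE -poweRM ?poweR_ge0//; last first.
    by apply: integral_ge0 => x _; exact: poweR_ge0.
  rewrite -ge0_integralZl//; [|by move=> x _; exact: poweR_ge0|exact: poweR_ge0].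
  apply: le_poweR; first by rewrite invr_ge0 ltW.
    by apply: integral_ge0 => x _; exact: poweR_ge0.
  apply: ae_ge0_le_integral => //.
  - by move=> x _; exact: poweR_ge0.
  - apply: measurable_fun_poweR; apply: measurableT_comp => //; exact: emeasurable_funM.
  - by move=> x _; rewrite mule_ge0 ?poweR_ge0.
  - by apply: emeasurable_funM => //; exact: measurable_cst.
  apply: filterS (ae_le_Lnormy f') => x fx _.
  rewrite abseM poweRM//; apply: lee_wpmul2r; first exact: poweR_ge0.
  by apply: le_poweR => //; exact: ltW.
case: hp => [r1 r2 r r10 r20 r0 e -> -> ->|r r0 -> -> ->|r r0 -> -> ->|-> -> ->].
- rewrite !LnormE.
  have n1 : (r1 != 0)%R by rewrite gt_eqF.
  have n2 : (r2 != 0)%R by rewrite gt_eqF.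
  have n : (r != 0)%R by rewrite gt_eqF.
  have eq1 x : `|f x * g x| `^ r = (`|f x| `^ r1) `^ (r / r1) * (`|g x| `^ r2) `^ (r / r2).
    rewrite abseM poweRM// -!poweRrM.
    by rewrite [(r1 * _)%R]mulrC [(r2 * _)%R]mulrC !divfK.
  under eq_integral do rewrite eq1.
  have pos h (s : R) : 0 <= \int[mu]_x (`|h x| `^ s).
    by apply: integral_ge0 => x _; exact: poweR_ge0.
  apply: (@le_trans _ _ (((\int[mu]_x (`|f x| `^ r1)) `^ (r / r1) *
      (\int[mu]_x (`|g x| `^ r2)) `^ (r / r2)) `^ r^-1)).
    apply: le_poweR; first by rewrite invr_ge0 ltW.
      by apply: integral_ge0 => x _; rewrite mule_ge0 ?poweR_ge0.
    apply: weighted_hoelder.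
    - by apply: measurable_fun_poweR; exact: measurableT_comp.
    - by apply: measurable_fun_poweR; exact: measurableT_comp.
    - by move=> x; exact: poweR_ge0.
    - by move=> x; exact: poweR_ge0.
    - by rewrite divr_ge0// ltW.
    - by rewrite divr_ge0// ltW.
    - by rewrite -mulrDr e divff.
  rewrite poweRM ?poweR_ge0// -!poweRrM.
  by rewrite ![(r / _)%R]mulrC -!mulrA divff// !mulr1.
- exact: main.
- rewrite muleC; apply: le_trans (main r g f r0 mg mf).
  by apply: le_Lnorm; [rewrite lte_fin|move=> x; rewrite muleC].
- apply: Lnormy_le; apply: filterS2 (ae_le_Lnormy f) (ae_le_Lnormy g) => x fx gx.
  by rewrite abseM lee_pmul.
Qed.

End LnormLemmas.

Section Minkowski.
Context d1 d2 (T1 : measurableType d1) (T2 : measurableType d2) (R : realType).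
Variables (m1 : {measure set T1 -> \bar R}) (m2 : {measure set T2 -> \bar R}).
Hypothesis sf1 : sigma_finite setT m1.
Hypothesis sf2 : sigma_finite setT m2.
Variable w : T2 -> R.
Hypothesis mw : measurable_fun setT w.
Hypothesis w0 : forall y, (0 < w y)%R.
Hypothesis intw : \int[m2]_y (w y)%:E < +oo.
Variable F : T1 * T2 -> \bar R.
Hypothesis mF : measurable_fun [set: T1 * T2] F.
Hypothesis F0 : forall z, 0 <= F z.

Let measurable_swap : measurable_fun [set: T2 * T1] (fun z => F (z.2, z.1)).
Proof.
apply: (measurableT_comp mF); apply/measurable_fun_pairP; split.
  exact: measurable_snd.
exact: measurable_fst.
Qed.

Lemma measurable_Lnorm_section (r : R) :
  measurable_fun setT (fun y => Lnorm m1 r%:E (fun x => F (x, y))).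
Proof.
under eq_fun do rewrite ge0_LnormE//.
apply: measurable_fun_poweR.
apply: (@measurable_partial_integral _ _ _ _ _ m1 sf1 (fun z => F (z.2, z.1) `^ r)).
  exact: measurable_fun_poweR.
by move=> z; exact: poweR_ge0.
Qed.

(** Minkowski's integral inequality. Hoelder's inequality in the second
    variable is applied with respect to the norms of the sections, perturbed by
    an integrable positive weight so that they can be divided by. *)
Lemma minkowski_integral (r : R) : (1 <= r)%R ->
  Lnorm m1 r%:E (fun x => \int[m2]_y F (x, y)) <=
  \int[m2]_y Lnorm m1 r%:E (fun x => F (x, y)).
Proof.
move=> r1; have r0 : (0 < r)%R by exact: lt_le_trans ltr01 r1.
pose m y := Lnorm m1 r%:E (fun x => F (x, y)).
have m0 y : 0 <= m y by exact: Lnorm_ge0.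
have mm : measurable_fun setT m by exact: measurable_Lnorm_section.
rewrite -/m.
have [->|Cy] := eqVneq (\int[m2]_y m y) +oo; first by rewrite leey.
have Clt : \int[m2]_y m y < +oo by rewrite ltey.
have C0 : 0 <= \int[m2]_y m y by exact: integral_ge0.
have mfin : {ae m2, forall y, m y \is a fin_num}.
  have := @integrable_ae _ _ _ m2 setT measurableT m.
  move=> /(_ _)/filterS h; apply: h => [y|]; first exact.
  apply/integrableP; split => //.
  by under eq_integral do rewrite gee0_abs//.
have W0 : 0 <= \int[m2]_y (w y)%:E by apply: integral_ge0 => y _; rewrite lee_fin ltW.
have Wfin : \int[m2]_y (w y)%:E \is a fin_num by rewrite ge0_fin_numE.
set W := fine (\int[m2]_y (w y)%:E).
suff key (e : R) : (0 < e)%R ->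
    Lnorm m1 r%:E (fun x => \int[m2]_y F (x, y)) <= \int[m2]_y m y + e%:E * \int[m2]_y (w y)%:E.
  apply/lee_addgt0Pr => e e0.
  have W1 : (0 < W + 1)%R by rewrite ltr_pwDr// fine_ge0.
  apply: le_trans (key _ (divr_gt0 e0 W1)) _.
  rewrite leeD2l// -(fineK Wfin) -/W -EFinM lee_fin -mulrA ger_pMr//.
  by rewrite mulrC ler_pdivrMr// mul1r lerDl.
move=> e0.
pose k y := (fine (m y) + e * w y)%R.
have k0 y : (0 < k y)%R by rewrite ltr_wpDl ?fine_ge0// mulr_gt0.
have mk : measurable_fun setT k.
  by apply: measurable_funD; [exact: measurableT_comp|apply: measurable_funM].
have mkE : measurable_fun setT (fun y => (k y)%:E) by exact/measurable_EFinP.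
have -> : \int[m2]_y m y + e%:E * \int[m2]_y (w y)%:E = \int[m2]_y (k y)%:E.
  rewrite -ge0_integralZl//; first last.
  - by rewrite lee_fin ltW.
  - by move=> y _; rewrite lee_fin ltW.
  - exact/measurable_EFinP.
  rewrite -ge0_integralD//; first last.
  - by apply: emeasurable_funM; [exact: measurable_cst|exact/measurable_EFinP].
  - by move=> y _; rewrite -EFinM lee_fin mulr_ge0 ?ltW.
  apply: ge0_ae_eq_integral => //.
  - apply: emeasurable_funD => //.
    by apply: emeasurable_funM; [exact: measurable_cst|exact/measurable_EFinP].
  - by move=> y _; rewrite adde_ge0// -EFinM lee_fin mulr_ge0 ?ltW.
  - by move=> y _; rewrite lee_fin ltW.
  by apply: filterS mfin => y my _; rewrite /k EFinD fineK.
have K0 : 0 <= \int[m2]_y (k y)%:E by apply: integral_ge0 => y _; rewrite lee_fin ltW.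
set K := \int[m2]_y (k y)%:E in K0 *.
pose G (z : T1 * T2) := F z `^ r * (k z.2 `^ (1 - r))%:E.
have mkr : measurable_fun setT (fun y => (k y `^ (1 - r))%:E).
  by apply/measurable_EFinP; exact: (measurableT_comp (measurable_powR _)).
have mG : measurable_fun setT G.
  apply: emeasurable_funM; first exact: measurable_fun_poweR.
  exact: (measurableT_comp mkr measurable_snd).
have G0 z : 0 <= G z by rewrite mule_ge0 ?poweR_ge0// lee_fin powR_ge0.
have rN0 : (r != 0)%R by rewrite gt_eqF.
have S0 x : 0 <= \int[m2]_y F (x, y) by exact: integral_ge0.
have ptw x : (\int[m2]_y F (x, y)) `^ r <= \int[m2]_y G (x, y) * K `^ (r - 1).
  have FG y : F (x, y) = G (x, y) `^ r^-1 * (k y)%:E `^ (1 - r^-1).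
    rewrite /G /= poweRM ?poweR_ge0 ?lee_fin ?powR_ge0// poweRK// -muleA.
    rewrite !poweR_EFin -EFinM -powRrM -powRD.
      rewrite (_ : (_ + _ = 0)%R) ?powRr0 ?mule1//.
      by rewrite mulrBl mul1r divff//; ring.
    by rewrite (gt_eqF (k0 y)) implybT.
  have h : \int[m2]_y F (x, y) <= (\int[m2]_y G (x, y)) `^ r^-1 * K `^ (1 - r^-1).
    under eq_integral do rewrite FG.
    apply: weighted_hoelder => //.
    - exact: (measurableT_comp mG (measurable_pair1 x)).
    - by move=> y; rewrite lee_fin ltW.
    - by rewrite invr_ge0 ltW.
    - by rewrite subr_ge0 invf_le1.
    - by rewrite addrC subrK.
  apply: le_trans (le_poweR (ltW r0) (S0 x) h) _.
  rewrite poweRM ?poweR_ge0// poweRVK ?integral_ge0//.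
  by rewrite -poweRrM mulrBl mul1r mulVf.
rewrite ge0_LnormE//.
suff : \int[m1]_x (\int[m2]_y F (x, y)) `^ r <= K `^ r.
  move=> h; rewrite -[leRHS](poweRK rN0 K0); apply: le_poweR => //.
    by rewrite invr_ge0 ltW.
  by apply: integral_ge0 => x _; exact: poweR_ge0.
apply: le_trans (le_ge0_integral m1 (fun x => poweR_ge0 _ _) ptw) _.
rewrite ge0_integralZr//; last 3 first.
- exact: measurable_partial_integral.
- by move=> x _; exact: integral_ge0.
- exact: poweR_ge0.
have -> : K `^ r = K * K `^ (r - 1).
  have [->|KN0] := eqVneq K 0; first by rewrite mul0e poweR0r.
  rewrite -{2}(poweRe1 K0) -poweRD ?subrKC//.
  by apply: nneg_neq0_poweRD_def => //; rewrite subr_ge0.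
apply: lee_wpmul2r; first exact: poweR_ge0.
rewrite (tonelli sf1 sf2)// /K.
apply: ae_ge0_le_integral => //.
- by move=> y _; exact: integral_ge0.
- apply: (@measurable_partial_integral _ _ _ _ _ m1 sf1 (fun z => G (z.2, z.1))).
    apply: (measurableT_comp mG); apply/measurable_fun_pairP; split.
      exact: measurable_snd.
    exact: measurable_fst.
  by move=> z.
- by move=> y _; rewrite lee_fin ltW.
apply: filterS mfin => y my _; rewrite /G /=.
rewrite ge0_integralZr//; last 3 first.
- by apply: measurable_fun_poweR; exact: (measurableT_comp mF (measurable_pair2 y)).
- by move=> x _; exact: poweR_ge0.
- by rewrite lee_fin powR_ge0.
have -> : \int[m1]_x F (x, y) `^ r = m y `^ r.
  rewrite /m ge0_LnormE// poweRVK// integral_ge0// => x _; exact: poweR_ge0.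
rewrite -(fineK my) poweR_EFin -EFinM lee_fin.
apply: (@le_trans _ _ (k y `^ r * k y `^ (1 - r))%R).
  apply: ler_wpM2r; first exact: powR_ge0.
  apply: ge0_ler_powR; rewrite ?nnegrE ?fine_ge0 ?(ltW r0) ?(ltW (k0 y))//.
  by rewrite lerDl mulr_ge0 ?ltW.
rewrite -powRD ?subrKC ?powRr1 ?(ltW (k0 y))//.
by rewrite (gt_eqF (k0 y)) implybT.
Qed.

End Minkowski.

Local Close Scope ereal_scope.

(** * Young inequality and twisted convolution *)

Local Open Scope ereal_scope.

Section MeasurePreserving.
Context d (T : measurableType d) (R : realType).
Variable mu : {measure set T -> \bar R}.
Hypothesis mu0 : 0 < mu setT.
Variable tau : T -> T.
Hypothesis mtau : measurable_fun setT tau.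
Hypothesis ptau : forall A, measurable A -> mu (tau @^-1` A) = mu A.

Lemma integral_measure_preserving (f : T -> \bar R) :
  measurable_fun setT f -> (forall x, 0 <= f x) ->
  \int[mu]_x f (tau x) = \int[mu]_x f x.
Proof.
move=> mf f0.
rewrite -[LHS](@ge0_integral_pushforward _ _ _ _ _ _ mtau mu setT f)//.
by apply: eq_measure_integral => A mA _; exact: ptau.
Qed.

Lemma Lnorm_measure_preserving (p : \bar R) (f : T -> \bar R) : 0 < p ->
  measurable_fun setT f -> Lnorm mu p (fun x => f (tau x)) = Lnorm mu p f.
Proof.
case: p => [r| |]// r0 mf.
- rewrite !LnormE (integral_measure_preserving (f := fun x => `|f x| `^ r))//.
    by apply: measurable_fun_poweR; exact: measurableT_comp.
  by move=> x; exact: poweR_ge0.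
- have maf : measurable_fun setT (abse \o f) by exact: measurableT_comp.
  have maft : measurable_fun setT ((abse \o f) \o tau) by exact: measurableT_comp.
  have h y : {ae mu, forall x, (abse \o f) (tau x) <= y} <-> {ae mu, forall x, (abse \o f) x <= y}.
    rewrite (ae_le_measureP mu y maf) (ae_le_measureP mu y maft).
    rewrite comp_preimage ptau//.
    by rewrite -[X in measurable X]setTI; apply: maf => //; exact: emeasurable_itv.
  rewrite !LnormyE//; apply/eqP; rewrite eq_le; apply/andP; split; apply/ess_supP.
    by apply/h; exact: (ess_sup_ge mu (abse \o f)).
  by apply/h; exact: (ess_sup_ge mu (abse \o (fun x => f (tau x)))).
Qed.

End MeasurePreserving.

Section LebesgueNorms.
Variables (R : realType) (V : normedModType R).
Variable mu : {measure set (borel V) -> \bar R}.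
Hypothesis hfd : finite_dimensional V.
Hypothesis hleb : is_lebesgue mu.

Let sf : sigma_finite setT mu := lebesgue_sigma_finite hfd hleb.

Lemma lebesgue_setT_gt0 : 0 < mu setT.
Proof. by case: hleb => _ _ h; rewrite lt0e h measure_ge0. Qed.
Local Notation mu0 := lebesgue_setT_gt0.

Lemma measurable_point_reflection (a : V) :
  measurable_fun setT ((fun x : V => a - x)%R : borel V -> borel V).
Proof. exact: (measurableT_comp (measurable_translation a) (@measurable_reflection R V)). Qed.

Lemma lebesgue_point_reflection (a : V) (A : set (borel V)) :
  measurable A -> mu ((fun x : V => a - x)%R @^-1` A) = mu A.
Proof.
move=> mA; rewrite -(lebesgue_translation hleb a mA).
have mB : measurable ((fun x : V => a + x)%R @^-1` A : set (borel V)).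
  by rewrite -[X in measurable X]setTI; apply: measurable_translation.
set B : set (borel V) := (_ @^-1` _) in mB *.
have mNB : measurable ((fun x : V => - x)%R @^-1` B : set (borel V)).
  by rewrite -[X in measurable X]setTI; apply: measurable_reflection.
have e D : measurable D -> mu D = \int[mu]_x (\1_D x)%:E.
  by move=> mD; rewrite integral_indic// setIT.
transitivity (mu ((fun x : V => - x)%R @^-1` B)); first by [].
rewrite !e// -[RHS](integral_reflection hfd hleb (f := fun x => (\1_B x)%:E))//.
apply/measurable_EFinP; exact: measurable_indic.
Qed.

Lemma Lnorm_point_reflection (a : V) (p : \bar R) (f : V -> \bar R) : 0 < p ->
  measurable_fun setT (f : borel V -> \bar R) ->
  Lnorm mu p (fun x => f (a - x)%R) = Lnorm mu p f.
Proof.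
move=> p0 mf; apply: (Lnorm_measure_preserving mu0 (tau := (fun x : V => a - x)%R)) => //.
  exact: measurable_point_reflection.
exact: lebesgue_point_reflection.
Qed.

Lemma Lnorm_translation (a : V) (p : \bar R) (f : V -> \bar R) : 0 < p ->
  measurable_fun setT (f : borel V -> \bar R) ->
  Lnorm mu p (fun x => f (x + a)%R) = Lnorm mu p f.
Proof.
move=> p0 mf.
rewrite -(Lnorm_measure_preserving mu0 (tau := (fun x : V => a + x)%R) _ _ p0 mf).
- by apply: eq_Lnorm => x; rewrite addrC.
- exact: measurable_translation.
- exact: lebesgue_translation.
Qed.

(** The essential supremum of a continuous function is its supremum, as open
    sets have positive measure. *)
Lemma continuous_le_Lnormy (f : V -> R) : continuous f ->
  forall x, `|f x|%:E <= Lnorm mu +oo (fun y => (f y)%:E).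
Proof.
move=> cf x; rewrite leNgt; apply/negP => h.
set M := Lnorm _ _ _ in h.
have M0 : 0 <= M by exact: Lnorm_ge0.
have Mfin : M \is a fin_num by rewrite ge0_fin_numE//; apply: lt_trans h (ltry _).
rewrite -(fineK Mfin) lte_fin in h.
pose U : set V := (fun y => `|f y|%R) @^-1` [set t | (fine M < t)%R].
have oU : open U.
  apply: open_comp; last exact: open_gt.
  by move=> y _; apply: (@continuous_comp _ _ _ f); [exact: cf|exact: norm_continuous].
have := lebesgue_open_gt0 hfd hleb oU (ex_intro _ x h).
suff -> : mu U = 0 by rewrite ltxx.
have mf : measurable_fun setT ((fun y => `|f y|%:E) : borel V -> \bar R).
  apply/measurable_EFinP; apply: measurableT_comp => //; exact: continuous_measurable_borel.
have hM : {ae mu, forall y : V, `|f y|%:E <= M} :=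
  ae_le_Lnormy mu0 (fun y => (f y)%:E).
have /(ae_le_measureP mu M mf) := hM.
move=> <-; congr (mu _); apply/seteqP; split => y /=; rewrite /U /= in_itv/= andbT.
  by rewrite -{2}(fineK Mfin) lte_fin.
by rewrite -{1}(fineK Mfin) lte_fin.
Qed.

(** For the infinite exponent, continuity makes the norm of a section a supremum
    over a dense sequence, which is measurable. *)
Lemma measurable_Lnorm_continuous (p : \bar R) (A : V -> V -> R) : 1 <= p ->
  continuous (fun z : V * V => A z.1 z.2) ->
  measurable_fun setT ((fun U => Lnorm mu p (fun X => (A X U)%:E)) : borel V -> \bar R).
Proof.
case: p => [r| |]// r1 cA.
- have m : measurable_fun setT (fun z : borel V * borel V => (`|A z.1 z.2|)%:E).
    by apply/measurable_EFinP; apply: measurableT_comp => //; exact: continuous_measurable_prod.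
  under eq_fun do rewrite -Lnorm_abse.
  exact: (measurable_Lnorm_section sf m (fun z => normr_ge0 _)).
- have [d hd] := exists_dense_sequence hfd.
  have c1 U := @continuous_cosection _ _ A U cA.
  have c2 X := @continuous_section _ _ A X cA.
  rewrite (_ : (fun U => _) = (fun U => esups (fun n => `|A (d n) U|%:E) 0%N)).
    apply: measurable_fun_esups => n; apply/measurable_EFinP.
    by apply: measurableT_comp => //; apply: continuous_measurable_borel; exact: c2.
  apply/funext => U; apply/eqP; rewrite eq_le; apply/andP; split.
    apply: (Lnormy_le mu0); apply: aeW => X; rewrite leNgt; apply/negP => h.
    set s := esups _ _ in h.
    have sd n : `|A (d n) U|%:E <= s by apply: ereal_sup_ubound; exists n.
    have s0 : 0 <= s by apply: le_trans (sd 0%N).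
    have sfin : s \is a fin_num by rewrite ge0_fin_numE//; apply: lt_trans h (ltry _).
    rewrite /= -(fineK sfin) lte_fin in h.
    have cn : (fun Y => `|A Y U|%R) @ X --> `|A X U|%R.
      by apply: (@continuous_comp _ _ _ (A ^~ U)); [exact: c1|exact: norm_continuous].
    have : \forall Y \near X, (fine s < `|A Y U|)%R by exact: (cvgr_gt _ cn).
    move=> /nbhs_ballP[e /= e0 he].
    have [n hn] := hd X e e0.
    have := he (d n); rewrite -ball_normE => /(_ hn).
    by rewrite ltNge -lee_fin fineK// sd.
  by apply: ub_ereal_sup => _ [n _ <-]; exact: continuous_le_Lnormy.
Qed.

(** Young's inequality. With [a = 1 / q], [b = 1 - 1 / q1], [c = 1 - 1 / q2],
    [F = f ^ q2] and [G = g ^ q1], the integrand is the product of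
    [(F G) ^ a], [F ^ b] and [G ^ c]; Hoelder's inequality for three factors
    bounds the convolution, and Tonelli's theorem integrates the bound. *)
Lemma young_convolution (q1 q2 q : \bar R) (f g : V -> \bar R) :
  1 <= q1 -> 1 <= q2 -> 1 <= q -> q1^-1 + q2^-1 = 1 + q^-1 ->
  measurable_fun setT (f : borel V -> \bar R) ->
  measurable_fun setT (g : borel V -> \bar R) ->
  (forall x, 0 <= f x) -> (forall x, 0 <= g x) ->
  Lnorm mu q (fun U => \int[mu]_V0 (f V0 * g (U - V0)%R)) <= Lnorm mu q2 f * Lnorm mu q1 g.
Proof.
move=> h1 h2 h hq mf mg f0 g0.
have mgr (U : V) : measurable_fun setT ((fun x => g (U - x)%R) : borel V -> \bar R).
  exact: (measurableT_comp mg (measurable_point_reflection U)).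
have conv0 U : 0 <= \int[mu]_V0 (f V0 * g (U - V0)%R).
  by apply: integral_ge0 => x _; exact: mule_ge0.
case: q h hq => [r| |]// r1 hq; last first.
  rewrite invey adde0 -inve1 addeC in hq.
  have hex := hoelder_exponentsP h2 h1 (lexx 1) hq.
  apply: (Lnormy_le mu0); apply: aeW => U.
  rewrite gee0_abs// -(Lnorm_point_reflection U _ mg); last by apply: lt_le_trans h1.
  apply: le_trans (hoelder_Lnorm mu0 hex mf (mgr U)).
  rewrite Lnorm1; apply: le_ge0_integral => x; first exact: mule_ge0.
  by rewrite gee0_abs// mule_ge0.
have r0 : (0 < r)%R by rewrite lee_fin in r1; exact: lt_le_trans ltr01 r1.
have rN0 : (r != 0)%R by rewrite gt_eqF.
have inv (s : R) : (0 < s)%R -> (s%:E)^-1 = s^-1%:E by move=> s0; rewrite inver gt_eqF.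
have pos (s : R) : 1 <= s%:E -> (0 < s)%R by rewrite lee_fin => /(lt_le_trans ltr01).
have invle1 (s : R) : 1 <= s%:E -> (s^-1 <= 1)%R.
  by move=> s1; rewrite invf_le1 ?pos// -lee_fin.
have rV : (0 < r^-1)%R by rewrite invr_gt0.
case: q1 q2 h1 h2 hq => [r1'| |] [r2'| |]// h1 h2; rewrite ?invey ?(inv _ (pos _ h1))
  ?(inv _ (pos _ h2)) ?(inv _ r0) ?adde0 ?add0e -?EFinD => -[e]; last 3 first.
- by have := invle1 _ h1; rewrite e gerDl leNgt rV.
- by have := invle1 _ h2; rewrite e gerDl leNgt rV.
- have : (0 < 1 + r^-1)%R by rewrite addr_gt0.
  by rewrite -e ltxx.
have s0 := pos _ h1; have t0 := pos _ h2.
have b0 : (0 <= 1 - r1'^-1)%R by rewrite subr_ge0 invle1.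
have c0 : (0 <= 1 - r2'^-1)%R by rewrite subr_ge0 invle1.
have e2 : (r2'^-1 = 1 + r^-1 - r1'^-1)%R by rewrite -e addrC addKr.
have abc : (r^-1 + (1 - r1'^-1) + (1 - r2'^-1) = 1)%R by rewrite e2; ring.
have eb : (r^-1 + (1 - r1'^-1) = r2'^-1)%R by rewrite e2; ring.
have ec : (r^-1 + (1 - r2'^-1) = r1'^-1)%R by rewrite e2; ring.
set a := (r^-1)%R in rV abc eb ec *; set b := (1 - r1'^-1)%R in b0 abc eb *;
  set c := (1 - r2'^-1)%R in c0 abc ec *.
have aK x : 0 <= x -> (x `^ a) `^ r = x by exact: poweRVK.
have Ka x : 0 <= x -> (x `^ r) `^ a = x by exact: poweRK.
pose f' x := f x `^ r2'; pose g' x := g x `^ r1'.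
have f'0 x : 0 <= f' x by exact: poweR_ge0.
have g'0 x : 0 <= g' x by exact: poweR_ge0.
have mf' : measurable_fun setT (f' : borel V -> \bar R) by exact: measurable_fun_poweR.
have mg' : measurable_fun setT (g' : borel V -> \bar R) by exact: measurable_fun_poweR.
have mg'r (U : V) : measurable_fun setT ((fun x => g' (U - x)%R) : borel V -> \bar R).
  exact: (measurableT_comp mg' (measurable_point_reflection U)).
have t1 : (r2' * r2'^-1 = 1)%R by rewrite divff// gt_eqF.
have s1 : (r1' * r1'^-1 = 1)%R by rewrite divff// gt_eqF.
have Df x : 0 <= x -> x = (x `^ r2') `^ a * (x `^ r2') `^ b.
  move=> x0; rewrite -!poweRrM -poweRD; first by rewrite -mulrDr eb t1 poweRe1.
  by apply: add_neq0_poweRD_def; rewrite -mulrDr eb t1 oner_eq0.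
have Dg x : 0 <= x -> x = (x `^ r1') `^ a * (x `^ r1') `^ c.
  move=> x0; rewrite -!poweRrM -poweRD; first by rewrite -mulrDr ec s1 poweRe1.
  by apply: add_neq0_poweRD_def; rewrite -mulrDr ec s1 oner_eq0.
set F := \int[mu]_x f' x; set G := \int[mu]_x g' x.
have F0 : 0 <= F by exact: integral_ge0.
have G0 : 0 <= G by exact: integral_ge0.
have GU U : \int[mu]_x g' (U - x)%R = G.
  exact: (integral_measure_preserving (measurable_point_reflection U)
    (@lebesgue_point_reflection U) mg' g'0).
pose C U := \int[mu]_x (f' x * g' (U - x)%R).
have C0 U : 0 <= C U by apply: integral_ge0 => x _; exact: mule_ge0.
have ptw U : (\int[mu]_x (f x * g (U - x)%R)) `^ r <= C U * (F `^ b * G `^ c) `^ r.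
  have step : \int[mu]_x (f x * g (U - x)%R) <= C U `^ a * F `^ b * G `^ c.
    have mfg : measurable_fun setT ((fun x => f' x * g' (U - x)%R) : borel V -> \bar R).
      exact: emeasurable_funM.
    have := weighted_hoelder3 mu mfg mf' (mg'r U) (fun x => mule_ge0 (f'0 x) (g'0 _))
      f'0 (fun x => g'0 _) (ltW rV) b0 c0 abc.
    rewrite GU; apply: le_trans; apply: le_ge0_integral => x; first exact: mule_ge0.
    rewrite poweRM// {1}(Df (f x))// {1}(Dg (g _))// /f' /g'.
    by rewrite muleACA muleA.
  apply: le_trans (le_poweR (ltW r0) (conv0 U) step) _.
  by rewrite -muleA [leLHS]poweRM ?mule_ge0 ?poweR_ge0// aK.
have mprod : measurable_fun setT (fun z : borel V * borel V => f' z.2 * g' ((z.1 : V) - (z.2 : V))%R).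
  apply: emeasurable_funM; first exact: (measurableT_comp mf' measurable_snd).
  apply: (@measurableT_comp _ _ _ (borel V * borel V)%type (borel V) _ g') => //.
  apply: continuous_measurable_prod_borel => //; exact: sub_continuous.
have p0 (z : borel V * borel V) : 0 <= f' z.2 * g' ((z.1 : V) - (z.2 : V))%R by exact: mule_ge0.
have mC : measurable_fun setT (C : borel V -> \bar R).
  exact: (measurable_partial_integral sf mprod p0).
have IC : \int[mu]_U C U = F * G.
  rewrite (tonelli sf sf mprod p0) /= -ge0_integralZr//; apply: eq_integral => x _.
  rewrite ge0_integralZl//; first by rewrite (integral_translation_to hleb x).
  have := (measurableT_comp mg' (measurable_translation (- x)%R)).
  by congr measurable_fun; apply/funext => y /=; rewrite addrC.
rewrite !ge0_LnormE//.
apply: (@le_trans _ _ (((F * G) * (F `^ b * G `^ c) `^ r) `^ a)).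
  apply: le_poweR; first exact: ltW.
    by apply: integral_ge0 => x _; exact: poweR_ge0.
  rewrite -IC -ge0_integralZr//; last exact: poweR_ge0.
  by apply: le_ge0_integral => U; [exact: poweR_ge0|exact: ptw].
rewrite [leLHS]poweRM ?mule_ge0 ?poweR_ge0// Ka ?mule_ge0 ?poweR_ge0//.
rewrite poweRM// muleACA -eb -ec.
have nb : (a + b != 0)%R by rewrite eb invr_neq0// gt_eqF.
have nc : (a + c != 0)%R by rewrite ec invr_neq0// gt_eqF.
by rewrite (poweRD (add_neq0_poweRD_def F nb)) (poweRD (add_neq0_poweRD_def G nc)).
Qed.

(** The estimate behind the Moyal product: Minkowski's inequality and
    Hoelder's inequality in the first variable reduce it to Young's inequality
    for the convolution of the norms of the sections. *)
Lemma twisted_convolution_estimate (p1 p2 p q1 q2 q : \bar R) (A1 A2 : V -> V -> R) :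
  1 <= p1 -> 1 <= p2 -> 1 <= p -> 1 <= q1 -> 1 <= q2 -> 1 <= q ->
  p1^-1 + p2^-1 = p^-1 -> q1^-1 + q2^-1 = 1 + q^-1 ->
  continuous (fun z : V * V => A1 z.1 z.2) -> continuous (fun z : V * V => A2 z.1 z.2) ->
  (forall x y, (0 <= A1 x y)%R) -> (forall x y, (0 <= A2 x y)%R) ->
  Lnorm mu q (fun U => Lnorm mu p (fun X =>
    \int[mu]_V0 (A2 X V0 * A1 (X + V0) (U - V0))%:E)) <=
  Lnorm mu q1 (fun U => Lnorm mu p1 (fun X => (A1 X U)%:E)) *
  Lnorm mu q2 (fun U => Lnorm mu p2 (fun X => (A2 X U)%:E)).
Proof.
move=> hp1 hp2 hp hq1 hq2 hq hpp hqq c1 c2 pos1 pos2.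
pose g1 U := Lnorm mu p1 (fun X => (A1 X U)%:E).
pose g2 U := Lnorm mu p2 (fun X => (A2 X U)%:E).
have mg1 : measurable_fun setT (g1 : borel V -> \bar R) by exact: measurable_Lnorm_continuous.
have mg2 : measurable_fun setT (g2 : borel V -> \bar R) by exact: measurable_Lnorm_continuous.
have g10 x : 0 <= g1 x by exact: Lnorm_ge0.
have g20 x : 0 <= g2 x by exact: Lnorm_ge0.
have p_gt0 (s : \bar R) : 1 <= s -> 0 < s by exact: lt_le_trans.
rewrite -/g1 -/g2 muleC.
apply: le_trans (young_convolution hq1 hq2 hq hqq mg2 mg1 g20 g10).
apply: (le_Lnorm mu0 (p_gt0 _ hq)) => U.
rewrite !gee0_abs ?Lnorm_ge0//; last by apply: integral_ge0 => x _; exact: mule_ge0.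
have hex : hoelder_exponents p2 p1 p by apply: hoelder_exponentsP => //; rewrite addeC.
have cAU : continuous (fun z : V * V => A2 z.1 z.2 * A1 (z.1 + z.2) (U - z.2))%R.
  move=> z; apply: cvgM; first exact: c2.
  apply: (@continuous_comp _ _ _ (fun z : V * V => (z.1 + z.2, U - z.2)%R) (fun z : V * V => A1 z.1 z.2)).
    apply: cvg_pair; first exact: add_continuous.
    by apply: cvgB; [exact: cvg_cst|exact: cvg_snd].
  exact: c1.
have sec1 U0 := @continuous_cosection _ _ A1 U0 c1.
have sec2 U0 := @continuous_cosection _ _ A2 U0 c2.
have msec1 (U0 : V) : measurable_fun setT ((fun X => (A1 X U0)%:E) : borel V -> \bar R).
  by apply/measurable_EFinP; exact: continuous_measurable_borel.
have msec2 (U0 : V) : measurable_fun setT ((fun X => (A2 X U0)%:E) : borel V -> \bar R).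
  by apply/measurable_EFinP; exact: continuous_measurable_borel.
have msec1' (a U0 : V) : measurable_fun setT ((fun X => (A1 (X + a)%R U0)%:E) : borel V -> \bar R).
  apply/measurable_EFinP; apply: continuous_measurable_borel => X.
  apply: (@continuous_comp _ _ _ (fun Y => Y + a)%R (A1 ^~ U0)); last exact: sec1.
  by apply: cvgD; [exact: cvg_id|exact: cvg_cst].
have secprod V0 : Lnorm mu p (fun X => (A2 X V0 * A1 (X + V0) (U - V0))%:E) <=
    g2 V0 * g1 (U - V0)%R.
  rewrite /g1 -(Lnorm_translation V0 _ (msec1 _)); last exact: p_gt0.
  apply: le_trans (hoelder_Lnorm mu0 hex (msec2 V0) (msec1' V0 (U - V0)%R)).
  exact: (le_Lnorm mu0 (p_gt0 _ hp)).
have [w hw] := poly_weight_integrable hfd hleb.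
case: p hp hpp hex secprod => [r| |]// hp hpp hex secprod.
  apply: (@le_trans _ _ (\int[mu]_V0 Lnorm mu r%:E (fun X => (A2 X V0 * A1 (X + V0) (U - V0))%:E))).
    apply: (minkowski_integral sf sf (measurable_poly_weight w) _ hw
      (F := fun z => (A2 z.1 z.2 * A1 (z.1 + z.2) (U - z.2))%:E)) => //.
    - by move=> x; exact: poly_weight_gt0.
    - by apply/measurable_EFinP; exact: continuous_measurable_prod.
    - by move=> z; rewrite lee_fin mulr_ge0.
  by apply: le_ge0_integral => x; [exact: Lnorm_ge0|exact: secprod].
have [e1 e2] : p1 = +oo /\ p2 = +oo by case: hex.
apply: (Lnormy_le mu0); apply: aeW => X.
rewrite gee0_abs; last by apply: integral_ge0 => x _; rewrite lee_fin mulr_ge0.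
apply: le_ge0_integral => V0; first by rewrite lee_fin mulr_ge0.
rewrite EFinM; apply: lee_pmul; rewrite ?lee_fin//.
- rewrite /g2 e2 -[X in X%:E]ger0_norm//; exact: (continuous_le_Lnormy (sec2 V0)).
- rewrite /g1 e1 -[X in X%:E]ger0_norm//; exact: (continuous_le_Lnormy (sec1 (U - V0)%R)).
Qed.

End LebesgueNorms.

Local Close Scope ereal_scope.

(** * Complex-valued integrals *)

Section ComplexAbs.
Variable R : realType.
Implicit Types (z w : R[i]) (t : R).

Lemma normcE_cabs z : `|z| = creal (cabs z).
Proof. by rewrite /cabs /creal normc_def. Qed.

Lemma crealM t1 t2 : creal (t1 * t2) = creal t1 * creal t2 :> R[i].
Proof. exact: (rmorphM (real_complex R)). Qed.

Lemma crealD t1 t2 : creal (t1 + t2) = creal t1 + creal t2 :> R[i].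
Proof. exact: (rmorphD (real_complex R)). Qed.

Lemma crealB t1 t2 : creal (t1 - t2) = creal t1 - creal t2 :> R[i].
Proof. exact: (rmorphB (real_complex R)). Qed.

Lemma crealV t : creal t^-1 = (creal t)^-1 :> R[i].
Proof. exact: (fmorphV (real_complex R)). Qed.

Lemma creal_inj : injective (@creal R).
Proof. by move=> x y []. Qed.

Lemma conj_creal t : (creal t)^*%C = creal t.
Proof. exact: conjc_real. Qed.

Lemma cabs_ge0 z : 0 <= cabs z.
Proof. by rewrite /cabs normc_def /= sqrtr_ge0. Qed.

Lemma cabs0 : cabs (0 : R[i]) = 0.
Proof. by rewrite /cabs normr0. Qed.

Lemma cabs1 : cabs (1 : R[i]) = 1.
Proof. by rewrite /cabs normr1. Qed.

Lemma cabs_eq0 z : cabs z = 0 -> z = 0.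
Proof. by move=> h; apply/eqP; rewrite -normr_eq0 normcE_cabs h. Qed.

Lemma cabsM z w : cabs (z * w) = cabs z * cabs w.
Proof. by apply: creal_inj; rewrite crealM -!normcE_cabs normrM. Qed.

Lemma cabsN z : cabs (- z) = cabs z.
Proof. by rewrite /cabs normrN. Qed.

Lemma cabsB z w : cabs (z - w) = cabs (w - z).
Proof. by rewrite -cabsN opprB. Qed.

Lemma cabsJ z : cabs (z^*)%C = cabs z.
Proof. by rewrite /cabs normcJ. Qed.

Lemma cabs_creal t : cabs (creal t) = `|t|.
Proof. by rewrite /cabs normc_def /= expr0n addr0 sqrtr_sqr. Qed.

Lemma cabsD z w : cabs (z + w) <= cabs z + cabs w.
Proof.
by have := ler_normD z w; rewrite !normcE_cabs -crealD lecE /= => /andP[_].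
Qed.

Lemma cabs_sqr z : creal (cabs z ^+ 2) = z * (z^*)%C.
Proof. by rewrite -sqr_normc normcE_cabs expr2 crealM -expr2. Qed.

Lemma Re_le_cabs z : `|complex.Re z| <= cabs z.
Proof. by rewrite /cabs normc_def /= -sqrtr_sqr; apply: ler_wsqrtr; rewrite lerDl sqr_ge0. Qed.

Lemma Im_le_cabs z : `|complex.Im z| <= cabs z.
Proof. by rewrite /cabs normc_def /= -sqrtr_sqr; apply: ler_wsqrtr; rewrite lerDr sqr_ge0. Qed.

Lemma cabs_le_ReIm z : cabs z <= `|complex.Re z| + `|complex.Im z|.
Proof.
rewrite /cabs normc_def /=.
rewrite -[leRHS]ger0_norm ?addr_ge0// -sqrtr_sqr; apply: ler_wsqrtr.
rewrite sqrrD !real_normK ?num_real// -addrA lerD2l lerDr.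
by rewrite mulrn_wge0// mulr_ge0.
Qed.

End ComplexAbs.

Section ComplexIntegral.
Context d (T : measurableType d) (R : realType).
Variable mu : {measure set T -> \bar R}.
Implicit Types f g : T -> R[i].

Lemma measurable_cabs f : cmeasurable f -> measurable_fun setT (fun x => cabs (f x)).
Proof.
move=> [mr mi].
rewrite (_ : (fun x => _) =
    (fun x => Num.sqrt (complex.Re (f x) ^+ 2 + complex.Im (f x) ^+ 2))); last first.
  by apply/funext => x; rewrite /cabs normc_def.
apply: (measurableT_comp (continuous_measurable_fun (@sqrt_continuous R))).
by apply: measurable_funD; exact: measurable_funX.
Qed.

Lemma cmeasurableD f g : cmeasurable f -> cmeasurable g ->
  cmeasurable (fun x => f x + g x).
Proof.
move=> [f1 f2] [g1 g2]; split.
- rewrite (_ : (fun x => _) = (fun x => complex.Re (f x) + complex.Re (g x))).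
    exact: measurable_funD.
  by apply/funext => x; case: (f x) (g x) => ? ? [].
- rewrite (_ : (fun x => _) = (fun x => complex.Im (f x) + complex.Im (g x))).
    exact: measurable_funD.
  by apply/funext => x; case: (f x) (g x) => ? ? [].
Qed.

Lemma cmeasurableM f g : cmeasurable f -> cmeasurable g ->
  cmeasurable (fun x => f x * g x).
Proof.
move=> [f1 f2] [g1 g2]; split.
- rewrite (_ : (fun x => _) = (fun x => complex.Re (f x) * complex.Re (g x) -
      complex.Im (f x) * complex.Im (g x))).
    by apply: measurable_funB; exact: measurable_funM.
  by apply/funext => x; case: (f x) (g x) => ? ? [].
- rewrite (_ : (fun x => _) = (fun x => complex.Re (f x) * complex.Im (g x) +
      complex.Im (f x) * complex.Re (g x))).
    by apply: measurable_funD; exact: measurable_funM.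
  by apply/funext => x; case: (f x) (g x) => ? ? [].
Qed.

Lemma cmeasurable_conj f : cmeasurable f -> cmeasurable (fun x => ((f x)^*)%C).
Proof.
move=> [f1 f2]; split.
- rewrite (_ : (fun x => _) = (fun x => complex.Re (f x)))//.
  by apply/funext => x; case: (f x).
- rewrite (_ : (fun x => _) = (fun x => - complex.Im (f x))).
    exact: measurableT_comp.
  by apply/funext => x; case: (f x).
Qed.

Lemma cmeasurable_cst (k : R[i]) : cmeasurable (fun _ : T => k).
Proof. by split; exact: measurable_cst. Qed.

Lemma cintegrableP f : cintegrable mu f <->
  cmeasurable f /\ (\int[mu]_x (cabs (f x))%:E < +oo)%E.
Proof.
split=> [[/integrableP[mr ir] /integrableP[mi ii]]|[[mr mi] fi]].
  split; first by split; exact/measurable_EFinP.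
  apply: (@le_lt_trans _ _ (\int[mu]_x (`|(complex.Re (f x))%:E| + `|(complex.Im (f x))%:E|))%E).
    apply: le_ge0_integral => x; first by rewrite lee_fin cabs_ge0.
    by rewrite -EFinD lee_fin cabs_le_ReIm.
  rewrite ge0_integralD//; first by rewrite lte_add_pinfty.
  - exact: measurableT_comp.
  - exact: measurableT_comp.
split; apply/integrableP; split; try exact/measurable_EFinP.
- by apply: le_lt_trans fi; apply: le_ge0_integral => x//; rewrite lee_fin Re_le_cabs.
- by apply: le_lt_trans fi; apply: le_ge0_integral => x//; rewrite lee_fin Im_le_cabs.
Qed.

Lemma cintegrable_le f (g : T -> R) : cmeasurable f ->
  (forall x, cabs (f x) <= g x) -> (\int[mu]_x (g x)%:E < +oo)%E -> cintegrable mu f.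
Proof.
move=> mf fg gi; apply/cintegrableP; split => //.
by apply: le_lt_trans gi; apply: le_ge0_integral => x; rewrite lee_fin ?cabs_ge0.
Qed.

Lemma cintegrable_linear (k : R[i]) f g : cintegrable mu f -> cintegrable mu g ->
  cintegrable mu (fun x => k * f x + g x).
Proof.
move=> /cintegrableP[mf fi] /cintegrableP[mg gi]; apply/cintegrableP; split.
  by apply: cmeasurableD => //; apply: cmeasurableM => //; exact: cmeasurable_cst.
have m1 : measurable_fun setT (fun x => (cabs (f x))%:E).
  by apply/measurable_EFinP; exact: measurable_cabs.
have m2 : measurable_fun setT (fun x => (cabs (g x))%:E).
  by apply/measurable_EFinP; exact: measurable_cabs.
apply: (@le_lt_trans _ _ (\int[mu]_x ((cabs k)%:E * (cabs (f x))%:E + (cabs (g x))%:E))%E).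
  apply: le_ge0_integral => x; first by rewrite lee_fin cabs_ge0.
  by rewrite -EFinM -EFinD lee_fin -cabsM cabsD.
have k0 := cabs_ge0 k.
rewrite ge0_integralD//; first last.
- by move=> x _; rewrite lee_fin cabs_ge0.
- by apply: emeasurable_funM => //; exact: measurable_cst.
- by move=> x _; rewrite -EFinM lee_fin mulr_ge0// cabs_ge0.
rewrite ge0_integralZl//; last by move=> x _; rewrite lee_fin cabs_ge0.
by rewrite lte_add_pinfty// lte_mul_pinfty.
Qed.

Lemma cint_linear (k : R[i]) f g : cintegrable mu f -> cintegrable mu g ->
  cint mu (fun x => k * f x + g x) = k * cint mu f + cint mu g.
Proof.
case: k => a b [f1 f2] [g1 g2]; rewrite /cint.
have i1 (c : R) h : mu.-integrable setT (EFin \o h) ->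
    mu.-integrable setT (EFin \o (fun x => c * h x)).
  by move=> ih; exact: (integrableZl measurableT c ih).
rewrite (_ : (\int[mu]_x complex.Re (Complex a b * f x + g x)) =
  a * (\int[mu]_x complex.Re (f x)) - b * (\int[mu]_x complex.Im (f x)) +
  \int[mu]_x complex.Re (g x)); last first.
  rewrite -!RintegralZl// -RintegralB//; [|exact: i1|exact: i1].
  rewrite -RintegralD//; last by apply: (integrableB measurableT (i1 a _ f1) (i1 b _ f2)).
  by apply: eq_Rintegral => x _; case: (f x) (g x) => ? ? [].
rewrite (_ : (\int[mu]_x complex.Im (Complex a b * f x + g x)) =
  a * (\int[mu]_x complex.Im (f x)) + b * (\int[mu]_x complex.Re (f x)) +
  \int[mu]_x complex.Im (g x)); last first.
  rewrite -!RintegralZl// -RintegralD//; [|exact: i1|exact: i1].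
  rewrite -RintegralD//; last by apply: (integrableD measurableT (i1 a _ f2) (i1 b _ f1)).
  by apply: eq_Rintegral => x _; case: (f x) (g x) => ? ? [].
by [].
Qed.

Lemma cint0 : cint mu (fun _ : T => 0 : R[i]) = 0.
Proof.
by rewrite /cint /= (_ : (\int[mu]_x 0) = 0)// /Rintegral integral0.
Qed.

Lemma cintegrableB f g : cintegrable mu f -> cintegrable mu g ->
  cintegrable mu (fun x => f x - g x).
Proof.
move=> fi gi; have := cintegrable_linear (-1) gi fi.
by congr cintegrable; apply/funext => x; rewrite mulN1r addrC.
Qed.

Lemma cintB f g : cintegrable mu f -> cintegrable mu g ->
  cint mu (fun x => f x - g x) = cint mu f - cint mu g.
Proof.
move=> fi gi; have := cint_linear (-1) gi fi; rewrite mulN1r addrC => <-.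
by congr cint; apply/funext => x; rewrite mulN1r addrC.
Qed.

(** The factor 2 comes from estimating the real and imaginary parts
    separately. *)
Lemma cabs_cint_le f (g : T -> R) : (forall x, cabs (f x) <= g x) ->
  (\int[mu]_x (g x)%:E < +oo)%E -> cmeasurable f ->
  ((cabs (cint mu f))%:E <= 2%:E * \int[mu]_x (g x)%:E)%E.
Proof.
move=> fg gi mf; have [f1 f2] := cintegrable_le mf fg gi.
have g0 x : 0 <= g x := le_trans (cabs_ge0 _) (fg x).
have I0 : (0 <= \int[mu]_x (g x)%:E)%E by apply: integral_ge0 => x _; rewrite lee_fin.
have key h : mu.-integrable setT (EFin \o h) -> (forall x, `|h x| <= g x) ->
    (`|\int[mu]_x h x|%:E <= \int[mu]_x (g x)%:E)%E.
  move=> ih hg; rewrite /Rintegral -abse_EFin fineK; last exact: integrable_fin_num.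
  apply: le_trans (le_abse_integral _ _ _) _ => //; first by case/integrableP: ih.
  by apply: le_ge0_integral => x//; rewrite lee_fin.
apply: (@le_trans _ _ (`|\int[mu]_x complex.Re (f x)| + `|\int[mu]_x complex.Im (f x)|)%:E).
  by rewrite lee_fin; exact: cabs_le_ReIm.
rewrite (_ : 2%:E = 1 + 1)%E; last by rewrite -EFinD.
rewrite ge0_muleDl// mul1e EFinD; apply: leeD; apply: key => // x.
- exact: le_trans (Re_le_cabs _) (fg x).
- exact: le_trans (Im_le_cabs _) (fg x).
Qed.

End ComplexIntegral.

Section WeightHoelder.
Variables (R : realType) (V : normedModType R).
Variable mu : {measure set (borel V) -> \bar R}.
Hypothesis hfd : finite_dimensional V.
Hypothesis hleb : is_lebesgue mu.
Local Open Scope ereal_scope.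

Let mu0 := lebesgue_setT_gt0 hleb.

(** An integrable bounded function lies in every Lebesgue space. *)
Lemma weight_hoelder (w : V -> R) (p : \bar R) : 1 <= p ->
  measurable_fun setT (w : borel V -> R) -> (forall x, 0 <= w x <= 1)%R ->
  \int[mu]_x (w x)%:E < +oo ->
  exists C : R, (0 < C)%R /\ forall t : V -> \bar R,
    measurable_fun setT (t : borel V -> \bar R) -> (forall x, 0 <= t x) ->
    \int[mu]_x ((w x)%:E * t x) <= C%:E * Lnorm mu p t.
Proof.
move=> p1 mw w01 wi.
have w0 x : (0 <= w x)%R by case/andP: (w01 x).
have mwE : measurable_fun setT ((fun x => (w x)%:E) : borel V -> \bar R).
  exact/measurable_EFinP.
suff [p' hp' wp'] : exists2 p', hoelder_exponents p' p 1 & Lnorm mu p' (fun x => (w x)%:E) < +oo.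
  have fin : Lnorm mu p' (fun x => (w x)%:E) \is a fin_num by rewrite ge0_fin_numE// Lnorm_ge0.
  exists (fine (Lnorm mu p' (fun x => (w x)%:E)) + 1)%R.
  split; first by rewrite ltr_wpDl// fine_ge0// Lnorm_ge0.
  move=> t mt t0; rewrite EFinD fineK//.
  apply: (@le_trans _ _ (Lnorm mu p' (fun x => (w x)%:E) * Lnorm mu p t)); last first.
    by apply: lee_wpmul2r; [exact: Lnorm_ge0|rewrite leeDl].
  have := hoelder_Lnorm mu0 hp' mwE mt; rewrite Lnorm1; apply: le_trans.
  apply: le_ge0_integral => x; first by rewrite mule_ge0// lee_fin.
  by rewrite gee0_abs// mule_ge0// lee_fin.
case: p p1 => [r| |]// p1.
- have r1 : (1 <= r)%R by rewrite lee_fin in p1.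
  move: r1; rewrite le_eqVlt => /predU1P[r1|r1].
    exists +oo; first by rewrite -r1; apply: HoelderInftyL.
    apply: (@le_lt_trans _ _ 1); last exact: ltry.
    apply: (Lnormy_le mu0); apply: aeW => x; rewrite gee0_abs ?lee_fin//.
    by case/andP: (w01 x).
  have r0 : (0 < r)%R by exact: lt_trans r1.
  have rV : (r^-1 < 1)%R by rewrite invf_lt1.
  pose s := ((1 - r^-1)^-1)%R.
  have s0 : (0 < s)%R by rewrite invr_gt0 subr_gt0.
  exists s%:E.
    by apply: (@HoelderFin _ _ _ _ s r 1) => //; rewrite /s invrK subrK invr1.
  rewrite LnormE; apply: poweR_lty.
  apply: le_lt_trans wi; apply: le_ge0_integral => x; first exact: poweR_ge0.
  rewrite gee0_abs ?lee_fin//.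
  have [->|wx] := eqVneq (w x) 0%R; first by rewrite powR0 ?gt_eqF.
  apply: ge1r_powR.
    by rewrite lt_neqAle eq_sym wx w0; case/andP: (w01 x).
  by rewrite /s invf_ge1 ?subr_gt0// gerBl invr_ge0 ltW.
- exists 1; first exact: (@HoelderInftyR _ _ _ _ 1%R).
  rewrite Lnorm1; apply: le_lt_trans wi; apply: le_ge0_integral => x //.
  by rewrite gee0_abs ?lee_fin.
Qed.

(** Hoelder's inequality in the inner variable, then in the outer one. *)
Lemma mixed_weight_hoelder (w : V -> R) (p q : \bar R) : 1 <= p -> 1 <= q ->
  measurable_fun setT (w : borel V -> R) -> (forall x, 0 <= w x <= 1)%R ->
  \int[mu]_x (w x)%:E < +oo ->
  exists C : R, (0 < C)%R /\ forall t : V -> V -> \bar R,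
    measurable_fun setT (fun z : borel V * borel V => t z.1 z.2) ->
    (forall x y, 0 <= t x y) ->
    \int[mu]_y ((w y)%:E * \int[mu]_x ((w x)%:E * t x y)) <=
    C%:E * Lnorm mu q (fun y => Lnorm mu p (fun x => t x y)).
Proof.
move=> p1 q1 mw w01 wi.
have w0 x : (0 <= w x)%R by case/andP: (w01 x).
have [C1 [C10 h1]] := weight_hoelder p1 mw w01 wi.
have [C2 [C20 h2]] := weight_hoelder q1 mw w01 wi.
exists (C2 * C1)%R; split; first exact: mulr_gt0.
move=> t mt t0.
pose u y := \int[mu]_x ((w x)%:E * t x y).
have u0 y : 0 <= u y by apply: integral_ge0 => x _; rewrite mule_ge0// lee_fin.
have mt' y : measurable_fun setT ((fun x => t x y) : borel V -> \bar R).
  exact: (measurableT_comp mt (measurable_pair2 (y : borel V))).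
have mu' : measurable_fun setT (u : borel V -> \bar R).
  apply: (measurable_partial_integral (lebesgue_sigma_finite hfd hleb)
    (f := fun z : borel V * borel V => (w z.2)%:E * t z.2 z.1)).
    apply: emeasurable_funM.
      apply/measurable_EFinP; exact: (measurableT_comp mw measurable_snd).
    have ms : measurable_fun setT (fun z : borel V * borel V => (z.2, z.1)).
      by apply/measurable_fun_pairP; split; [exact: measurable_snd|exact: measurable_fst].
    exact: (measurableT_comp mt ms).
  by move=> z; rewrite mule_ge0// lee_fin.
apply: (le_trans (h2 u mu' u0)).
rewrite EFinM -muleA; apply: lee_wpmul2l; first by rewrite lee_fin ltW.
have C1N : (C1 != 0)%R by rewrite gt_eqF.
have uE : u = (fun y => C1%:E * (C1^-1%:E * u y)).
  by apply/funext => y; rewrite muleA -EFinM divff// mul1e.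
rewrite uE (LnormZ_ge0 mu0) ?(ltW C10)//; first last.
- by apply: emeasurable_funM => //; exact: measurable_cst.
- exact: lt_le_trans q1.
apply: lee_wpmul2l; first by rewrite lee_fin ltW.
apply: (le_Lnorm mu0); first exact: lt_le_trans q1.
move=> y; rewrite !gee0_abs ?Lnorm_ge0//; last by rewrite mule_ge0// lee_fin invr_ge0 ltW.
rewrite -[leRHS]mul1e -(mulVf C1N) EFinM -muleA; apply: lee_wpmul2l.
  by rewrite lee_fin invr_ge0 ltW.
exact: h1.
Qed.

End WeightHoelder.

(** * Mixed norms and composition of kernels *)

Section TripleIntegral.
Variables (R : realType) (V : normedModType R) (mu : {measure set (borel V) -> \bar R}).
Hypotheses (hfd : finite_dimensional V) (hleb : is_lebesgue mu).
Local Open Scope ereal_scope.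

Let sf := lebesgue_sigma_finite hfd hleb.

(** Integration over the middle point becomes a twisted convolution when kernels
    are written as functions of the first point and the displacement. *)
Lemma twisted_convolutionE (B1 B2 : V -> V -> R) (x u : V) :
  continuous (fun z : V * V => B1 z.1 z.2) -> continuous (fun z : V * V => B2 z.1 z.2) ->
  (forall x y, (0 <= B1 x y)%R) -> (forall x y, (0 <= B2 x y)%R) ->
  \int[mu]_y (B2 x y * B1 y (x + u)%R)%:E =
  \int[mu]_v (B2 x (x + v)%R * B1 (x + v)%R ((x + v) + (u - v))%R)%:E.
Proof.
move=> c1 c2 pos1 pos2; rewrite -(integral_translation hleb x) /=; first last.
- by move=> y; rewrite lee_fin mulr_ge0.
- apply/measurable_EFinP; apply: continuous_measurable_borel => y.
  by apply: cvgM; [exact: continuous_section c2 y|exact: (@continuous_cosection R V B1 (x + u)%R)].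
apply: eq_integral => v _; congr (_ * B1 _ _)%:E.
by rewrite addrACA addrN addr0.
Qed.

(** With the kernels [B1] and [B2] seen as functions of the first point and the
    displacement, integration over the middle point is a twisted convolution;
    the product of the weights at the outer points is dominated by a product of
    weights in the first point and in the total displacement. *)
Lemma weighted_composition_bound (N : nat) (p1 p2 p q1 q2 q : \bar R) :
  \int[mu]_x (poly_weight N x)%:E < +oo ->
  1 <= p1 -> 1 <= p2 -> 1 <= p -> 1 <= q1 -> 1 <= q2 -> 1 <= q ->
  p1^-1 + p2^-1 = p^-1 -> q1^-1 + q2^-1 = 1 + q^-1 ->
  exists C : R, (0 < C)%R /\ forall B1 B2 : V -> V -> R,
    continuous (fun z : V * V => B1 z.1 z.2) -> continuous (fun z : V * V => B2 z.1 z.2) ->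
    (forall x y, (0 <= B1 x y)%R) -> (forall x y, (0 <= B2 x y)%R) ->
    \int[mu]_y ((\int[mu]_x (poly_weight (N + N) x * B2 x y)%:E) *
                (\int[mu]_z (poly_weight (N + N) z * B1 y z)%:E)) <=
    C%:E * (Lnorm mu q1 (fun u => Lnorm mu p1 (fun x => (B1 x (x + u)%R)%:E)) *
            Lnorm mu q2 (fun u => Lnorm mu p2 (fun x => (B2 x (x + u)%R)%:E))).
Proof.
move=> iN hp1 hp2 hp hq1 hq2 hq hpp hqq.
pose w := @poly_weight R V N.
have w0 x : (0 <= w x)%R by exact: poly_weight_ge0.
have w01 x : (0 <= w x <= 1)%R by rewrite w0 poly_weight_le1.
have mw : measurable_fun setT (w : borel V -> R) by exact: measurable_poly_weight.
have [C [C0 hC]] := mixed_weight_hoelder hfd hleb hp hq mw w01 iN.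
exists C; split=> // B1 B2 c1 c2 pos1 pos2.
pose k := @poly_weight R V (N + N).
have k0 x : (0 <= k x)%R by exact: poly_weight_ge0.
have ck : continuous k by exact: poly_weight_continuous.
have csnd (g : V -> R) : continuous g -> continuous (fun z : V * V => g z.2).
  by move=> cg z; apply: (@continuous_comp _ _ _ snd g); [exact: cvg_snd|exact: cg].
have cfst (g : V -> R) : continuous g -> continuous (fun z : V * V => g z.1).
  by move=> cg z; apply: (@continuous_comp _ _ _ fst g); [exact: cvg_fst|exact: cg].
have csec := @continuous_section R V.
have cswap (B : V -> V -> R) : continuous (fun z : V * V => B z.1 z.2) ->
    continuous (fun z : V * V => B z.2 z.1).
  move=> cB z; apply: (@continuous_comp _ _ _ (fun z : V * V => (z.2, z.1)) (fun z : V * V => B z.1 z.2)).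
    by apply: cvg_pair; [exact: cvg_snd|exact: cvg_fst].
  exact: cB.
have csec2 := @continuous_cosection R V.
have mE (g : V * V -> R) : continuous g ->
    measurable_fun setT ((fun z => (g z)%:E) : borel V * borel V -> \bar R).
  by move=> cg; apply/measurable_EFinP; exact: continuous_measurable_prod.
have mE1 (g : V -> R) : continuous g -> measurable_fun setT ((fun z => (g z)%:E) : borel V -> \bar R).
  by move=> cg; apply/measurable_EFinP; exact: continuous_measurable_borel.
pose G y := \int[mu]_z (k z * B1 y z)%:E.
have G0 y : 0 <= G y by apply: integral_ge0 => z _; rewrite lee_fin mulr_ge0.
have mG : measurable_fun setT (G : borel V -> \bar R).
  apply: (measurable_partial_integral sf (f := fun z : borel V * borel V => (k z.2 * B1 z.1 z.2)%:E)).
    by apply: mE => z; apply: cvgM; [exact: csnd|exact: c1].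
  by move=> z; rewrite lee_fin mulr_ge0.
pose t x u := \int[mu]_y (B2 x y * B1 y (x + u)%R)%:E.
have t0 x u : 0 <= t x u by apply: integral_ge0 => z _; rewrite lee_fin mulr_ge0.
have mt : measurable_fun setT (fun z : borel V * borel V => t z.1 z.2).
  apply: (measurable_partial_integral sf (f := fun z : (borel V * borel V) * borel V =>
    (B2 z.1.1 z.2 * B1 z.2 (z.1.1 + z.1.2)%R)%:E)).
    under eq_fun do rewrite EFinM.
    apply: emeasurable_funM.
      apply: (@measurableT_comp _ _ _ _ _ _ (fun z : borel V * borel V => (B2 z.1 z.2)%:E) _
         (fun z : (borel V * borel V) * borel V => (z.1.1, z.2))); first exact: mE.
      apply/measurable_fun_pairP; split; last exact: measurable_snd.
      exact: (measurableT_comp measurable_fst measurable_fst).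
    apply: (@measurableT_comp _ _ _ _ _ _ (fun z : borel V * borel V => (B1 z.1 z.2)%:E) _
       (fun z : (borel V * borel V) * borel V => (z.2, (z.1.1 + z.1.2)%R))); first exact: mE.
    apply/measurable_fun_pairP; split; first exact: measurable_snd.
    apply: (@measurableT_comp _ _ _ _ _ _ (fun z : borel V * borel V => (z.1 + z.2)%R : borel V) _ fst) => //.
    by apply: continuous_measurable_prod_borel => //; exact: add_continuous.
  by move=> z; rewrite lee_fin mulr_ge0.
have inner x : \int[mu]_y ((k x * B2 x y)%:E * G y) <=
    \int[mu]_u ((w x * w u)%:E * t x u).
  have cF : continuous (fun z : V * V => (k x * B2 x z.1) * (k z.2 * B1 z.1 z.2))%R.
    move=> z; apply: cvgM; apply: cvgM.
    - exact: cvg_cst.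
    - exact: cfst (csec _ _ c2) z.
    - exact: csnd.
    - exact: c1.
  have F0 y z : (0 <= (k x * B2 x y) * (k z * B1 y z))%R by rewrite !mulr_ge0.
  rewrite [leLHS](_ : _ = \int[mu]_y \int[mu]_z ((k x * B2 x y) * (k z * B1 y z))%:E); last first.
    apply: eq_integral => y _; under [RHS]eq_integral do rewrite EFinM.
    rewrite ge0_integralZl ?lee_fin ?mulr_ge0//.
      by apply: mE1 => z; apply: cvgM; [exact: ck|exact: csec].
    by move=> z _; rewrite lee_fin mulr_ge0.
  rewrite (tonelli sf sf (f := fun z : borel V * borel V => ((k x * B2 x z.1) * (k z.2 * B1 z.1 z.2))%:E)
     (mE _ cF)) /=; last by move=> z; rewrite lee_fin F0.
  rewrite -(integral_translation hleb x) /=; first last.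
  - by move=> z; apply: integral_ge0 => y _; rewrite lee_fin F0.
  - apply: (measurable_partial_integral sf (f := fun z : borel V * borel V => ((k x * B2 x z.2) * (k z.1 * B1 z.2 z.1))%:E)).
      exact: mE (cswap (fun y z => (k x * B2 x y) * (k z * B1 y z))%R cF).
    by move=> z; rewrite lee_fin F0.
  apply: le_ge0_integral => u.
    by apply: integral_ge0 => y _; rewrite lee_fin F0.
  rewrite -ge0_integralZl//; first last.
  - by rewrite lee_fin mulr_ge0.
  - by move=> y _; rewrite lee_fin mulr_ge0.
  - apply: mE1 => y; apply: cvgM; first exact: csec.
    exact: csec2 c1 y.
  apply: le_ge0_integral => y; first by rewrite lee_fin F0.
  rewrite -EFinM lee_fin.
  rewrite (_ : _ * _ * _ = (k x * k (x + u)) * (B2 x y * B1 y (x + u)))%R; last by ring.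
  apply: ler_wpM2r; first by rewrite mulr_ge0.
  rewrite /k /w !poly_weightD mulrACA.
  apply: (@le_trans _ _ (poly_weight N u * poly_weight N x)%R); last by rewrite mulrC.
  apply: ler_pM; rewrite ?mulr_ge0 ?poly_weight_ge0 ?poly_weight_shift//.
  by rewrite ler_piMr ?poly_weight_ge0 ?poly_weight_le1.
have cA := @continuous_displacement R V.
apply: (@le_trans _ _ (\int[mu]_u ((w u)%:E * \int[mu]_x ((w x)%:E * t x u)))); last first.
  apply: le_trans (hC t mt t0) _; apply: lee_wpmul2l; first by rewrite lee_fin ltW.
  apply: le_trans (twisted_convolution_estimate hfd hleb hp1 hp2 hp hq1 hq2 hq hpp hqq
    (A1 := fun x u => B1 x (x + u)%R) (A2 := fun x u => B2 x (x + u)%R) (cA _ c1) (cA _ c2)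
    (fun _ _ => pos1 _ _) (fun _ _ => pos2 _ _)).
  rewrite le_eqVlt; apply/orP; left; apply/eqP; congr Lnorm; apply/funext => u.
  by congr Lnorm; apply/funext => x; exact: twisted_convolutionE.
apply: (@le_trans _ _ (\int[mu]_y \int[mu]_x ((k x * B2 x y)%:E * G y))).
  apply: le_ge0_integral => y.
    by rewrite mule_ge0//; apply: integral_ge0 => x _; rewrite lee_fin mulr_ge0.
  rewrite ge0_integralZr//.
    by apply: mE1 => x; apply: cvgM; [exact: ck|exact: csec2 c2 x].
  by move=> x _; rewrite lee_fin mulr_ge0.
have mkBG : measurable_fun setT (fun z : borel V * borel V => (k z.2 * B2 z.2 z.1)%:E * G z.1).
  apply: emeasurable_funM; last exact: (measurableT_comp mG measurable_fst).
  by apply: mE => z; apply: cvgM; [exact: csnd|exact: cswap].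
rewrite (tonelli sf sf mkBG) /=; last by move=> z; rewrite mule_ge0// lee_fin mulr_ge0.
apply: (@le_trans _ _ (\int[mu]_x \int[mu]_u ((w x * w u)%:E * t x u))).
  apply: le_ge0_integral => x; last exact: inner.
  by apply: integral_ge0 => y _; rewrite mule_ge0// lee_fin mulr_ge0.
have mwt : measurable_fun setT (fun z : borel V * borel V => (w z.1 * w z.2)%:E * t z.1 z.2).
  apply: emeasurable_funM => //; apply: mE => z; apply: cvgM.
    exact: cfst (@poly_weight_continuous R V N) z.
  exact: csnd (@poly_weight_continuous R V N) z.
rewrite (tonelli sf sf mwt) /=; last by move=> z; rewrite mule_ge0// lee_fin mulr_ge0.
rewrite le_eqVlt; apply/orP; left; apply/eqP; apply: eq_integral => u _.
rewrite -ge0_integralZl//; first last.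
- by rewrite lee_fin.
- by move=> x _; rewrite mule_ge0// lee_fin.
- apply: emeasurable_funM; first exact/measurable_EFinP.
  exact: (measurableT_comp mt (measurable_pair2 (u : borel V))).
by apply: eq_integral => x _; rewrite muleA -EFinM mulrC.
Qed.

End TripleIntegral.

Section MixedNorm.
Variables (R : realType) (V : normedModType R) (mu : {measure set (borel V) -> \bar R}).
Hypotheses (hfd : finite_dimensional V) (hleb : is_lebesgue mu).
Local Open Scope ereal_scope.

Let mu0 := lebesgue_setT_gt0 hleb.
Let p_gt0 (s : \bar R) : 1 <= s -> 0 < s.
Proof. exact: lt_le_trans. Qed.

Definition mixed_norm (p q : \bar R) (A : V -> V -> R) : \bar R :=
  Lnorm mu q (fun u => Lnorm mu p (fun x => (A x u)%:E)).

Lemma mixed_norm_ge0 p q A : 0 <= mixed_norm p q A.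
Proof. exact: Lnorm_ge0. Qed.

Lemma mixed_normZ p q (c : R) (A : V -> V -> R) : 1 <= p -> 1 <= q -> (0 <= c)%R ->
  continuous (fun z : V * V => A z.1 z.2) ->
  mixed_norm p q (fun x u => c * A x u)%R = c%:E * mixed_norm p q A.
Proof.
move=> p1 q1 c0 cA; rewrite /mixed_norm -(LnormZ_ge0 mu0 (p_gt0 q1) c0).
  congr Lnorm; apply/funext => u; rewrite -(LnormZ_ge0 mu0 (p_gt0 p1) c0).
    by congr Lnorm; apply/funext => x; rewrite EFinM.
  by apply/measurable_EFinP; apply: continuous_measurable_borel; exact: continuous_cosection.
exact: measurable_Lnorm_continuous.
Qed.

Let poweRD_le (s : R) (x y : \bar R) : (0 < s)%R -> 0 <= x -> 0 <= y ->
  (x + y) `^ s <= (2 `^ s)%:E * (x `^ s + y `^ s).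
Proof.
move=> s0 x0 y0.
wlog yx : x y x0 y0 / y <= x.
  move=> h; have [/h|/ltW/h] := leP y x; first exact.
  by rewrite addeC [y `^ s + _]addeC; apply.
apply: (@le_trans _ _ ((2%:E * x) `^ s)).
  apply: le_poweR; [exact: ltW|exact: adde_ge0|].
  rewrite (_ : 2 = 1 + 1)%R// EFinD ge0_muleDl ?lee_fin// mul1e; exact: leeD.
rewrite poweRM ?lee_fin// poweR_EFin; apply: lee_wpmul2l; first by rewrite lee_fin powR_ge0.
by rewrite leeDl// poweR_ge0.
Qed.

(** The bound [(x + y) ^ s <= 2 ^ s (x ^ s + y ^ s)], applied under the integral
    with [s = p] and outside of it with [s = 1 / p]. A constant in the triangle
    inequality is harmless for continuity. *)
Lemma Lnorm_quasi_triangle (p : \bar R) (f g : V -> \bar R) : 1 <= p ->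
  measurable_fun setT (f : borel V -> \bar R) -> measurable_fun setT (g : borel V -> \bar R) ->
  (forall x, 0 <= f x) -> (forall x, 0 <= g x) ->
  Lnorm mu p (fun x => f x + g x) <= 4%:E * (Lnorm mu p f + Lnorm mu p g).
Proof.
case: p => [r| |]// p1 mf mg f0 g0; last first.
  apply: (Lnormy_le mu0).
  apply: filterS2 (ae_le_Lnormy mu0 f) (ae_le_Lnormy mu0 g) => x hf hg.
  rewrite gee0_abs ?adde_ge0//; apply: (@le_trans _ _ (Lnorm mu +oo f + Lnorm mu +oo g)).
    by apply: leeD; [rewrite -(gee0_abs (f0 x))|rewrite -(gee0_abs (g0 x))].
  rewrite -[leLHS]mul1e; apply: lee_wpmul2r; first by rewrite adde_ge0 ?Lnorm_ge0.
  by rewrite lee_fin ler1n.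
have r1 : (1 <= r)%R by rewrite lee_fin in p1.
have r0 : (0 < r)%R by exact: lt_le_trans r1.
have rV0 : (0 < r^-1)%R by rewrite invr_gt0.
rewrite !ge0_LnormE//; last by move=> x; exact: adde_ge0.
set F := \int[mu]_x (f x `^ r); set G := \int[mu]_x (g x `^ r).
have F0 : 0 <= F by apply: integral_ge0 => x _; exact: poweR_ge0.
have G0 : 0 <= G by apply: integral_ge0 => x _; exact: poweR_ge0.
have step : \int[mu]_x ((f x + g x) `^ r) <= (2 `^ r)%:E * (F + G).
  rewrite /F /G -ge0_integralD//; last 4 first.
  - by move=> x _; exact: poweR_ge0.
  - exact: measurable_fun_poweR.
  - by move=> x _; exact: poweR_ge0.
  - exact: measurable_fun_poweR.
  rewrite -ge0_integralZl//; last 2 first.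
  - by apply: emeasurable_funD; exact: measurable_fun_poweR.
  - by move=> x _; rewrite adde_ge0// poweR_ge0.
  by apply: le_ge0_integral => x; [exact: poweR_ge0|exact: poweRD_le].
apply: le_trans (le_poweR (ltW rV0) _ step) _.
  by apply: integral_ge0 => x _; exact: poweR_ge0.
have FG0 : 0 <= F + G by exact: adde_ge0.
have P20 : 0 <= (2 `^ r)%:E by rewrite lee_fin powR_ge0.
rewrite poweRM// poweR_EFin -powRrM divff ?gt_eqF// powRr1//.
apply: le_trans (lee_wpmul2l _ (poweRD_le rV0 F0 G0)) _; first by rewrite lee_fin.
rewrite muleA -EFinM; apply: lee_wpmul2r; first by rewrite adde_ge0// poweR_ge0.
rewrite lee_fin (_ : 4 = 2 * 2)%R; last by ring.
rewrite ler_pM2l// -[leRHS]powRr1//; apply: ler_powR; first by rewrite ler1n.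
by rewrite invf_le1.
Qed.

Lemma mixed_norm_quasi_triangle p q (A B C : V -> V -> R) : 1 <= p -> 1 <= q ->
  continuous (fun z : V * V => B z.1 z.2) -> continuous (fun z : V * V => C z.1 z.2) ->
  (forall x u, (0 <= A x u)%R) -> (forall x u, (0 <= B x u)%R) -> (forall x u, (0 <= C x u)%R) ->
  (forall x u, (A x u <= B x u + C x u)%R) ->
  mixed_norm p q A <= 16%:E * (mixed_norm p q B + mixed_norm p q C).
Proof.
move=> p1 q1 cB cC A0 B0 C0 ABC.
pose b u := Lnorm mu p (fun x => (B x u)%:E); pose c u := Lnorm mu p (fun x => (C x u)%:E).
have mb : measurable_fun setT (b : borel V -> \bar R) by exact: measurable_Lnorm_continuous.
have mc : measurable_fun setT (c : borel V -> \bar R) by exact: measurable_Lnorm_continuous.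
have b0 u : 0 <= b u by exact: Lnorm_ge0.
have c0 u : 0 <= c u by exact: Lnorm_ge0.
have mE (K : V -> V -> R) u : continuous (fun z : V * V => K z.1 z.2) ->
    measurable_fun setT ((fun x => (K x u)%:E) : borel V -> \bar R).
  move=> cK; apply/measurable_EFinP; apply: continuous_measurable_borel.
  exact: continuous_cosection.
apply: (@le_trans _ _ (Lnorm mu q (fun u => 4%:E * (b u + c u)))).
  apply: (le_Lnorm mu0 (p_gt0 q1)) => u.
  rewrite !gee0_abs ?Lnorm_ge0 ?mule_ge0 ?adde_ge0//.
  apply: le_trans (Lnorm_quasi_triangle p1 (mE B u cB) (mE C u cC)
    (fun x => B0 x u) (fun x => C0 x u)).
  apply: (le_Lnorm mu0 (p_gt0 p1)) => x.
  by rewrite -EFinD !gee0_abs ?lee_fin ?addr_ge0.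
apply: (@le_trans _ _ (4%:E * Lnorm mu q (fun u => b u + c u))).
  rewrite le_eqVlt; apply/orP; left; apply/eqP.
  by apply: (LnormZ_ge0 mu0 (p_gt0 q1)) => //; exact: emeasurable_funD.
rewrite (_ : 16 = 4 * 4)%R; last by ring.
rewrite EFinM -muleA; apply: lee_wpmul2l; first by rewrite lee_fin.
exact: Lnorm_quasi_triangle.
Qed.

(** The composition of two kernels is a twisted convolution in the displacement
    variables; the constant is absorbed into the factor [B2]. *)
Lemma mixed_norm_composition (p1 p2 p q1 q2 q : \bar R) (c : R) (B1 B2 K : V -> V -> R) :
  1 <= p1 -> 1 <= p2 -> 1 <= p -> 1 <= q1 -> 1 <= q2 -> 1 <= q ->
  p1^-1 + p2^-1 = p^-1 -> q1^-1 + q2^-1 = 1 + q^-1 -> (0 <= c)%R ->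
  continuous (fun z : V * V => B1 z.1 z.2) -> continuous (fun z : V * V => B2 z.1 z.2) ->
  (forall x y, (0 <= B1 x y)%R) -> (forall x y, (0 <= B2 x y)%R) ->
  (forall x u, (0 <= K x u)%R) ->
  (forall x u, (K x u)%:E <= c%:E * \int[mu]_y (B2 x y * B1 y (x + u)%R)%:E) ->
  mixed_norm p q K <= c%:E *
    (mixed_norm p1 q1 (fun x u => B1 x (x + u)%R) * mixed_norm p2 q2 (fun x u => B2 x (x + u)%R)).
Proof.
move=> hp1 hp2 hp hq1 hq2 hq hpp hqq c0 c1 c2 pos1 pos2 K0 hK.
rewrite muleCA -(mixed_normZ (A := fun x u => B2 x (x + u)%R) hp2 hq2 c0 (continuous_displacement c2)).
have cA2 : continuous (fun z : V * V => c * B2 z.1 (z.1 + z.2))%R.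
  by move=> z; apply: cvgM; [exact: cvg_cst|exact: continuous_displacement c2 z].
apply: le_trans (twisted_convolution_estimate hfd hleb hp1 hp2 hp hq1 hq2 hq hpp hqq
    (A1 := fun x u => B1 x (x + u)%R) (A2 := fun x u => (c * B2 x (x + u))%R)
    (continuous_displacement c1) cA2 (fun _ _ => pos1 _ _) (fun _ _ => mulr_ge0 c0 (pos2 _ _))).
apply: (le_Lnorm mu0 (p_gt0 hq)) => u; rewrite !gee0_abs ?Lnorm_ge0//.
apply: (le_Lnorm mu0 (p_gt0 hp)) => x; rewrite !gee0_abs ?lee_fin//; last first.
  by apply: integral_ge0 => v _; rewrite lee_fin !mulr_ge0.
apply: le_trans (hK x u) _; rewrite (twisted_convolutionE hleb x u c1 c2 pos1 pos2).
rewrite -ge0_integralZl//; last 2 first.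
- apply/measurable_EFinP; apply: continuous_measurable_borel => v; apply: cvgM.
    exact: (@continuous_section R V (fun x u => B2 x (x + u)%R) x (continuous_displacement c2) v).
  have cg : continuous (fun v : V => (x + v, x + v + (u - v))%R).
    move=> y; apply: cvg_pair; first by apply: cvgD; [exact: cvg_cst|exact: cvg_id].
    apply: cvgD; first by apply: cvgD; [exact: cvg_cst|exact: cvg_id].
    by apply: cvgB; [exact: cvg_cst|exact: cvg_id].
  exact: (@continuous_comp _ _ _ _ (fun z : V * V => B1 z.1 z.2) v (cg v) (c1 _)).
- by move=> v _; rewrite lee_fin mulr_ge0.
rewrite le_eqVlt; apply/orP; left; apply/eqP; apply: eq_integral => v _.
by rewrite -EFinM mulrA.
Qed.

End MixedNorm.

(** * Hilbert spaces *)

Section HilbertSpace.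
Variables (R : realType) (H : completeNormedModType R[i]).
Variable ip : {dot H for (@conjc R)}.
Hypothesis ip_norm : forall f : H, `|f| ^+ 2 = ip f f.
Implicit Types (f g h : H) (k : R[i]).

Lemma normE_hnorm f : `|f| = creal (hnorm f).
Proof.
have := normr_ge0 f; rewrite /hnorm /creal; case: `|f| => a b.
by rewrite lecE /= => /andP[/eqP ->].
Qed.

Lemma hnorm_ge0 f : 0 <= hnorm f.
Proof. by have := normr_ge0 f; rewrite normE_hnorm lecE /= => /andP[]. Qed.

Lemma hnorm0 : hnorm (0 : H) = 0.
Proof. by rewrite /hnorm normr0. Qed.

Lemma hnorm_eq0 f : hnorm f = 0 -> f = 0.
Proof. by move=> h; apply/eqP; rewrite -normr_eq0 normE_hnorm h. Qed.

Lemma hnormZ k f : hnorm (k *: f) = cabs k * hnorm f.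
Proof. by apply: creal_inj; rewrite -normE_hnorm normrZ crealM -normE_hnorm normcE_cabs. Qed.

Lemma hnormN f : hnorm (- f) = hnorm f.
Proof. by rewrite /hnorm normrN. Qed.

Lemma hnormB f g : hnorm (f - g) = hnorm (g - f).
Proof. by rewrite /hnorm distrC. Qed.

Lemma hnormD f g : hnorm (f + g) <= hnorm f + hnorm g.
Proof.
by have := ler_normD f g; rewrite !normE_hnorm -crealD lecE /= => /andP[_].
Qed.

Lemma ipPl k f g h : ip (k *: f + g) h = k * ip f h + ip g h.
Proof. by rewrite linearPl. Qed.

Lemma ipPr k f g h : ip h (k *: f + g) = (k^*)%C * ip h f + ip h g.
Proof. by rewrite linearPr. Qed.

Lemma ip0l h : ip 0 h = 0. Proof. exact: linear0l. Qed.
Lemma ip0r h : ip h 0 = 0. Proof. exact: linear0r. Qed.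

Lemma ipZl k f h : ip (k *: f) h = k * ip f h.
Proof. by rewrite -[k *: f]addr0 ipPl ip0l addr0. Qed.

Lemma ipZr k f h : ip h (k *: f) = (k^*)%C * ip h f.
Proof. by rewrite -[k *: f]addr0 ipPr ip0r addr0. Qed.

Lemma ipDl f g h : ip (f + g) h = ip f h + ip g h. Proof. exact: linearDl. Qed.
Lemma ipDr f g h : ip h (f + g) = ip h f + ip h g. Proof. exact: linearDr. Qed.
Lemma ipBl f g h : ip (f - g) h = ip f h - ip g h. Proof. exact: linearBl. Qed.
Lemma ipBr f g h : ip h (f - g) = ip h f - ip h g. Proof. exact: linearBr. Qed.
Lemma ipC f g : ip f g = ((ip g f)^*)%C.
Proof. by rewrite hermC expr0 mul1r. Qed.

Lemma ip_suml (I : Type) (r : seq I) (F : I -> H) h :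
  ip (\sum_(i <- r) F i) h = \sum_(i <- r) ip (F i) h.
Proof.
elim: r => [|i r IH]; first by rewrite !big_nil ip0l.
by rewrite !big_cons ipDl IH.
Qed.

Lemma ip_sumr (I : Type) (r : seq I) (F : I -> H) h :
  ip h (\sum_(i <- r) F i) = \sum_(i <- r) ip h (F i).
Proof.
elim: r => [|i r IH]; first by rewrite !big_nil ip0r.
by rewrite !big_cons ipDr IH.
Qed.

Lemma ip_self f : ip f f = creal (hnorm f ^+ 2).
Proof. by rewrite -ip_norm normE_hnorm expr2 -crealM -expr2. Qed.

Lemma cauchy_schwarz f g : cabs (ip f g) <= hnorm f * hnorm g.
Proof.
have [g0|gN0] := eqVneq (hnorm g) 0.
  by rewrite (hnorm_eq0 g0) ip0r cabs0 hnorm0 mulr0.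
pose G := hnorm g ^+ 2; pose a := ip f g.
have G0 : 0 < G by rewrite exprn_gt0// lt_neqAle eq_sym gN0 hnorm_ge0.
have key : ip (creal G *: f - a *: g) (creal G *: f - a *: g) =
    creal (G * (G * hnorm f ^+ 2 - cabs a ^+ 2)).
  rewrite ipBl !ipBr !ipZl !ipZr conj_creal (ipC g f) -/a !ip_self -/G.
  rewrite crealM crealB crealM cabs_sqr.
  by ring.
have : 0 <= G * (G * hnorm f ^+ 2 - cabs a ^+ 2).
  by have := key; rewrite ip_self => /creal_inj <-; rewrite sqr_ge0.
rewrite pmulr_rge0// subr_ge0 /G -exprMn -/a.
by rewrite ler_pXn2r ?nnegrE ?mulr_ge0 ?hnorm_ge0 ?cabs_ge0// mulrC.
Qed.

Lemma hilbert_nbhsP (x : H) (A : set H) : @lnbhs R (hilbert_lcs H) x A <->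
  exists2 e : R, 0 < e & forall y, hnorm (y - x) < e -> A y.
Proof.
split=> [[n [s [e [e0 h]]]]|[e e0 h]].
  by exists e => // y xy; apply: h.
exists 1%N, (fun=> tt), e; split => // y _ /(_ ord0); exact: h.
Qed.

Lemma cvg_hilbert (T : Type) (F : set_system T) (FF : Filter F) (f : T -> H) (l : H) :
  f @ F `=>` @lnbhs R (hilbert_lcs H) l <->
  (forall e : R, 0 < e -> \forall t \near F, hnorm (f t - l) < e).
Proof.
split=> [h e e0|h A /hilbert_nbhsP[e e0 he]].
  by apply: (h [set y | hnorm (y - l) < e]); apply/hilbert_nbhsP; exists e.
by apply: filterS (h e e0) => t; exact: he.
Qed.

Lemma cvg_hilbert_linear (T : Type) (F : set_system T) (FF : Filter F) (f g : T -> H)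
    (l m : H) k :
  f @ F `=>` @lnbhs R (hilbert_lcs H) l -> g @ F `=>` @lnbhs R (hilbert_lcs H) m ->
  (fun t => k *: f t + g t) @ F `=>` @lnbhs R (hilbert_lcs H) (k *: l + m).
Proof.
move=> /cvg_hilbert hf /cvg_hilbert hg; apply/cvg_hilbert => e e0.
have c0 := cabs_ge0 k.
have e1 : 0 < e / (2 * (cabs k + 1)) by rewrite divr_gt0// mulr_gt0// ltr_wpDl.
have e2 : 0 < e / 2 by rewrite divr_gt0.
near=> t.
rewrite opprD addrACA -scalerBr; apply: le_lt_trans (hnormD _ _) _.
rewrite (splitr e) ler_ltD//; last by near: t; exact: hg.
rewrite hnormZ.
have h1 : hnorm (f t - l) < e / (2 * (cabs k + 1)) by near: t; exact: hf.
apply: (@le_trans _ _ (cabs k * (e / (2 * (cabs k + 1))))).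
  by apply: ler_wpM2l => //; exact: ltW.
have -> : cabs k * (e / (2 * (cabs k + 1))) = e / 2 * (cabs k / (cabs k + 1)).
  by field; rewrite gt_eqF// ltr_wpDl.
rewrite ger_pMr//.
by rewrite ler_pdivrMr ?ltr_wpDl// mul1r lerDl.
Unshelve. all: by end_near.
Qed.

Lemma cvg_hilbert_unique (T : Type) (F : set_system T) (FF : ProperFilter F) (f : T -> H)
    (l m : H) :
  f @ F `=>` @lnbhs R (hilbert_lcs H) l -> f @ F `=>` @lnbhs R (hilbert_lcs H) m -> l = m.
Proof.
move=> /cvg_hilbert hf /cvg_hilbert hg.
apply/eqP; rewrite -subr_eq0; apply/eqP; apply: hnorm_eq0; apply/eqP.
rewrite eq_le hnorm_ge0 andbT; apply/ler_addgt0Pr => e e0; rewrite add0r.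
have e2 : 0 < e / 2 by rewrite divr_gt0.
have [t [h1 h2]] := filter_ex (filterI (hf _ e2) (hg _ e2)).
rewrite -(subrKA (f t)) (splitr e); apply: le_trans (hnormD _ _) _.
by rewrite [hnorm (l - _)]hnormB; apply: lerD; exact: ltW.
Qed.

Lemma cvg_hilbert_ip (T : Type) (F : set_system T) (FF : Filter F) (f : T -> H)
    (l g : H) : f @ F `=>` @lnbhs R (hilbert_lcs H) l ->
  forall e : R, 0 < e -> \forall t \near F, cabs (ip (f t) g - ip l g) < e.
Proof.
move=> /cvg_hilbert hf e e0.
have g0 := hnorm_ge0 g.
have g1 : 0 < hnorm g + 1 by rewrite ltr_wpDl.
apply: filterS (hf _ (divr_gt0 e0 g1)) => t ht.
rewrite -ipBl; apply: le_lt_trans (cauchy_schwarz _ _) _.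
apply: (@le_lt_trans _ _ (hnorm (f t - l) * (hnorm g + 1))).
  by rewrite ler_wpM2l ?hnorm_ge0// lerDl.
by rewrite -ltr_pdivlMr.
Qed.

(** With the next lemma, this makes the smooth vectors a linear subspace. *)
Lemma Ck_linear (k : R[i]) (n : nat) : forall (E : tvsType R) (U : set E) (f g : E -> H),
  @lcs_Ck R (hilbert_lcs H) n E U f -> @lcs_Ck R (hilbert_lcs H) n E U g ->
  @lcs_Ck R (hilbert_lcs H) n E U (fun x => k *: f x + g x).
Proof.
rewrite /lcs_Ck; elim: n => [|n IH] E U f g /=.
  by move=> hf hg x Ux; apply: cvg_hilbert_linear; [exact: hf|exact: hg].
move=> [cf [df [hdf cdf]]] [cg [dg [hdg cdg]]]; split.
  by move=> x Ux; apply: cvg_hilbert_linear; [exact: cf|exact: cg].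
exists (fun z => k *: df z + dg z); split; last exact: IH.
move=> x v Ux.
rewrite (_ : (fun t : R => _) = fun t : R =>
  k *: (creal t^-1 *: (f (x + t *: v) - f x)) + creal t^-1 *: (g (x + t *: v) - g x)); last first.
  apply/funext => t; rewrite opprD addrACA -scalerBr scalerDr !scalerA.
  by rewrite [creal _ * k]mulrC.
by apply: cvg_hilbert_linear; [exact: hdf|exact: hdg].
Qed.

Lemma Ck_cst (c : H) (n : nat) : forall (E : tvsType R) (U : set E),
  @lcs_Ck R (hilbert_lcs H) n E U (fun=> c).
Proof.
have h0 e : 0 < e -> hnorm (0 : H) < e by rewrite hnorm0.
move: c; rewrite /lcs_Ck; elim: n => [|n IH] c E U /=.
  by move=> x Ux; apply/cvg_hilbert => e e0; apply: nearW => t; rewrite subrr; exact: h0.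
split; first by move=> x Ux; apply/cvg_hilbert => e e0; apply: nearW => t; rewrite subrr; exact: h0.
exists (fun=> 0); split; last exact: IH.
by move=> x v _; apply/cvg_hilbert => e e0; apply: nearW => t; rewrite subrr scaler0 subrr; exact: h0.
Qed.

End HilbertSpace.

Section ApproximateRiesz.
Variables (R : realType) (E : lmodType R[i]) (D : set E).
Hypothesis D0 : D 0.
Hypothesis DL : forall (k : R[i]) x y, D x -> D y -> D (k *: x + y).
Variables (Q : E -> E -> R[i]) (q : E -> R).
Hypothesis QPl : forall k x y z, D x -> D y -> D z -> Q (k *: x + y) z = k * Q x z + Q y z.
Hypothesis QC : forall x y, D x -> D y -> Q x y = ((Q y x)^*)%C.
Hypothesis Qq : forall x, D x -> Q x x = creal (q x).
Hypothesis q0 : forall x, D x -> 0 <= q x.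
Variables (l : E -> R[i]) (C : R).
Hypothesis lL : forall k x y, D x -> D y -> l (k *: x + y) = k * l x + l y.
Hypothesis lC : forall x, D x -> cabs (l x) <= C * Num.sqrt (q x).

Let l0 : l 0 = 0.
Proof.
by have := lL (-1) D0 D0; rewrite scaler0 addr0 mulN1r addNr.
Qed.

Let DZ k x : D x -> D (k *: x).
Proof. by move=> Dx; rewrite -[k *: x]addr0; exact: DL. Qed.

Let lZ k x : D x -> l (k *: x) = k * l x.
Proof. by move=> Dx; rewrite -[k *: x]addr0 lL// l0 addr0. Qed.

Let QPr k x y z : D x -> D y -> D z -> Q z (k *: x + y) = (k^*)%C * Q z x + Q z y.
Proof.
move=> Dx Dy Dz; rewrite QC//; last exact: DL.
by rewrite QPl// rmorphD rmorphM /= -!QC.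
Qed.

Let Q0l z : D z -> Q 0 z = 0.
Proof.
by move=> Dz; have := QPl (-1) D0 D0 Dz; rewrite scaler0 addr0 mulN1r addNr.
Qed.

Let qP k x y : D x -> D y ->
  q (k *: x + y) = cabs k ^+ 2 * q x + 2 * complex.Re (k * Q x y) + q y.
Proof.
move=> Dx Dy; apply: creal_inj; rewrite -Qq; last exact: DL.
rewrite QPl ?QPr//; last exact: DL.
rewrite (QC Dy Dx) !Qq// !crealD (crealM (_ ^+ 2)) (crealM 2).
have e : creal 2 * creal (complex.Re (k * Q x y)) = k * Q x y + ((k * Q x y)^*)%C :> R[i].
  by rewrite addcJ /creal; congr (_ * _); rewrite -[RHS](rmorph_nat (real_complex R)).
rewrite e cabs_sqr rmorphM /=; ring.
Qed.

Let qZ k x : D x -> q (k *: x) = cabs k ^+ 2 * q x.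
Proof.
move=> Dx; have := qP k Dx D0; rewrite addr0 => ->.
have Qx0 : Q x 0 = 0 by rewrite QC// Q0l// rmorph0.
have q00 : q 0 = 0 by apply: creal_inj; rewrite -Qq// Q0l.
by rewrite Qx0 mulr0 mulr0 q00 !addr0.
Qed.

(** A bounded functional on a (possibly incomplete) semi-inner product space is
    approximated by inner products with vectors on which it is almost extremal. *)
Lemma approximate_riesz (eps : R) : 0 < eps ->
  exists2 h, D h & forall x, D x -> cabs (l x - Q x h) <= eps * Num.sqrt (q x).
Proof.
move=> eps0.
pose S := [set t | exists x, [/\ D x, q x <= 1 & t = cabs (l x)]].
have S0 : S 0.
  exists 0; split => //; last by rewrite l0 cabs0.
  by have := qZ 0 D0; rewrite scale0r cabs0 expr0n mul0r => ->.
have C'0 : 0 <= Num.max C 0 by rewrite le_max lexx orbT.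
have Sub : ubound S (Num.max C 0).
  move=> _ [x [Dx qx ->]]; apply: le_trans (lC Dx) _.
  apply: (@le_trans _ _ (Num.max C 0 * Num.sqrt (q x))).
    by rewrite ler_wpM2r ?sqrtr_ge0// le_max lexx.
  rewrite ler_piMr//; rewrite -sqrtr1; exact: ler_wsqrtr.
have hS : has_sup S by split; [exists 0|exists (Num.max C 0)].
set M := sup S.
have M0 : 0 <= M by apply: sup_upper_bound.
have lM x : D x -> cabs (l x) <= M * Num.sqrt (q x).
  move=> Dx; have [qx0|qxN0] := eqVneq (q x) 0.
    by have := lC Dx; rewrite qx0 sqrtr0 !mulr0.
  have qx : 0 < Num.sqrt (q x) by rewrite sqrtr_gt0 lt_neqAle eq_sym qxN0 q0.
  pose k : R[i] := creal (Num.sqrt (q x))^-1.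
  have : cabs (l (k *: x)) <= M.
    apply: sup_upper_bound => //; exists (k *: x); split => //; first exact: DZ.
    rewrite qZ// cabs_creal ger0_norm ?invr_ge0 ?(ltW qx)// exprVn sqr_sqrtr ?q0//.
    by rewrite mulVf.
  rewrite lZ// cabsM cabs_creal ger0_norm ?invr_ge0 ?(ltW qx)//.
  by rewrite mulrC ler_pdivrMr.
have [MZ|MN0] := eqVneq M 0.
  exists 0 => // x Dx; rewrite QC// Q0l// rmorph0 subr0.
  apply: (le_trans (lM _ Dx)); rewrite MZ mul0r mulr_ge0 ?sqrtr_ge0//; exact: ltW.
have {M0 MN0}M0 : 0 < M by rewrite lt_neqAle eq_sym MN0.
pose s := Num.min 1 (eps / (3 * M)).
have s0 : 0 < s by rewrite lt_min ltr01 divr_gt0// mulr_gt0.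
have s1 : s <= 1 by rewrite ge_min lexx.
have sM : 3 * M * s <= eps.
  by rewrite mulrC -ler_pdivlMr ?mulr_gt0// ge_min lexx orbT.
have [_ [x0 [Dx0 qx0 ->]] hx0] := sup_adherent (mulr_gt0 M0 (exprn_gt0 2 s0)) hS.
rewrite -/M in hx0.
have [z0 [cz0 hz0]] : exists z, cabs z = 1 /\ z * l x0 = creal (cabs (l x0)).
  have [lx0|lx0] := eqVneq (cabs (l x0)) 0.
    by exists 1; rewrite cabs1 lx0 mul1r (cabs_eq0 lx0).
  exists (((l x0)^*)%C * creal (cabs (l x0))^-1).
  rewrite cabsM cabsJ cabs_creal ger0_norm ?invr_ge0 ?cabs_ge0// divff//; split => //.
  rewrite mulrC mulrA -cabs_sqr -crealM expr2 -mulrA divff// mulr1//.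
pose h0 := z0 *: x0.
have Dh0 : D h0 by exact: DZ.
have qh0 : q h0 <= 1 by rewrite qZ// cz0 expr1n mul1r.
set m := cabs (l x0) in hz0 hx0.
have lh0 : l h0 = creal m by rewrite lZ.
have m0 : 0 <= m by exact: cabs_ge0.
have mM : m <= M by apply: sup_upper_bound => //; exists x0.
exists (creal M *: h0); first exact: DZ.
(* the case of unit vectors; the general case follows by scaling *)
have unit x : D x -> q x <= 1 -> cabs (l x - Q x (creal M *: h0)) <= eps.
  move=> Dx qx.
  have QM : Q x (creal M *: h0) = creal M * Q x h0.
    have := QPr (creal M) Dh0 D0 Dx; rewrite addr0 conj_creal => ->.
    by rewrite [Q x 0]QC// Q0l// rmorph0 addr0.
  pose Er := creal m * l x - creal (M ^+ 2) * Q x h0.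
  have Ebnd : cabs Er <= 3 / 2 * M ^+ 2 * s.
    have [E0|EN0] := eqVneq (cabs Er) 0.
      by rewrite E0 !mulr_ge0// ltW.
    pose z := creal s * (((Er)^*)%C * creal (cabs Er)^-1).
    have cz : cabs z = s.
      rewrite !cabsM cabsJ !cabs_creal !ger0_norm ?invr_ge0 ?cabs_ge0 ?(ltW s0)//.
      by rewrite divff// mulr1.
    have zE : z * Er = creal (s * cabs Er).
      rewrite /z -!mulrA [creal _^-1 * _]mulrC !mulrA.
      rewrite -[creal s * _ * Er]mulrA [(_^*)%C * Er]mulrC -cabs_sqr -!crealM.
      by congr creal; rewrite expr2 -!mulrA divff// mulr1.
    have := lM _ (DL z Dx Dh0).
    rewrite lL// lh0 => h1.
    have h2 : cabs (z * l x + creal m) ^+ 2 <= M ^+ 2 * q (z *: x + h0).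
      rewrite -[q (z *: x + h0)]sqr_sqrtr ?q0//; last exact: DL.
      rewrite -exprMn ler_pXn2r ?nnegrE ?cabs_ge0 ?mulr_ge0 ?sqrtr_ge0//; exact: ltW.
    have h3 : m ^+ 2 + 2 * m * complex.Re (z * l x) <= cabs (z * l x + creal m) ^+ 2.
      have -> : cabs (z * l x + creal m) ^+ 2 =
          cabs (z * l x) ^+ 2 + 2 * m * complex.Re (z * l x) + m ^+ 2.
        apply: creal_inj; rewrite cabs_sqr.
        case: (z * l x) => a b; rewrite /cabs normc_def /= sqr_sqrtr ?addr_ge0 ?sqr_ge0//.
        by apply/eqP; rewrite eq_complex /=; apply/andP; split; apply/eqP; ring.
      by have := sqr_ge0 (cabs (z * l x)); lra.
    rewrite qP// cz in h2.
    have h4 : 2 * complex.Re (z * Er) = 2 * m * complex.Re (z * l x) -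
        2 * M ^+ 2 * complex.Re (z * Q x h0).
      rewrite /Er mulrBr mulrCA [z * (creal (M ^+ 2) * _)]mulrCA.
      by case: (z * l x) (z * Q x h0) => a b [c d] /=; ring.
    have := le_trans h3 h2; rewrite zE in h4.
    have qx' := q0 Dx; have s2 := sqr_ge0 s; have M2 := sqr_ge0 M.
    have e1 : M ^+ 2 * (s ^+ 2 * q x) <= M ^+ 2 * s ^+ 2.
      by rewrite ler_wpM2l// ler_piMr.
    have e2 : M ^+ 2 * q h0 <= M ^+ 2 by rewrite ler_piMr.
    rewrite /= in h4 => h5.
    have h6 : 2 * (s * cabs Er) <= M ^+ 2 - m ^+ 2 + M ^+ 2 * s ^+ 2.
      rewrite h4; move: h5; rewrite !mulrDr; lra.
    have h7 : M ^+ 2 - m ^+ 2 <= 2 * M * (M * s ^+ 2).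
      rewrite subr_sqr mulrC.
      have d0 : 0 <= M - m by rewrite subr_ge0.
      apply: (@le_trans _ _ (2 * M * (M - m))).
        by rewrite ler_wpM2r//; lra.
      by rewrite ler_wpM2l ?mulr_ge0 ?(ltW M0)//; lra.
    have h8 : s * cabs Er <= s * (3 / 2 * M ^+ 2 * s).
      have -> : s * (3 / 2 * M ^+ 2 * s) = 3 / 2 * (M ^+ 2 * s ^+ 2) by ring.
      have e3 : 2 * M * (M * s ^+ 2) = 2 * (M ^+ 2 * s ^+ 2) by ring.
      by rewrite e3 in h7; lra.
    by rewrite ler_pM2l in h8.
  have lx1 : cabs (l x) <= M.
    by apply: sup_upper_bound => //; exists x.
  have -> : l x - Q x (creal M *: h0) =
      creal M^-1 * (Er + creal (M - m) * l x).
    rewrite QM /Er crealB.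
    have MN : creal M != 0 :> R[i] by apply/eqP => /(@creal_inj R M 0) h; move: M0; rewrite h ltxx.
    rewrite crealV expr2 crealM; field.
    exact: MN.
  rewrite cabsM cabs_creal ger0_norm ?invr_ge0 ?(ltW M0)// mulrC ler_pdivrMr//.
  apply: (le_trans (cabsD _ _)); rewrite cabsM cabs_creal ger0_norm ?subr_ge0//.
  have b1 : (M - m) * cabs (l x) <= M * s ^+ 2 * M.
    by apply: ler_pM; rewrite ?cabs_ge0 ?subr_ge0//; lra.
  have b2 : M * s ^+ 2 * M <= M ^+ 2 * s.
    have -> : M * s ^+ 2 * M = M ^+ 2 * s * s by ring.
    by rewrite ler_piMr// mulr_ge0 ?sqr_ge0 ?(ltW s0).
  have b3 : 3 * M ^+ 2 * s <= eps * M.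
    have -> : 3 * M ^+ 2 * s = 3 * M * s * M by ring.
    by rewrite ler_wpM2r// ltW.
  have b4 : 0 <= M ^+ 2 * s by rewrite mulr_ge0 ?sqr_ge0 ?(ltW s0).
  have b5 : 3 * M ^+ 2 * s = 3 * (M ^+ 2 * s) by ring.
  have b6 : 3 / 2 * M ^+ 2 * s = 3 / 2 * (M ^+ 2 * s) by ring.
  by rewrite b5 in b3; rewrite b6 in Ebnd; lra.
move=> x Dx.
have DMh : D (creal M *: h0) by exact: DZ.
have QZ k : Q (k *: x) (creal M *: h0) = k * Q x (creal M *: h0).
  by have := QPl k Dx D0 DMh; rewrite addr0 Q0l// addr0.
apply/ler_addgt0Pr => e e0.
(* scale by the norm perturbed to be positive *)
pose t := Num.sqrt (q x) + e / eps.
have t0 : 0 < t by rewrite ltr_wpDl ?sqrtr_ge0// divr_gt0.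
have tE : eps * t = eps * Num.sqrt (q x) + e.
  by rewrite /t mulrDr mulrCA divff ?mulr1// gt_eqF.
have qt : q (creal t^-1 *: x) <= 1.
  rewrite qZ// cabs_creal ger0_norm ?invr_ge0 ?(ltW t0)// exprVn.
  rewrite -[X in _ * X]sqr_sqrtr ?q0// -exprVn -exprMn expr_le1//; last first.
    by rewrite mulr_ge0 ?sqrtr_ge0 ?invr_ge0 ?(ltW t0).
  by rewrite mulrC ler_pdivrMr// mul1r lerDl divr_ge0// ltW.
have := unit _ (DZ _ Dx) qt.
rewrite lZ// QZ -mulrBr cabsM cabs_creal ger0_norm ?invr_ge0 ?(ltW t0)//.
by rewrite mulrC ler_pdivrMr// tE.
Qed.

End ApproximateRiesz.

(** * Smooth vectors *)

(** The passage from smallness near the origin to a bound, by homogeneity: [p]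
    and [s] are the values at a vector, [t] is a scaling factor. *)
Lemma scaling_bound (R : realType) (p s : R) : 0 <= s ->
  (forall t, 0 < t -> t * s < 1 -> t * p <= 1) -> p <= 2 * s.
Proof.
move=> s0 h; have [s1|s1] := eqVneq s 0.
  rewrite s1 mulr0 leNgt; apply/negP => p0.
  have := h (2 / p) (divr_gt0 (ltr0Sn R 1) p0).
  by rewrite s1 mulr0 => /(_ ltr01); rewrite divfK ?gt_eqF//; lra.
have {s1}s1 : 0 < s by rewrite lt_neqAle eq_sym s1.
have := h (2 * s)^-1; rewrite invr_gt0 mulr_gt0// => /(_ isT).
have -> : (2 * s)^-1 * s = 2^-1 by field; rewrite gt_eqF.
by rewrite mulrC ler_pdivrMr ?mulr_gt0// mul1r; apply; lra.
Qed.

Section SmoothVectors.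
Variables (R : realType) (W : weyl_data R) (setting : standing_setting W).
Local Notation M := (wM W).
Local Notation mm := (wLie W).
Local Notation H := (wH W).
Local Notation ip := (wIp W).
Local Notation pi := (@wPi R W).
Local Notation expM := (@wExp R W).
Implicit Types (f g v w : H) (k : R[i]) (X : mm) (u : seq (R[i] * seq mm)).

Definition smooth (f : H) : Prop := @ldom R (Hinf W) f.

Lemma setting_ip_norm f : `|f| ^+ 2 = ip f f.
Proof. exact: (ss_hilbert setting). Qed.
Local Notation hN := setting_ip_norm.

Lemma pi_linear m k f g : pi m (k *: f + g) = k *: pi m f + pi m g.
Proof. by case: (ss_unitary setting). Qed.

Lemma pi_ip m f g : ip (pi m f) (pi m g) = ip f g.
Proof. by case: (ss_unitary setting). Qed.

Lemma piM m n f : pi (m * n)%g f = pi m (pi n f).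
Proof. by case: (ss_unitary setting). Qed.

Lemma pi1 f : pi 1%g f = f.
Proof. by case: (ss_unitary setting). Qed.

Lemma pi0 m : pi m 0 = 0.
Proof. by have := pi_linear m (-1) 0 0; rewrite scaler0 addr0 scaleN1r addNr. Qed.

Lemma piZ m k f : pi m (k *: f) = k *: pi m f.
Proof. by have := pi_linear m k f 0; rewrite addr0 pi0 addr0. Qed.

Lemma pi_hnorm m f : hnorm (pi m f) = hnorm f.
Proof.
apply/eqP; rewrite -(@eqrXn2 _ 2)// ?hnorm_ge0//; apply/eqP.
by apply: creal_inj; rewrite -!(ip_self hN) pi_ip.
Qed.

Lemma smooth0 : smooth 0.
Proof.
split => // c n Ac; rewrite (_ : _ \o _ = fun=> (0 : H)); last first.
  by apply/funext => x /=; rewrite pi0.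
exact: Ck_cst.
Qed.

Lemma smoothP k f g : smooth f -> smooth g -> smooth (k *: f + g).
Proof.
move=> [_ sf] [_ sg]; split => // c n Ac.
rewrite (_ : _ \o _ = fun x => k *: (pi (cinv c x) f) + pi (cinv c x) g); last first.
  by apply/funext => x /=; rewrite pi_linear.
by apply: Ck_linear; [exact: sf|exact: sg].
Qed.

Lemma smoothZ k f : smooth f -> smooth (k *: f).
Proof. by move=> sf; rewrite -[k *: f]addr0; apply: smoothP => //; exact: smooth0. Qed.

Lemma smoothD f g : smooth f -> smooth g -> smooth (f + g).
Proof. by move=> sf sg; rewrite -[f]scale1r; exact: smoothP. Qed.

Lemma smoothB f g : smooth f -> smooth g -> smooth (f - g).
Proof. by move=> sf sg; rewrite addrC -scaleN1r; exact: smoothP. Qed.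

Lemma smooth_sum (I : Type) (r : seq I) (F : I -> H) :
  (forall i, smooth (F i)) -> smooth (\sum_(i <- r) F i).
Proof.
move=> sF; elim: r => [|i r IH]; first by rewrite big_nil; exact: smooth0.
by rewrite big_cons; exact: smoothD.
Qed.

Local Notation dr := (@drep R M mm expM (hilbert_lcs H) pi).

Let dquot X v (t : R) : H := creal t^-1 *: (pi (expM (t *: X)) v - v).

Let dlim X v w := dquot X v @ (0 : R)^' `=>` @lnbhs R (hilbert_lcs H) w.

Let pf : ProperFilter ((0 : R)^').
Proof. exact: Proper_dnbhs_numFieldType. Qed.

Lemma drep_lim X v w : dlim X v w -> dr X v = w.
Proof.
move=> hw; rewrite /drep.
case: xgetP => [w' -> [_ hw']|h]; first exact: (cvg_hilbert_unique _ hw' hw).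
by case: (h w (conj I hw)).
Qed.

Lemma drep_nolim X v : ~ (exists w, dlim X v w) -> dr X v = 0.
Proof.
move=> h; rewrite /drep; case: xgetP => [w' _ [_ hw']|//].
by case: h; exists w'; exact: hw'.
Qed.

Lemma dlim_linear X k v1 v2 w1 w2 : dlim X v1 w1 -> dlim X v2 w2 ->
  dlim X (k *: v1 + v2) (k *: w1 + w2).
Proof.
move=> h1 h2; rewrite /dlim (_ : dquot X _ = fun t => k *: dquot X v1 t + dquot X v2 t).
  exact: cvg_hilbert_linear.
apply/funext => t; rewrite /dquot pi_linear opprD addrACA -scalerBr scalerDr.
by rewrite !scalerA [k * _]mulrC.
Qed.

Lemma dlim0 X : dlim X 0 0.
Proof.
apply/cvg_hilbert => e e0; apply: nearW => t.
by rewrite /dquot pi0 subrr scaler0 subrr hnorm0.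
Qed.

Lemma drepZ X k v : dr X (k *: v) = k *: dr X v.
Proof.
have [->|k0] := eqVneq k 0; first by rewrite !scale0r (drep_lim (dlim0 X)).
have [[w hw]|h] := pselect (exists w, dlim X v w).
  have := dlim_linear (k := k) hw (dlim0 X); rewrite !addr0 => /drep_lim ->.
  by rewrite (drep_lim hw).
rewrite (drep_nolim h) scaler0 drep_nolim// => -[w hw].
apply: h; exists (k^-1 *: w).
by have := dlim_linear (k := k^-1) hw (dlim0 X); rewrite !addr0 scalerA mulVf// scale1r.
Qed.

Lemma dpiZ u k f : dpi u (k *: f) = k *: dpi u f.
Proof.
rewrite /dpi /denv scaler_sumr; apply: eq_bigr => -[c s] _ /=.
rewrite scalerA [k * c]mulrC -scalerA; congr (_ *: _).
by elim: s => //= X s ->; rewrite drepZ.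
Qed.

(** Finite sums of the defining seminorms; they are directed, so that a single
    one of them controls a neighbourhood. *)
Definition smooth_sn (us : seq (seq (R[i] * seq mm))) (f : H) : R :=
  \sum_(u <- us) hnorm (dpi u f).

Lemma smooth_sn_ge0 us f : 0 <= smooth_sn us f.
Proof. by apply: sumr_ge0 => u _; exact: hnorm_ge0. Qed.

Lemma smooth_snZ us k f : smooth_sn us (k *: f) = cabs k * smooth_sn us f.
Proof. by rewrite /smooth_sn mulr_sumr; apply: eq_bigr => u _; rewrite dpiZ hnormZ. Qed.

Lemma smooth_sn_cat us vs f : smooth_sn (us ++ vs) f = smooth_sn us f + smooth_sn vs f.
Proof. by rewrite /smooth_sn big_cat. Qed.

Lemma Hinf_nbhsP (x : H) (A : set H) : @lnbhs R (Hinf W) x A <->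
  exists us (e : R), 0 < e /\
    forall y, smooth (y - x) -> smooth_sn us (y - x) < e -> A y.
Proof.
split.
- move=> [n [s [e [e0 h]]]].
  exists [seq (s j).2 | j <- enum 'I_n], e; split => // y sy hy.
  apply: h => // j; apply: le_lt_trans hy.
  rewrite /smooth_sn big_map big_enum /= (bigD1 j)//= lerDl.
  by apply: sumr_ge0 => i _; exact: hnorm_ge0.
- move=> [us [e [e0 h]]].
  exists (size us), (fun j => (tt, nth [::] us j)), (e / (size us).+1%:R).
  split; first by rewrite divr_gt0.
  move=> y sy hy; apply: h => //.
  rewrite /smooth_sn (big_nth [::]) big_mkord.
  apply: (@le_lt_trans _ _ (\sum_(i < size us) e / (size us).+1%:R)).
    by apply: ler_sum => i _; apply: ltW; exact: (hy i).
  rewrite sumr_const card_ord -[X in X < _]mulr_natr -mulrA gtr_pMr//.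
  by rewrite mulrC ltr_pdivrMr// mul1r ltr_nat.
Qed.

Lemma dpi_id f : dpi [:: (1, [::])] f = f.
Proof. by rewrite /dpi /denv big_seq1 /= scale1r. Qed.

Lemma pi_smooth m f : smooth f -> smooth (pi m f).
Proof. by case: (ss_twice_nuclearly_smooth setting) => -[_ _ [h _] _ _] _ _; exact: h. Qed.

Lemma drep_smooth X f : smooth f -> smooth (dr X f).
Proof. by case: (ss_twice_nuclearly_smooth setting) => -[_ _ [_ h] _ _] _ _; exact: h. Qed.

Lemma foldr_drep_smooth s f : smooth f -> smooth (foldr dr f s).
Proof. by move=> sf; elim: s => //= X s IH; exact: drep_smooth. Qed.

Lemma dpi_smooth u f : smooth f -> smooth (dpi u f).
Proof.
by move=> sf; apply: smooth_sum => p; apply: smoothZ; exact: foldr_drep_smooth.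
Qed.

(** The vectors at which the orbit map is differentiable in the direction [X]
    form a subspace. Near a smooth vector outside of it the derivative has the
    value zero, so that by continuity it vanishes on all smooth vectors: it is
    linear either way. *)
Lemma drep_dichotomy X : (forall v, smooth v -> exists w, dlim X v w) \/
  (forall v, smooth v -> dr X v = 0).
Proof.
have [h|/existsNP[v0 /not_implyP[sv0 nv0]]] :=
  pselect (forall v, smooth v -> exists w, dlim X v w); [by left|right].
move=> v sv; have [[w hw]|] := pselect (exists w, dlim X v w); last exact: drep_nolim.
apply: hnorm_eq0; apply/eqP; rewrite eq_le hnorm_ge0 andbT.
apply/ler_addgt0Pr => e e0; rewrite add0r.
have := ss_twice_nuclearly_smooth setting => -[[_ _ _ _ cdr] _ _].
have := cdr X v sv [set y | hnorm (y - dr X v) < e].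
case.
  apply/Hinf_nbhsP; exists [:: [:: (1, [::])]], e; split => // y _.
  by rewrite /smooth_sn big_seq1 dpi_id.
move=> [P Q] /= [nP /Hinf_nbhsP[us [d [d0 hQ]]]] PQ.
pose s := d / (2 * (smooth_sn us v0 + 1)).
have s0 : 0 < s by rewrite divr_gt0// mulr_gt0// ltr_wpDl ?smooth_sn_ge0.
have Qs : Q (creal s *: v0 + v).
  apply: hQ; rewrite addrK; first exact: smoothZ.
  rewrite smooth_snZ cabs_creal ger0_norm ?(ltW s0)// /s.
  have n0 := smooth_sn_ge0 us v0.
  have n1 : 0 < 2 * (smooth_sn us v0 + 1) by rewrite mulr_gt0// ltr_wpDl.
  by rewrite mulrAC ltr_pdivrMr// ltr_pM2l//; lra.
have := PQ (X, creal s *: v0 + v) (conj (nbhs_singleton nP) Qs).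
rewrite /= (@drep_nolim X (creal s *: v0 + v)); first by rewrite sub0r hnormN => /ltW.
move=> [w' hw']; apply: nv0.
have sN : creal s != 0 :> R[i].
  by apply/eqP => /(@creal_inj R s 0) E; rewrite E ltxx in s0.
have h1 := dlim_linear (k := -1) hw hw'.
have h2 := dlim_linear (k := (creal s)^-1) h1 (dlim0 X).
have E : (creal s)^-1 *: (-1 *: v + (creal s *: v0 + v)) + 0 = v0.
  by rewrite addr0 scaleN1r addrCA addNr addr0 scalerA mulVf// scale1r.
by rewrite E in h2; exists ((creal s)^-1 *: (-1 *: w + w') + 0).
Qed.

Lemma drep_linear X k f g : smooth f -> smooth g ->
  dr X (k *: f + g) = k *: dr X f + dr X g.
Proof.
move=> sf sg; case: (drep_dichotomy X) => h.
  have [w1 h1] := h _ sf; have [w2 h2] := h _ sg.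
  by rewrite (drep_lim (dlim_linear (k := k) h1 h2)) (drep_lim h1) (drep_lim h2).
by rewrite !h ?scaler0 ?addr0//; exact: smoothP.
Qed.

Lemma expM0 : expM 0 = 1%g.
Proof.
have [_ hD _] := ss_exponential setting.
have /(congr1 (fun y : M => ((expM 0)^-1 * y)%g)) := hD 0 0 0.
by rewrite addr0 scale0r mulKg mulVg => <-.
Qed.

Lemma expMN X (t : R) : expM (- (t *: X)) = ((expM (t *: X))^-1)%g.
Proof.
have [_ hD _] := ss_exponential setting.
apply: (@mulgI _ (expM (t *: X))); rewrite mulgV -scaleNr -hD subrr scale0r.
exact: expM0.
Qed.

(** The difference quotients of a one-parameter unitary group at [t] and [- t]
    are adjoint to each other up to the sign. *)
Lemma drep_skew X f g : smooth f -> smooth g -> ip (dr X f) g = - ip f (dr X g).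
Proof.
move=> sf sg; case: (drep_dichotomy X) => h; last by rewrite !h// ip0l ip0r oppr0.
have [w1 h1] := h _ sf; have [w2 h2] := h _ sg.
rewrite (drep_lim h1) (drep_lim h2).
apply/eqP; rewrite -subr_eq0 opprK; apply/eqP; apply: cabs_eq0; apply/eqP.
rewrite eq_le cabs_ge0 andbT; apply/ler_addgt0Pr => e e0; rewrite add0r.
have e2 : 0 < e / 2 by rewrite divr_gt0.
have n1 : \forall t \near (0 : R)^', cabs (ip (dquot X f t) g - ip w1 g) < e / 2.
  exact: (cvg_hilbert_ip hN _ g h1 e2).
have n2 : \forall t \near (0 : R)^', cabs (ip (dquot X g (- t)) f - ip w2 f) < e / 2.
  have n2 : nbhs (0 : R) (fun t : R => t != 0 -> cabs (ip (dquot X g t) f - ip w2 f) < e / 2).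
    exact: (cvg_hilbert_ip hN _ f h2 e2).
  suff : nbhs (0 : R) (fun t : R => t != 0 -> cabs (ip (dquot X g (- t)) f - ip w2 f) < e / 2) by [].
  have /nbhs_ballP[d /= d0 hd] := n2.
  apply/nbhs_ballP; exists d => // t; rewrite /= -ball_normE /= sub0r normrN => td tN.
  apply: hd; last by rewrite oppr_eq0.
  by rewrite -ball_normE /= sub0r opprK.
have [t [t1 t2]] := @filter_ex _ _ pf _ (filterI n1 n2).
have E : ip (dquot X f t) g = - ip f (dquot X g (- t)).
  rewrite /dquot ipZl ipZr conj_creal ipBl ipBr invrN -mulNr.
  have -> : - creal (- t^-1) = creal t^-1 :> R[i].
    by rewrite -[- t^-1]sub0r crealB -[creal 0]/(0 : R[i]) sub0r opprK.
  congr (_ * (_ - _)).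
  rewrite scaleNr expMN -(pi_ip (expM (t *: X)) f).
  by rewrite -[in RHS]piM mulgV pi1.
have -> : ip w1 g + ip f w2 = (ip w1 g - ip (dquot X f t) g) +
    ((ip w2 f - ip (dquot X g (- t)) f)^*)%C.
  by rewrite rmorphB /= -!ipC E opprK; ring.
apply: le_trans (cabsD _ _) _; rewrite cabsJ (splitr e).
by rewrite cabsB [X in _ + X]cabsB; apply: lerD; exact: ltW.
Qed.

Lemma foldr_drep_linear s k f g : smooth f -> smooth g ->
  foldr dr (k *: f + g) s = k *: foldr dr f s + foldr dr g s.
Proof.
by move=> sf sg; elim: s => //= X s ->; rewrite drep_linear//; exact: foldr_drep_smooth.
Qed.

Lemma dpi_linear u k f g : smooth f -> smooth g ->
  dpi u (k *: f + g) = k *: dpi u f + dpi u g.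
Proof.
move=> sf sg; rewrite /dpi /denv scaler_sumr -big_split; apply: eq_bigr => p _.
by rewrite foldr_drep_linear// scalerDr !scalerA [_ * k]mulrC.
Qed.

Lemma foldr_drep_adjoint s f g : smooth f -> smooth g ->
  ip (foldr dr f s) g = (-1) ^+ size s * ip f (foldr dr g (rev s)).
Proof.
elim: s g => [|X s IH] g sf sg /=; first by rewrite mul1r.
rewrite drep_skew//; last exact: foldr_drep_smooth.
rewrite IH//; last exact: drep_smooth.
by rewrite rev_cons -cats1 foldr_cat /= exprS mulN1r mulNr.
Qed.

Lemma dpiE u f : dpi u f = \sum_(p <- u) (p.1 *: (foldr dr f p.2 : H) : H).
Proof. by []. Qed.

(** Reverse the words and conjugate the coefficients; each letter contributes
    a sign. *)
Lemma dpi_adjoint u : exists u', forall f g, smooth f -> smooth g ->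
  ip (dpi u f) g = ip f (dpi u' g).
Proof.
exists [seq (((-1) ^+ size p.2 * (p.1^*)%C), rev p.2) | p <- u] => f g sf sg.
rewrite !dpiE big_map ip_suml ip_sumr; apply: eq_bigr => p _.
rewrite ipZl ipZr foldr_drep_adjoint// rmorphM /= conjcK mulrA [p.1 * _]mulrC.
by rewrite rmorphXn rmorphN1.
Qed.

(** Nonnegative homogeneous functions which are small near the origin are
    dominated by the seminorms of the derived representation. *)
Lemma homogeneous_bound (I : Type) (p : I -> H -> R) :
  (forall i k f, smooth f -> p i (k *: f) = cabs k * p i f) ->
  (exists A, @lnbhs R (Hinf W) 0 A /\ forall i f, smooth f -> A f -> p i f <= 1) ->
  exists us (C : R), 0 < C /\ forall i f, smooth f -> p i f <= C * smooth_sn us f.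
Proof.
move=> pZ [A [/Hinf_nbhsP[us [e [e0 hA]]] h]].
exists us, (2 * e^-1); split; first by rewrite mulr_gt0// invr_gt0.
move=> i f sf; rewrite -mulrA; apply: scaling_bound => [|t t0 te].
  by rewrite mulr_ge0 ?invr_ge0 ?(ltW e0)// smooth_sn_ge0.
have := h i (creal t *: f) (smoothZ _ sf).
rewrite pZ// cabs_creal ger0_norm ?(ltW t0)//; apply; apply: hA; rewrite subr0.
  exact: smoothZ.
rewrite smooth_snZ cabs_creal ger0_norm ?(ltW t0)//.
by move: te; rewrite mulrCA ltr_pdivrMl// mulr1.
Qed.

End SmoothVectors.

(** * Schwartz functions and square-integrable functions *)

Definition ccontinuous (R : realType) (T : topologicalType) (F : T -> R[i]) : Prop :=
  forall x (e : R), 0 < e -> \forall y \near x, cabs (F y - F x) < e.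

Section ComplexContinuity.
Variables (R : realType) (T : topologicalType).
Implicit Types F G : T -> R[i].

Lemma ccontinuous_Re F : ccontinuous F -> continuous (fun x => complex.Re (F x)).
Proof.
move=> cF x; apply/cvgrPdist_lt => e e0; apply: filterS (cF x e e0) => y.
apply: le_lt_trans; rewrite distrC; have := Re_le_cabs (F y - F x).
by case: (F y) (F x) => a b [].
Qed.

Lemma ccontinuous_Im F : ccontinuous F -> continuous (fun x => complex.Im (F x)).
Proof.
move=> cF x; apply/cvgrPdist_lt => e e0; apply: filterS (cF x e e0) => y.
apply: le_lt_trans; rewrite distrC; have := Im_le_cabs (F y - F x).
by case: (F y) (F x) => a b [].
Qed.

Lemma ccontinuous_cabs F : ccontinuous F -> continuous (fun x => cabs (F x)).
Proof.
move=> cF x; apply/cvgrPdist_lt => e e0; apply: filterS (cF x e e0) => y.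
apply: le_lt_trans; rewrite ler_norml; apply/andP; split.
  by rewrite lerNl opprB lerBlDr -[X in cabs X <= _](subrK (F x)); exact: cabsD.
rewrite lerBlDr -[X in cabs X <= _](subrK (F y)) cabsB; exact: cabsD.
Qed.

Lemma ccontinuous_ReIm F : continuous (fun x => complex.Re (F x)) ->
  continuous (fun x => complex.Im (F x)) -> ccontinuous F.
Proof.
move=> c1 c2 x e e0; have e2 : 0 < e / 2 by rewrite divr_gt0.
near=> y; apply: le_lt_trans (cabs_le_ReIm _) _; rewrite (splitr e).
have E : forall (z w : R[i]), complex.Re (z - w) = complex.Re z - complex.Re w /\
    complex.Im (z - w) = complex.Im z - complex.Im w by move=> [a b] [].
have [-> ->] := E (F y) (F x); apply: ltrD.
- rewrite distrC; near: y; have /cvgrPdist_lt := c1 x; exact.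
- rewrite distrC; near: y; have /cvgrPdist_lt := c2 x; exact.
Unshelve. all: by end_near.
Qed.

Lemma ccontinuousB F G : ccontinuous F -> ccontinuous G -> ccontinuous (fun x => F x - G x).
Proof.
move=> cF cG x e e0; have e2 : 0 < e / 2 by rewrite divr_gt0.
near=> y.
have -> : F y - G y - (F x - G x) = (F y - F x) - (G y - G x) by ring.
apply: le_lt_trans (cabsD _ _) _; rewrite cabsN (splitr e).
by apply: ltrD; near: y; [exact: cF|exact: cG].
Unshelve. all: by end_near.
Qed.

End ComplexContinuity.

Lemma ccontinuous_cmeasurable (R : realType) (T : ptopologicalType) (F : T -> R[i]) :
  ccontinuous F -> cmeasurable (F : borel T -> R[i]).
Proof.
move=> cF; split; apply: continuous_measurable_borel.
  exact: ccontinuous_Re.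
exact: ccontinuous_Im.
Qed.

Section Schwartz.
Variables (R : realType) (V : normedModType R).
Implicit Types b : V -> R[i].

Lemma schwartz_ccontinuous b : schwartz_fun b -> ccontinuous b.
Proof.
move=> [db _]; apply: ccontinuous_ReIm => x.
  by case: (db [::] x) => /differentiable_continuous.
by case: (db [::] x) => _ /differentiable_continuous.
Qed.

Lemma schwartz_decay b N x : schwartz_fun b ->
  cabs (b x) <= schwartz_sn (N, [::]) b * poly_weight N x.
Proof.
move=> [_ /(_ N [::])[c hc]].
have h : (1 + `|x|) ^+ N * cabs (b x) <= schwartz_sn (N, [::]) b.
  apply: sup_upper_bound; last first.
    by exists x => //; rewrite /schwartz_weight /iterDc /=; case: (b x).
  split; first by exists (schwartz_weight N [::] b x), x.
  by exists c => _ [y _ <-]; exact: hc.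
have -> : cabs (b x) = ((1 + `|x|) ^+ N * cabs (b x)) * poly_weight N x.
  by rewrite mulrAC poly_weightK mul1r.
by apply: ler_wpM2r => //; exact: poly_weight_ge0.
Qed.

Lemma schwartz_fun0 : schwartz_fun (fun _ : V => 0 : R[i]).
Proof.
have it vs : Defs.iterD vs (fun _ : V => 0 : R) = fun=> 0.
  by elim: vs => //= v vs ->; apply/funext => x; exact: derive_cst.
split=> [vs x|N vs]; first by rewrite /= it; split; exact: differentiable_cst.
exists 0 => x; rewrite /schwartz_weight /iterDc /= !it.
by rewrite -[Complex 0 0]/(0 : R[i]) cabs0 mulr0.
Qed.

End Schwartz.

Section SchwartzLinear.
Variables (R : realType) (V : normedModType R).
Implicit Types b c : V -> R[i].

Let smooth_real (g : V -> R) := forall vs x, differentiable (Defs.iterD vs g) x.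

Let iterD_linear (r s : R) (g h : V -> R) : smooth_real g -> smooth_real h ->
  forall vs, Defs.iterD vs (fun x => r * g x + s * h x)
    = (fun x => r * Defs.iterD vs g x + s * Defs.iterD vs h x).
Proof.
move=> sg sh; elim=> [//|v vs IH] /=; rewrite IH; apply/funext => x.
have dg := @diff_derivable R V R (Defs.iterD vs g) x v (sg vs x).
have dh := @diff_derivable R V R (Defs.iterD vs h) x v (sh vs x).
have -> : (fun x0 => r * Defs.iterD vs g x0 + s * Defs.iterD vs h x0) =
   (r \*: (Defs.iterD vs g : V -> R^o)) + (s \*: (Defs.iterD vs h : V -> R^o)) by [].
rewrite deriveD; [|exact: derivableZ|exact: derivableZ].
by rewrite !deriveZ.
Qed.

Let smooth_linear (r s : R) (g h : V -> R) : smooth_real g -> smooth_real h ->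
  smooth_real (fun x => r * g x + s * h x).
Proof.
move=> sg sh vs x; rewrite iterD_linear//.
have -> : (fun x0 => r * Defs.iterD vs g x0 + s * Defs.iterD vs h x0) =
   (r \*: (Defs.iterD vs g : V -> R^o)) + (s \*: (Defs.iterD vs h : V -> R^o)) by [].
by apply: differentiableD; apply: differentiableZ.
Qed.

Lemma schwartz_fun_linear (k : R[i]) b c : schwartz_fun b -> schwartz_fun c ->
  schwartz_fun (k *: b + c).
Proof.
move=> [db hb] [dc hc].
have sRb : smooth_real (fun y => complex.Re (b y)) by move=> vs x; case: (db vs x).
have sIb : smooth_real (fun y => complex.Im (b y)) by move=> vs x; case: (db vs x).
have sRc : smooth_real (fun y => complex.Re (c y)) by move=> vs x; case: (dc vs x).
have sIc : smooth_real (fun y => complex.Im (c y)) by move=> vs x; case: (dc vs x).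
have ReE : (fun y => complex.Re ((k *: b + c) y)) = (fun y =>
    1 * (complex.Re k * complex.Re (b y) + (- complex.Im k) * complex.Im (b y))
    + 1 * complex.Re (c y)).
  apply/funext => y; rewrite !mul1r.
  have -> : (k *: b + c) y = k * b y + c y by [].
  by case: k (b y) (c y) => kr ki [br bi] [cr ci] /=; rewrite mulNr.
have ImE : (fun y => complex.Im ((k *: b + c) y)) = (fun y =>
    1 * (complex.Re k * complex.Im (b y) + complex.Im k * complex.Re (b y))
    + 1 * complex.Im (c y)).
  apply/funext => y; rewrite !mul1r.
  have -> : (k *: b + c) y = k * b y + c y by [].
  by case: (k) (b y) (c y) => kr ki [br bi] [cr ci].
split=> [vs x|N vs].
  rewrite ReE ImE; split; apply: smooth_linear => //; exact: smooth_linear.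
have [B hB] := hb N vs; have [C hC] := hc N vs.
exists (cabs k * B + C) => x; rewrite /schwartz_weight.
have -> : iterDc vs (k *: b + c) x = k * iterDc vs b x + iterDc vs c x.
  rewrite /iterDc ReE ImE !iterD_linear//; [|exact: smooth_linear..].
  by case: (k) => kr ki; rewrite !mul1r mulNr.
have P0 : 0 <= (1 + `|x|) ^+ N by rewrite exprn_ge0// addr_ge0.
apply: le_trans (ler_wpM2l P0 (cabsD _ _)) _.
rewrite mulrDr cabsM mulrCA; apply: lerD; last exact: hC.
by rewrite ler_wpM2l ?cabs_ge0//; exact: hB.
Qed.

End SchwartzLinear.

Section SquareIntegrable.
Variables (R : realType) (V : normedModType R).
Variable mu : {measure set (borel V) -> \bar R}.
Hypothesis hfd : finite_dimensional V.
Hypothesis hleb : is_lebesgue mu.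
Implicit Types f g : V -> R[i].
Local Notation L2 := (@L2 _ (borel V) R mu).
Local Notation L2norm := (@L2norm _ (borel V) R mu).
Local Notation L2dot := (@L2dot _ (borel V) R mu).

Let mu0 := lebesgue_setT_gt0 hleb.

Let mabs f : @cmeasurable _ (borel V) R f ->
  measurable_fun setT ((fun x => (cabs (f x))%:E) : borel V -> \bar R).
Proof. by move=> mf; apply/measurable_EFinP; exact: (@measurable_cabs _ (borel V) R). Qed.

Lemma L2_product_bound f g : L2 f -> L2 g ->
  (\int[mu]_x (cabs (f x) * cabs (g x))%:E <= L2norm f * L2norm g)%E.
Proof.
move=> [mf _] [mg _].
have h : hoelder_exponents (2%:E : \bar R) 2%:E 1.
  apply: (@HoelderFin R _ _ _ 2 2 1) => //.
  by rewrite invr1; lra.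
have := hoelder_Lnorm mu0 h (mabs mf) (mabs mg); rewrite Lnorm1; apply: le_trans.
apply: le_ge0_integral => x; first by rewrite lee_fin mulr_ge0 ?cabs_ge0.
by rewrite gee0_abs -?EFinM// lee_fin mulr_ge0 ?cabs_ge0.
Qed.

Lemma L2_cintegrable f g : L2 f -> L2 g ->
  @cintegrable _ (borel V) R mu (fun x => f x * (g x)^*%C).
Proof.
move=> Lf Lg; have := L2_product_bound Lf Lg.
case: Lf Lg => [mf nf] [mg ng] h.
apply: (@cintegrable_le _ (borel V) R mu _ (fun x => cabs (f x) * cabs (g x))).
- by apply: (@cmeasurableM _ (borel V) R) => //; exact: (@cmeasurable_conj _ (borel V) R).
- by move=> x; rewrite cabsM cabsJ.
- apply: le_lt_trans h _.
  have N f0 : (0 <= L2norm f0)%E by exact: Lnorm_ge0.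
  by rewrite lte_mul_pinfty// ge0_fin_numE.
Qed.

Lemma L2dot_bound f g : L2 f -> L2 g ->
  ((cabs (L2dot f g))%:E <= 2%:E * (L2norm f * L2norm g))%E.
Proof.
move=> Lf Lg; have h := L2_product_bound Lf Lg; have := L2_cintegrable Lf Lg.
move=> /(@cintegrableP _ (borel V) R)[mfg ifg].
apply: le_trans (@cabs_cint_le _ (borel V) R mu _ _ (fun x => lexx _) ifg mfg) _.
apply: lee_wpmul2l => //; apply: le_trans h.
apply: le_ge0_integral => x; first by rewrite lee_fin cabs_ge0.
by rewrite cabsM cabsJ.
Qed.

Lemma L2_linear (k : R[i]) f g : L2 f -> L2 g -> L2 (fun x => k * f x + g x).
Proof.
move=> [mf nf] [mg ng]; split.
  by apply: (@cmeasurableD _ (borel V) R) => //; apply: (@cmeasurableM _ (borel V) R) => //.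
have m1 : measurable_fun setT ((fun x => cabs k * cabs (f x)) : borel V -> R).
  by apply: measurable_funM => //; exact: (@measurable_cabs _ (borel V) R).
have m2 : measurable_fun setT ((fun x => cabs (g x)) : borel V -> R).
  exact: (@measurable_cabs _ (borel V) R).
have := eminkowski mu m1 m2 (p := 2%:E).
rewrite lee_fin => /(_ (ler1n R 2)) h.
apply: (@le_lt_trans _ _ (Lnorm mu 2%:E (EFin \o (fun x => cabs k * cabs (f x) + cabs (g x))))).
  apply: (le_Lnorm mu0) => [|x]; first by rewrite lte_fin.
  rewrite /= lee_fin !ger0_norm ?addr_ge0 ?mulr_ge0 ?cabs_ge0// -cabsM; exact: cabsD.
apply: le_lt_trans h _; rewrite lte_add_pinfty//.
have := LnormZ_ge0 mu0 (p := 2%:E) _ (cabs_ge0 k) (mabs mf).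
rewrite lte_fin => /(_ (ltr0Sn R 1)).
rewrite (_ : (fun x => _) = EFin \o (fun x => cabs k * cabs (f x))); last first.
  by apply/funext => x /=; rewrite EFinM.
move=> ->; rewrite lte_mul_pinfty ?lee_fin ?cabs_ge0//.
Qed.

Lemma L2_sub f g : L2 f -> L2 g -> L2 (fun x => f x - g x).
Proof.
move=> Lf Lg; have := L2_linear (-1) Lg Lf; congr L2.
by apply/funext => x; rewrite mulN1r addrC.
Qed.

Lemma L2dot_linearr (k : R[i]) h f g : L2 h -> L2 f -> L2 g ->
  L2dot h (fun x => k * f x + g x) = (k^*)%C * L2dot h f + L2dot h g.
Proof.
move=> Lh Lf Lg.
rewrite -(@cint_linear _ (borel V) R mu _ _ _ (L2_cintegrable Lh Lf) (L2_cintegrable Lh Lg)).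
by congr cint; apply/funext => x; rewrite rmorphD rmorphM /= mulrDr mulrCA.
Qed.

Lemma L2dot_linearl (k : R[i]) h f g : L2 h -> L2 f -> L2 g ->
  L2dot (fun x => k * f x + g x) h = k * L2dot f h + L2dot g h.
Proof.
move=> Lh Lf Lg.
rewrite -(@cint_linear _ (borel V) R mu _ _ _ (L2_cintegrable Lf Lh) (L2_cintegrable Lg Lh)).
by congr cint; apply/funext => x; rewrite mulrDl mulrA.
Qed.

Lemma L2_zero : L2 (fun=> 0).
Proof.
split; first exact: (@cmeasurable_cst _ (borel V) R).
rewrite /Defs.L2norm (_ : (fun x => _) = cst 0%E) ?Lnorm0//.
by apply/funext => x /=; rewrite cabs0.
Qed.

Lemma L2dot_sum h (I : Type) (r : seq I) (c : I -> R[i]) (A : I -> V -> R[i]) :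
  L2 h -> (forall i, L2 (A i)) -> (forall i, L2dot h (A i) = 0) ->
  L2 (fun x => \sum_(i <- r) c i * A i x) /\ L2dot h (fun x => \sum_(i <- r) c i * A i x) = 0.
Proof.
move=> Lh LA hA; elim: r => [|i r [L0 d0]].
  rewrite (_ : (fun x => _) = fun=> 0); last by apply/funext => x; rewrite big_nil.
  split; first exact: L2_zero.
  rewrite /Defs.L2dot -[RHS](@cint0 _ (borel V) R mu); congr cint.
  by apply/funext => x; rewrite rmorph0 mulr0.
rewrite (_ : (fun x => _) = fun x => c i * A i x + \sum_(j <- r) c j * A j x); last first.
  by apply/funext => x; rewrite big_cons.
split; first exact: L2_linear.
by rewrite L2dot_linearr// hA d0 mulr0 addr0.
Qed.

Lemma L2_of_decay f (w : V -> R) (c : R) : @cmeasurable _ (borel V) R f ->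
  (forall x, cabs (f x) <= c * w x) -> measurable_fun setT (w : borel V -> R) ->
  (forall x, 0 <= w x <= 1) -> (\int[mu]_x (w x)%:E < +oo)%E -> L2 f.
Proof.
move=> mf fw mw w01 iw; split=> //.
have w0 x : 0 <= w x by case/andP: (w01 x).
have c0 x : 0 <= c * w x := le_trans (cabs_ge0 _) (fw x).
rewrite /Defs.L2norm LnormE; apply: poweR_lty.
apply: (@le_lt_trans _ _ (\int[mu]_x ((c ^+ 2)%:E * (w x)%:E))%E).
  apply: le_ge0_integral => x; first exact: poweR_ge0.
  rewrite gee0_abs; last by rewrite lee_fin cabs_ge0.
  rewrite poweR_EFin -EFinM lee_fin.
  rewrite powR_mulrn ?cabs_ge0//.
  apply: (@le_trans _ _ ((c * w x) ^+ 2)).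
    by rewrite ler_pXn2r ?nnegrE ?cabs_ge0.
  rewrite exprMn ler_wpM2l ?sqr_ge0// expr2 ler_piMr//; by case/andP: (w01 x).
rewrite ge0_integralZl ?lee_fin ?sqr_ge0//; last 2 first.
- exact/measurable_EFinP.
- by move=> x _; rewrite lee_fin.
by rewrite lte_mul_pinfty ?lee_fin ?sqr_ge0.
Qed.

(** A continuous square-integrable function orthogonal to a family with dense
    span vanishes. *)
Lemma L2_orthogonal_eq0 f : L2 f -> ccontinuous f ->
  (forall e : R, 0 < e -> exists g, [/\ L2 g, L2dot f g = 0 &
     (L2norm (fun x => f x - g x)%R < e%:E)%E]) -> forall x, f x = 0.
Proof.
move=> Lf cf h.
have N0 : (0 <= L2norm f)%E by exact: Lnorm_ge0.
have Nfin : L2norm f \is a fin_num by rewrite ge0_fin_numE//; case: Lf.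
pose N := fine (L2norm f).
have NE : L2norm f = N%:E by rewrite fineK.
have Nge0 : 0 <= N by rewrite -lee_fin -NE.
have sq : N ^+ 2 <= cabs (L2dot f f).
  have e2 : (\int[mu]_x (cabs (f x) ^+ 2)%:E = (N ^+ 2)%:E)%E.
    have := poweR_Lnorm mu (fun x => (cabs (f x))%:E) (r := 2).
    rewrite -/(L2norm _) NE pnatr_eq0 => /(_ isT) e2.
    rewrite -(powR_mulrn 2 Nge0) -poweR_EFin e2; apply: eq_integral => x _.
    rewrite gee0_abs; last by rewrite lee_fin cabs_ge0.
    by rewrite poweR_EFin powR_mulrn ?cabs_ge0.
  have -> : L2dot f f = creal (N ^+ 2).
    rewrite /Defs.L2dot (_ : (fun x => _) = fun x => creal (cabs (f x) ^+ 2)); last first.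
      by apply/funext => x; rewrite cabs_sqr.
    by rewrite /cint /= /Rintegral e2 integral0.
  by rewrite cabs_creal ger0_norm ?sqr_ge0.
have NZ : N = 0.
  apply/eqP; rewrite eq_le Nge0 andbT leNgt; apply/negP => Npos.
  have [g [Lg fg0 hg]] := h (N / 4) (divr_gt0 Npos (ltr0Sn R 3)).
  have Lfg := L2_sub Lf Lg.
  have E : L2dot f f = L2dot f (fun x => f x - g x).
    have := L2dot_linearr (-1) Lf Lg Lf.
    rewrite fg0 mulr0 add0r => <-; congr L2dot; apply/funext => x.
    by rewrite mulN1r addrC.
  have := L2dot_bound Lf Lfg; rewrite -E NE => b1.
  have b2 : ((cabs (L2dot f f))%:E <= (2 * (N * (N / 4)))%:E)%E.
    apply: le_trans b1 _; rewrite !EFinM lee_pmul2l//= lee_pmul2l ?lte_fin//.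
    by rewrite -EFinM; exact: ltW.
  rewrite lee_fin in b2; have := le_trans sq b2.
  have N2 : 0 < N ^+ 2 by rewrite exprn_gt0.
  rewrite (_ : 2 * (N * (N / 4)) = N ^+ 2 / 2); last by field.
  by lra.
have ae0 : (fun x => (cabs (f x))%:E) = \0 %[ae mu].
  apply: (@Lnorm_eq0_eq0 _ (borel V) R mu _ 2%:E); [exact: mabs (proj1 Lf)|by rewrite lte_fin|].
  by rewrite -/(L2norm _) NE NZ.
move=> x; apply: cabs_eq0; apply/eqP; rewrite eq_le cabs_ge0 andbT -lee_fin.
have := continuous_le_Lnormy hfd hleb (ccontinuous_cabs cf) x.
rewrite ger0_norm ?cabs_ge0// => /le_trans; apply.
apply: (Lnormy_le mu0).
have ae1 : {ae mu, forall y, (cabs (f y))%:E = 0%E}.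
  move: ae0; rewrite /ae_eq => h0.
  by apply: (@filterS _ _ (ae_filter_ringOfSetsType mu) _ _ _ h0) => y; apply.
by apply: (@filterS _ _ (ae_filter_ringOfSetsType mu) _ _ _ ae1) => y ->; rewrite abse0.
Qed.

End SquareIntegrable.

(** * Ambiguity functions and Wigner distributions *)

Section Lcs.
Variable R : realType.

Lemma lcs_filter (E : lcs R) (x : E) : Filter (@lnbhs R E x).
Proof.
split.
- by exists 0%N, (fun i : 'I_0 => match i with Ordinal _ h => False_rect _ (notF h) end), 1; split.
- move=> A B [n [s [e [e0 hA]]]] [m [t [d [d0 hB]]]].
  exists (n + m)%N, (fun j => match fintype.split j with inl i => s i | inr i => t i end), (Num.min e d).
  split; first by rewrite lt_min e0.
  move=> y yx hy; split.
    apply: hA => // j; have := hy (lshift m j); rewrite (unsplitK (inl j)).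
    by rewrite lt_min => /andP[].
  apply: hB => // j; have := hy (rshift n j); rewrite (unsplitK (inr j)).
  by rewrite lt_min => /andP[].
- move=> A B AB [n [s [e [e0 hA]]]]; exists n, s, e; split => // y yx hy.
  by apply: AB; exact: hA.
Qed.

Lemma lnbhs_translate (E : lcs R) (x : E) (A : set E) :
  @lnbhs R E 0 A -> @lnbhs R E x [set y | A (y - x)].
Proof.
move=> [n [s [e [e0 h]]]]; exists n, s, e; split => // y yx hy.
by apply: h; rewrite subr0.
Qed.

Lemma lnbhs0_ldom (E : lcs R) (A : set E) : @lnbhs R E 0 A ->
  @lnbhs R E 0 (A `&` @ldom R E).
Proof.
move=> [n [s [e [e0 h]]]]; exists n, s, e; split => // y; rewrite subr0 => yx hy.
by split=> //; apply: h; rewrite subr0.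
Qed.

End Lcs.

Section WeylOperators.
Variables (R : realType) (W : weyl_data R) (setting : standing_setting W).
Local Notation mm := (wLie W).
Local Notation H := (wH W).
Local Notation ip := (wIp W).
Local Notation pi := (@wPi R W).
Local Notation expM := (@wExp R W).
Local Notation Xi := (wXi W).
Local Notation Xis := (wXis W).
Local Notation dX := (wdX W).
Local Notation theta := (wTheta W).
Local Notation smooth := (@smooth R W).
Implicit Types (f g h phi : H) (k : R[i]).

Let hN : forall f : H, `|f| ^+ 2 = ip f f := setting_ip_norm setting.
Let hfd := ss_finite_dimensional setting.
Let hleb := ss_lebesgue setting.

(** A linear map on a finite-dimensional space is a finite sum of coordinates
    times fixed vectors. *)
Lemma theta_continuous : continuous theta.
Proof.
have [n [b [co [c0 [c00 coK Kco hco]]]]] := bounded_coordinates hfd.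
have coB x y : co (x - y) = co x - co y.
  by rewrite -{1}(coK x) -{1}(coK y) -lin_combB Kco.
have c_co i : continuous (fun x => co x 0 i).
  move=> x; apply/cvgrPdist_lt => e e0.
  apply/nbhs_ballP; exists (e / c0) => /=; first by rewrite divr_gt0.
  move=> y; rewrite -ball_normE /= => hy.
  have -> : co x 0 i - co y 0 i = (co (x - y)) 0 i by rewrite coB !mxE.
  apply: (@le_lt_trans _ _ `|co (x - y)|).
    by rewrite [leRHS]/Num.norm /= mx_normrE; apply/bigmax_geP; right; exists (0, i).
  by apply: le_lt_trans (hco _) _; rewrite mulrC -ltr_pdivlMr.
rewrite (_ : (theta : Xi -> mm) = fun x => \sum_(i <- enum 'I_n) co x 0 i *: theta (b i)).
  apply: sum_continuous => i x.
  apply: (@continuous2_cvg _ _ _ _ _ _ (fun x => co x 0 i : R^o) (fun=> theta (b i))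
    (fun (a : R^o) (v : mm) => a *: v)); [|exact: c_co|exact: cvg_cst].
  exact: (@scale_continuous R mm (co x 0 i, theta (b i))).
apply/funext => x; rewrite -{1}(coK x) /lin_comb linear_sum big_enum /=.
by apply: eq_bigr => i _; rewrite linearZ.
Qed.

Lemma exp_theta_continuous : continuous (fun X : Xi => expM (theta X)).
Proof.
have [[cexp _] _ _] := ss_exponential setting.
move=> X; apply: (@continuous_comp _ _ _ theta expM); [exact: theta_continuous|exact: cexp].
Qed.

Lemma piX_linear (X : Xi) k f g : piX X (k *: f + g) = k *: piX X f + piX X g.
Proof. exact: (pi_linear setting). Qed.

Lemma piX_hnorm (X : Xi) f : hnorm (piX X f) = hnorm f.
Proof. exact: (pi_hnorm setting). Qed.

Lemma piX_smooth (X : Xi) f : smooth f -> smooth (piX X f).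
Proof. exact: (pi_smooth setting). Qed.

Lemma piX_cvg_smooth phi us (X : Xi) (e : R) : smooth phi -> 0 < e ->
  \forall Y \near X, smooth_sn us (piX Y phi - piX X phi) < e.
Proof.
move=> sphi e0.
have [[_ _ _ cpi _] _ _] := ss_twice_nuclearly_smooth setting.
have := cpi (expM (theta X)) phi sphi
  [set y | smooth_sn us (y - piX X phi) < e].
case; first by apply/Hinf_nbhsP; exists us, e; split.
move=> [P Q] /= [nP nQ] PQ.
have : \forall Y \near X, P (expM (theta Y)) by exact: (exp_theta_continuous nP).
apply: filterS => Y PY; apply: (PQ (expM (theta Y), phi)); split => //=.
move/Hinf_nbhsP : nQ => [vs [d [d0]]]; apply; rewrite subrr.
  exact: smooth0.
by rewrite -(scale0r (0 : H)) smooth_snZ// cabs0 mul0r.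
Qed.

Lemma piX_cvg f (X : Xi) (e : R) : 0 < e ->
  \forall Y \near X, hnorm (piX Y f - piX X f) < e.
Proof.
move=> e0; have [_ _ _ _ cpi] := ss_unitary setting.
have e0' : 0 < creal e by rewrite /creal ltcE /= eqxx.
have /cvgrPdist_lt/(_ _ e0') : piX Y f @[Y --> X] --> piX X f.
  apply: (@continuous_comp _ _ _ (fun X : Xi => expM (theta X)) (fun m => pi m f)).
    exact: exp_theta_continuous.
  exact: cpi.
apply: filterS => Y; rewrite distrC normE_hnorm ltcE /= => /andP[_]; exact.
Qed.

Lemma ip_piX_ccontinuous f g : ccontinuous (fun X : Xi => ip (piX X f) g).
Proof.
move=> X e e0; have g1 : 0 < hnorm g + 1 by rewrite ltr_wpDl ?hnorm_ge0.
apply: filterS (piX_cvg f X (divr_gt0 e0 g1)) => Y hY.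
rewrite -(@ipBl R H); apply: le_lt_trans (cauchy_schwarz hN _ _) _.
apply: (@le_lt_trans _ _ (hnorm (piX Y f - piX X f) * (hnorm g + 1))).
  by rewrite ler_wpM2l ?hnorm_ge0// lerDl.
by rewrite -ltr_pdivlMr.
Qed.

Lemma ambiguity_ccontinuous phi f : ccontinuous (ambiguity phi f).
Proof.
move=> X e e0; apply: filterS (ip_piX_ccontinuous phi f X e0) => Y.
by rewrite /ambiguity (ipC ip f (piX Y phi)) (ipC ip f (piX X phi)) -rmorphB cabsJ.
Qed.

Lemma ambiguity_linear phi k f g :
  ambiguity phi (k *: f + g) = (fun X : Xi => k * ambiguity phi f X + ambiguity phi g X).
Proof. by apply/funext => X; rewrite /ambiguity ipPl. Qed.

Lemma ambiguity_antilinear k f g h :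
  ambiguity (k *: f + g) h = (fun X : Xi => (k^*)%C * ambiguity f h X + ambiguity g h X).
Proof. by apply/funext => X; rewrite /ambiguity piX_linear ipPr. Qed.

Lemma ambiguity_L2 phi f : L2 dX (ambiguity phi f).
Proof. by case: (ss_orthogonality setting). Qed.

Lemma ambiguity_dot f1 f2 phi1 phi2 :
  L2dot dX (ambiguity phi1 f1) (ambiguity phi2 f2) = ip f1 f2 * ip phi2 phi1.
Proof. by case: (ss_orthogonality setting). Qed.

Lemma exists_weight : exists N, (\int[dX]_x (poly_weight N x)%:E < +oo)%E.
Proof. exact: (poly_weight_integrable hfd hleb). Qed.

Lemma weight01 N (x : Xi) : 0 <= poly_weight N x <= 1.
Proof. by rewrite poly_weight_ge0 poly_weight_le1. Qed.


(** For a nonzero operator [Op a], the defining weak integral exists at every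
    vector: the vectors at which it does form a subspace on whose complement
    the linear operator [Op a] vanishes. *)
Lemma Op_weak_integral (a : Xis -> R[i]) : @ldom R (SXis W) a ->
  (exists h, Op a h <> 0) ->
  forall h g, ip (Op a h) g = cint dX (fun X : Xi => fourier_inv a X * ip (piX X h) g).
Proof.
move=> da [h1 Oh1].
have [[_ _ surjF] _ _ _] := ss_fourier_schwartz setting.
have [sb _] : @ldom R (SXi W) (fourier_inv a) /\ fourier (fourier_inv a) = a.
  rewrite /fourier_inv; case: xgetP => [b _ []//|hb].
  by have [b sb ba] := surjF a da; case: (hb b).
set b := fourier_inv a in sb.
pose I h g := cint dX (fun X : Xi => b X * ip (piX X h) g).
have [N iN] := exists_weight.
have Iint h g : cintegrable dX (fun X : Xi => b X * ip (piX X h) g).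
  apply: (@cintegrable_le _ (borel Xi) R dX _
    (fun x => (schwartz_sn (N, [::]) b * (hnorm h * hnorm g)) * poly_weight N x)).
  - apply: (@cmeasurableM _ (borel Xi) R); apply: ccontinuous_cmeasurable.
      exact: schwartz_ccontinuous.
    exact: ip_piX_ccontinuous.
  - move=> X; rewrite cabsM [X in _ <= X]mulrAC; apply: ler_pM; rewrite ?cabs_ge0//.
      exact: schwartz_decay.
    by apply: le_trans (cauchy_schwarz hN _ _) _; rewrite piX_hnorm.
  - have s0 : 0 <= schwartz_sn (N, [::]) b.
      have := le_trans (cabs_ge0 _) (schwartz_decay N 0 sb).
      by rewrite pmulr_lge0// poly_weight_gt0.
    under eq_integral do rewrite EFinM.
    rewrite ge0_integralZl ?lee_fin ?mulr_ge0 ?hnorm_ge0//; last 2 first.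
    + by apply/measurable_EFinP; exact: measurable_poly_weight.
    + by move=> x _; rewrite lee_fin poly_weight_ge0.
    by rewrite lte_mul_pinfty ?lee_fin ?mulr_ge0 ?hnorm_ge0.
have IP k f h g : I (k *: f + h) g = k * I f g + I h g.
  rewrite /I -(@cint_linear _ (borel Xi) R dX _ _ _ (Iint f g) (Iint h g)).
  by congr cint; apply/funext => X; rewrite piX_linear ipPl mulrDr mulrCA.
pose rep h := exists y, forall g, ip y g = I h g.
have OpP k f g : Op a (k *: f + g) = k *: Op a f + Op a g.
  have [[sub _ _] _ _ _] := ss_regularity setting.
  by have [[hs _ _] _] := sub a da; exact: hs.
have Oprep h : rep h -> forall g, ip (Op a h) g = I h g.
  move=> [y hy] g; rewrite /Op; case: xgetP => [z _ hz|hz]; first exact: hz.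
  by case: (hz y).
have Opnrep h : ~ rep h -> Op a h = 0.
  move=> nh; rewrite /Op; case: xgetP => [z _ hz|//].
  by case: nh; exists z.
suff all_rep h : rep h by move=> h g; exact: Oprep.
apply: contrapT => nh; apply: Oh1.
have [rh1|] := pselect (rep h1); last exact: Opnrep.
have nrep : ~ rep (h + h1).
  move=> [y hy]; apply: nh; have [y1 hy1] := rh1.
  exists (-1 *: y1 + y) => g; rewrite ipPl hy hy1 -IP.
  by congr I; rewrite scaleN1r addrC addrK.
have := Opnrep _ nrep; have := OpP 1 h h1; rewrite !scale1r => ->.
by rewrite (Opnrep h nh) add0r.
Qed.

Lemma rank1_proj f g : smooth f -> smooth g -> @ldom R (proj_lcs W) (rank1 ip f g).
Proof.
move=> sf sg; exists 1%N, (fun=> f), (fun=> g); split; first by [].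
by apply/funext => h; rewrite big_ord1.
Qed.

Lemma rank1_Binf f g : smooth f -> smooth g -> @ldom R (Binf W) (rank1 ip f g).
Proof.
have [_ _ [sub _ _ _ _]] := ss_twice_nuclearly_smooth setting.
by move=> sf sg; apply: sub; exact: rank1_proj.
Qed.

Lemma SXi_linear k b c : @ldom R (SXi W) b -> @ldom R (SXi W) c ->
  fourier (k *: b + c) = k *: fourier b + fourier c.
Proof. by case: (ss_fourier_schwartz setting) => _ + _ _; apply. Qed.

Lemma SXi0 : @ldom R (SXi W) 0.
Proof. exact: schwartz_fun0. Qed.

Lemma fourier0 : fourier (0 : Xi -> R[i]) = 0.
Proof.
by have := SXi_linear (-1) SXi0 SXi0; rewrite scaler0 addr0 scaleN1r addNr.
Qed.

Lemma SXis0 : @ldom R (SXis W) 0.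
Proof.
rewrite -fourier0; case: (ss_fourier_schwartz setting) => -[sub _ _] _ _ _.
exact: sub SXi0.
Qed.

Lemma Op_linear k (a b : Xis -> R[i]) : @ldom R (SXis W) a -> @ldom R (SXis W) b ->
  Op (k *: a + b) = k *: Op a + Op b.
Proof. by case: (ss_regularity setting) => _ + _ _; apply. Qed.

Lemma Op_zero : Op (0 : Xis -> R[i]) = 0.
Proof.
by have := Op_linear (-1) SXis0 SXis0; rewrite scaler0 addr0 scaleN1r addNr.
Qed.

Lemma Op_inj (a b : Xis -> R[i]) : @ldom R (SXis W) a -> @ldom R (SXis W) b ->
  Op a = Op b -> a = b.
Proof.
have [[_ inj _] _ _ _] := ss_regularity setting.
by move=> da db; apply: inj; rewrite inE.
Qed.

Lemma fourier_inj (a b : Xi -> R[i]) : @ldom R (SXi W) a -> @ldom R (SXi W) b ->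
  fourier a = fourier b -> a = b.
Proof.
have [[_ inj _] _ _ _] := ss_fourier_schwartz setting.
by move=> da db; apply: inj; rewrite inE.
Qed.

(** The ambiguity function of smooth vectors is the Schwartz function whose
    Weyl operator is the rank one operator: the difference is orthogonal to all
    ambiguity functions, and these span a dense subspace. *)
Lemma ambiguity_wigner f phi : smooth f -> smooth phi ->
  [/\ @ldom R (SXi W) (ambiguity phi f), @ldom R (SXis W) (wigner f phi) &
      Op (wigner f phi) = rank1 ip f phi].
Proof.
move=> sf sphi.
have zero : ambiguity phi f = 0 -> rank1 ip f phi = 0 ->
   [/\ @ldom R (SXi W) (ambiguity phi f), @ldom R (SXis W) (wigner f phi) &
      Op (wigner f phi) = rank1 ip f phi].
  move=> a0 r0; rewrite /wigner a0 r0 fourier0 Op_zero; split=> //.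
    exact: SXi0.
  exact: SXis0.
have [f0|fN0] := pselect (f = 0).
  apply: zero; first by apply/funext => X; rewrite /ambiguity f0 ip0l.
  by apply/funext => h; rewrite /rank1 f0 scaler0.
have [p0|pN0] := pselect (phi = 0).
  apply: zero.
    by apply/funext => X; rewrite /ambiguity p0 /piX (pi0 setting) ip0r.
  by apply/funext => h; rewrite /rank1 p0 ip0r scale0r.
have [[_ _ surjO] _ _ _] := ss_regularity setting.
have [a da Oa] := surjO _ (rank1_Binf sf sphi).
have Onz : exists h, Op a h <> 0.
  exists phi; rewrite Oa /rank1 => /eqP; rewrite scaler_eq0 => /orP[|/eqP//].
  rewrite (ip_self hN) => /eqP /(@creal_inj R _ 0) /eqP; rewrite sqrf_eq0 => /eqP.
  by move=> /hnorm_eq0.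
have key := Op_weak_integral da Onz.
have [[_ _ surjF] _ _ _] := ss_fourier_schwartz setting.
have [sb fb] : @ldom R (SXi W) (fourier_inv a) /\ fourier (fourier_inv a) = a.
  rewrite /fourier_inv; case: xgetP => [b _ []//|hb].
  by have [b sb ba] := surjF a da; case: (hb b).
set b := fourier_inv a in sb fb key.
have [N iN] := exists_weight.
have Lb : L2 dX b.
  apply: (L2_of_decay _ (fun x => schwartz_decay N x sb)) => //.
  - by apply: ccontinuous_cmeasurable; exact: schwartz_ccontinuous.
  - exact: measurable_poly_weight.
  - by move=> x; exact: weight01.
have La := ambiguity_L2.
have LD : L2 dX (fun X => b X - ambiguity phi f X) by apply: L2_sub.
have orth h g : L2dot dX (fun X => b X - ambiguity phi f X) (ambiguity h g) = 0.
  have := L2dot_linearl hleb (-1) (La h g) (La phi f) Lb.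
  rewrite ambiguity_dot (_ : L2dot dX b _ = ip h phi * ip f g); last first.
    have := key h g; rewrite Oa /rank1 ipZl => ->.
    by congr cint; apply/funext => X; rewrite /ambiguity -ipC.
  rewrite mulN1r [ip h phi * _]mulrC addNr => E; rewrite -[RHS]E; congr L2dot.
  by apply/funext => X; rewrite mulN1r addrC.
have eqb : b = ambiguity phi f.
  apply/funext => X; apply/eqP; rewrite -subr_eq0; apply/eqP; move: X.
  apply: (L2_orthogonal_eq0 hfd hleb LD).
    apply: ccontinuousB; first exact: schwartz_ccontinuous.
    exact: ambiguity_ccontinuous.
  move=> e e0; have [n [c [ph [g hg]]]] := ss_density setting LD e0.
  have [L0 d0] := L2dot_sum hleb (index_enum 'I_n) c LD (fun i => La (ph i) (g i))
    (fun i => orth (ph i) (g i)).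
  by exists (fun X => \sum_i c i * ambiguity (ph i) (g i) X); split.
have Wa : wigner f phi = a by rewrite /wigner -eqb.
by rewrite Wa -eqb.
Qed.
End WeylOperators.

(** * Bounded forms and estimates along orbits *)

Section WeylEstimates.
Variables (R : realType) (W : weyl_data R) (setting : standing_setting W).
Local Notation H := (wH W).
Local Notation ip := (wIp W).
Local Notation Xi := (wXi W).
Local Notation Xis := (wXis W).
Local Notation dX := (wdX W).
Local Notation smooth := (@smooth R W).
Implicit Types (f g h phi : H) (k : R[i]).


Lemma SXis_linear k (a b : Xis -> R[i]) : @ldom R (SXis W) a -> @ldom R (SXis W) b ->
  @ldom R (SXis W) (k *: a + b).
Proof. by move=> sa sb j; exact: schwartz_fun_linear (sa j) (sb j). Qed.

Lemma fourier_open (A : set (Xi -> R[i])) : @lnbhs R (SXi W) 0 A ->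
  @lnbhs R (SXis W) 0 (@fourier R W @` A).
Proof.
move=> nA; have [_ _ _ op] := ss_fourier_schwartz setting.
by have := op 0 A (SXi0 W) nA; rewrite (fourier0 setting).
Qed.

Lemma Op_open (a : Xis -> R[i]) (A : set (Xis -> R[i])) : @ldom R (SXis W) a ->
  @lnbhs R (SXis W) a A -> @lnbhs R (Binf W) (Op a) (@Op R W @` A).
Proof. by move=> sa nA; have [_ _ _ op] := ss_regularity setting; exact: op. Qed.

Lemma continuous_seminorms_bound (n : nat) (p : 'I_n -> H -> R) :
  (forall i, @continuous_seminorm R (Hinf W) (p i)) ->
  exists us (C : R), 0 < C /\ forall i f, smooth f -> p i f <= C * smooth_sn us f.
Proof.
move=> hp; apply: (homogeneous_bound setting) => [i k f|].
  by have [_ + _ _] := hp i; apply.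
exists [set f | forall i, p i f < 1]; split; last by move=> i f _ /(_ i)/ltW.
apply: (@filter_forall H 'I_n (fun i f => p i f < 1) (@lnbhs R (Hinf W) 0)
  (@lcs_filter R (Hinf W) 0)) => i.
by have [_ _ _] := hp i; apply.
Qed.

(** A rank one operator is one of its own decompositions. *)
Lemma proj_sn_rank1 (p q : H -> R) f g : @continuous_seminorm R (Hinf W) p ->
  @continuous_seminorm R (Hinf W) q -> smooth f -> smooth g ->
  proj_sn p q (rank1 ip f g) <= p f * q g.
Proof.
move=> [p0 _ _ _] [q0 _ _ _] sf sg; apply: ge_inf.
  exists 0 => r [n [f' [g' [sfg _ ->]]]]; apply: sumr_ge0 => i _.
  by have [sf' sg'] := sfg i; rewrite mulr_ge0 ?p0 ?q0.
exists 1%N, (fun=> f), (fun=> g); split; [by []| |by rewrite big_ord1].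
by apply/funext => h; rewrite big_ord1.
Qed.

(** The Wigner distribution depends continuously on a pair of smooth vectors:
    the rank one operators do so in the projective topology, which is the one
    that [Op] transports to the Schwartz space. *)
Lemma wigner_small (A : set (Xis -> R[i])) : @lnbhs R (SXis W) 0 A ->
  exists us (D : R), 0 < D /\ forall f g, smooth f -> smooth g ->
    D * (smooth_sn us f * smooth_sn us g) < 1 -> A (wigner f g).
Proof.
move=> nA.
have [_ _ [_ _ topE _ _]] := ss_twice_nuclearly_smooth setting.
have nB := Op_open (SXis0 setting) (lnbhs0_ldom nA).
rewrite (Op_zero setting) in nB.
have P0 : @ldom R (proj_lcs W) 0.
  have f0 : 'I_0 -> H by case.
  by exists 0%N, f0, f0; split=> [[]//|]; apply/funext => h; rewrite big_ord0.
have : @lnbhs R (proj_lcs W) 0 (@Op R W @` (A `&` @ldom R (SXis W))).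
  by rewrite topE//; apply: (@filterS _ _ (@lcs_filter R (Binf W) 0) _ _ _ nB) => T.
move=> [n [s [e [e0 hB]]]].
have [us [C [C0 hC]]] := continuous_seminorms_bound (fun j => proj2_sig (s j).1).
have [vs [D [D0 hD]]] := continuous_seminorms_bound (fun j => proj2_sig (s j).2).
exists (us ++ vs), (C * D / e); split; first by rewrite !mulr_gt0 ?invr_gt0.
move=> f g sf sg small.
have [_ sW OpW] := ambiguity_wigner setting sf sg.
have [] := hB (rank1 ip f g).
- by rewrite subr0; exact: rank1_proj.
- move=> j; rewrite subr0; apply: le_lt_trans (proj_sn_rank1 _ _ sf sg) _.
    exact: proj2_sig (s j).1.
    exact: proj2_sig (s j).2.
  apply: (@le_lt_trans _ _ ((C * D) * (smooth_sn (us ++ vs) f * smooth_sn (us ++ vs) g))).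
    rewrite mulrACA; apply: ler_pM.
    + by have [+ _ _ _] := proj2_sig (s j).1; apply.
    + by have [+ _ _ _] := proj2_sig (s j).2; apply.
    + apply: le_trans (hC j f sf) _; rewrite ler_pM2l// smooth_sn_cat lerDl.
      exact: smooth_sn_ge0.
    + apply: le_trans (hD j g sg) _; rewrite ler_pM2l// smooth_sn_cat lerDr.
      exact: smooth_sn_ge0.
  by move: small; rewrite mulrAC ltr_pdivrMr// mul1r.
move=> a [Aa sa] Oa; rewrite (_ : wigner f g = a)//.
by apply: (Op_inj setting) => //; rewrite OpW.
Qed.

Lemma wigner_linear phi k f g : smooth phi -> smooth f -> smooth g ->
  wigner (k *: f + g) phi = k *: wigner f phi + wigner g phi.
Proof.
move=> sp sf sg; rewrite /wigner ambiguity_linear.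
rewrite -[RHS](SXi_linear setting) //.
  by have [] := ambiguity_wigner setting sf sp.
by have [] := ambiguity_wigner setting sg sp.
Qed.

Lemma wigner_antilinear phi k f g : smooth phi -> smooth f -> smooth g ->
  wigner phi (k *: f + g) = (k^*)%C *: wigner phi f + wigner phi g.
Proof.
move=> sp sf sg; rewrite /wigner (ambiguity_antilinear setting).
rewrite -[RHS](SXi_linear setting) //.
  by have [] := ambiguity_wigner setting sp sf.
by have [] := ambiguity_wigner setting sp sg.
Qed.

Lemma wignerZ phi k f : smooth phi -> smooth f ->
  wigner (k *: f) phi = k *: wigner f phi.
Proof.
move=> sp sf; have := wigner_linear k sp sf (smooth0 setting); rewrite addr0 => ->.
rewrite (_ : wigner 0 phi = 0) ?addr0//.
rewrite /wigner (_ : ambiguity phi 0 = 0) ?(fourier0 setting)//.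
by apply/funext => X; rewrite /ambiguity ip0l.
Qed.

(** [w f g] is linear in [f] and antilinear in [g] on smooth vectors, and
    jointly continuous: the form of a continuous map from the smooth vectors to
    their antidual. *)
Definition bounded_form (w : H -> H -> R[i]) : Prop :=
  [/\ forall k f1 f2 g, smooth f1 -> smooth f2 -> smooth g ->
        w (k *: f1 + f2) g = k * w f1 g + w f2 g,
      forall k f g1 g2, smooth f -> smooth g1 -> smooth g2 ->
        w f (k *: g1 + g2) = (k^*)%C * w f g1 + w f g2 &
      exists us (C : R), 0 < C /\ forall f g, smooth f -> smooth g ->
        cabs (w f g) <= C * (smooth_sn us f * smooth_sn us g)].

Lemma tempered0 (a : (Xis -> R[i]) -> R[i]) : @ldom R (tempered W) a -> a 0 = 0.
Proof.
move=> [aP _ _]; have := aP (-1) 0 0 (SXis0 setting) (SXis0 setting).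
by rewrite scaler0 addr0 rmorphN1 mulN1r addNr.
Qed.

Lemma OpdE (a : (Xis -> R[i]) -> R[i]) f g : smooth f -> smooth g ->
  Opd a f g = a (wigner g f).
Proof. by move=> sf sg; rewrite /Opd asboolT. Qed.

Lemma Opd_bounded_form (a : (Xis -> R[i]) -> R[i]) : @ldom R (tempered W) a ->
  bounded_form (Opd a).
Proof.
move=> ta; have a0 := tempered0 ta; have [aP _ ac] := ta.
have sW f g : smooth f -> smooth g -> @ldom R (SXis W) (wigner f g).
  by move=> sf sg; have [] := ambiguity_wigner setting sf sg.
split.
- move=> k f1 f2 g s1 s2 sg; rewrite !OpdE//; last exact: smoothP.
  by rewrite wigner_antilinear// aP ?conjcK//; exact: sW.
- move=> k f g1 g2 sf s1 s2; rewrite !OpdE//; last exact: smoothP.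
  by rewrite wigner_linear// aP//; exact: sW.
- have : @lnbhs R (SXis W) 0 [set b | cabs (a b) < 1].
    apply: (ac 0 (SXis0 setting) [set z | cabs z < 1]); rewrite a0.
    by exists 1%N, (fun=> tt), 1; split=> // y _ /(_ ord0); rewrite subr0.
  move=> /wigner_small[us [D [D0 h]]]; exists us, (2 * D); split; first by rewrite mulr_gt0.
  move=> f g sf sg; rewrite OpdE// -mulrA; apply: scaling_bound => [|t t0 ts].
    by rewrite mulr_ge0 ?(ltW D0)// mulr_ge0 ?smooth_sn_ge0.
  have := h (creal t *: g) f (smoothZ setting _ sg) sf.
  rewrite wignerZ// (smooth_snZ setting) cabs_creal (ger0_norm (ltW t0)).
  rewrite (_ : D * _ = t * (D * (smooth_sn us f * smooth_sn us g))); last by ring.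
  move=> /(_ ts) /=; have := aP (creal t) (wigner g f) 0 (sW _ _ sg sf) (SXis0 setting).
  by rewrite addr0 a0 addr0 conj_creal => ->; rewrite cabsM cabs_creal (ger0_norm (ltW t0)) => /ltW.
Qed.

(** The ambiguity function is the inverse Fourier transform of the Wigner
    distribution, so that it depends continuously on the pair of vectors as a
    Schwartz function. *)
Lemma ambiguity_decay N : exists us (C : R), 0 < C /\
  forall f phi, smooth f -> smooth phi -> forall X : Xi,
    cabs (ambiguity phi f X) <= C * (smooth_sn us f * smooth_sn us phi) * poly_weight N X.
Proof.
have : @lnbhs R (SXis W) 0 (@fourier R W @`
    ([set b | @schwartz_sn R Xi (N, [::]) b < 1] `&` @ldom R (SXi W))).
  apply: fourier_open; apply: lnbhs0_ldom.
  by exists 1%N, (fun=> (N, [::])), 1; split=> // y _ /(_ ord0); rewrite subr0.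
move=> /wigner_small[us [D [D0 h]]]; exists us, (2 * D); split; first by rewrite mulr_gt0.
move=> f phi sf sp X.
have W0 := @poly_weight_gt0 R Xi N X.
rewrite -ler_pdivrMr// -mulrA; apply: scaling_bound => [|t t0 ts].
  by rewrite mulr_ge0 ?(ltW D0)// mulr_ge0 ?smooth_sn_ge0.
have := h (creal t *: f) phi (smoothZ setting _ sf) sp.
rewrite (smooth_snZ setting) cabs_creal (ger0_norm (ltW t0)).
rewrite (_ : D * _ = t * (D * (smooth_sn us f * smooth_sn us phi))); last by ring.
move=> /(_ ts) [b [/= bN sb] wb].
have [sA _ _] := ambiguity_wigner setting (smoothZ setting (creal t) sf) sp.
have bE : b = ambiguity phi (creal t *: f) by apply: (fourier_inj setting).
have := schwartz_decay N X sb.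
rewrite {1}bE /ambiguity ipZl cabsM cabs_creal (ger0_norm (ltW t0)) => H1.
rewrite mulrA ler_pdivrMr// mul1r; apply: le_trans H1 _.
by apply: ler_piMl; [exact: ltW|exact: ltW].
Qed.

Lemma piX_growth us phi : smooth phi -> exists (C : R) N, 0 < C /\
  forall X : Xi, smooth_sn us (piX X phi) <= C * (1 + `|X|) ^+ N.
Proof.
move=> sp; elim: us => [|u us [C [N [C0 h]]]].
  by exists 1, 0%N; split=> // X; rewrite /smooth_sn big_nil mulr1.
have [c [N' hc]] := ss_growth setting u sp.
exists (`|c| + C), (N' + N)%N; split; first by rewrite ltr_wpDl.
move=> X; rewrite /smooth_sn big_cons mulrDl; apply: lerD.
  apply: le_trans (hc X) _; apply: (@le_trans _ _ (`|c| * (1 + `|X|) ^+ N')).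
    by rewrite ler_wpM2r ?exprn_ge0 ?addr_ge0// ler_norm.
  by rewrite ler_wpM2l// ler_weXn2l ?poly_weight_base_ge1// leq_addr.
apply: le_trans (h X) _.
by rewrite ler_wpM2l ?(ltW C0)// ler_weXn2l ?poly_weight_base_ge1// leq_addl.
Qed.

Lemma bounded_form_ccontinuous (T : topologicalType) (w : H -> H -> R[i]) (F G : T -> H) :
  bounded_form w -> (forall x, smooth (F x)) -> (forall x, smooth (G x)) ->
  (forall us x (e : R), 0 < e -> \forall y \near x, smooth_sn us (F y - F x) < e) ->
  (forall us x (e : R), 0 < e -> \forall y \near x, smooth_sn us (G y - G x) < e) ->
  ccontinuous (fun x => w (F x) (G x)).
Proof.
move=> [wl wr [us [C [C0 hw]]]] sF sG cF cG x e e0.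
pose m := smooth_sn us (F x) + smooth_sn us (G x) + 1.
have m1 : 1 <= m by rewrite /m lerDr addr_ge0 ?smooth_sn_ge0.
have m0 : 0 < m := lt_le_trans ltr01 m1.
pose d := Num.min 1 (e / (3 * C * m)).
have K0 : 0 < 3 * C * m by rewrite !mulr_gt0.
have d0 : 0 < d by rewrite lt_min ltr01 divr_gt0.
apply: filterS2 (cF us x d d0) (cG us x d d0) => y hF hG.
have sdF : smooth (F y - F x) by exact: smoothB.
have sdG : smooth (G y - G x) by exact: smoothB.
have -> : w (F y) (G y) - w (F x) (G x) =
    w (F y - F x) (G y - G x) + w (F y - F x) (G x) + w (F x) (G y - G x).
  have wF g : smooth g -> w (F y - F x) g = w (F y) g - w (F x) g.
    by move=> sg; rewrite [F y - F x]addrC -scaleN1r wl// mulN1r addrC.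
  have wG f : smooth f -> w f (G y - G x) = w f (G y) - w f (G x).
    by move=> sf; rewrite [G y - G x]addrC -scaleN1r wr// rmorphN1 mulN1r addrC.
  rewrite (wF _ sdG) (wF _ (sG x)) !wG//; ring.
have a0 := smooth_sn_ge0 us (F y - F x); have b0 := smooth_sn_ge0 us (G y - G x).
have c0 := smooth_sn_ge0 us (F x); have g0 := smooth_sn_ge0 us (G x).
have d1 : d <= 1 by rewrite ge_min lexx.
have dK : d * (3 * C * m) <= e by rewrite -ler_pdivlMr// ge_min lexx orbT.
have bnd (u v : R) : 0 <= u -> 0 <= v -> u <= d -> v <= m -> C * (u * v) <= d * (C * m).
  by move=> u0 v0 ud vm; rewrite mulrCA ler_pM ?mulr_ge0 ?(ltW C0)// ler_pM2l.
have h1 := le_trans (hw _ _ sdF sdG) (bnd _ _ a0 b0 (ltW hF) (le_trans (ltW hG) (le_trans d1 m1))).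
have h2 : cabs (w (F y - F x) (G x)) <= d * (C * m).
  apply: le_trans (hw _ _ sdF (sG x)) (bnd _ _ a0 g0 (ltW hF) _).
  by rewrite /m -addrA addrCA lerDl addr_ge0.
have h3 : cabs (w (F x) (G y - G x)) < d * (C * m).
  apply: le_lt_trans (hw _ _ (sF x) sdG) _.
  rewrite [smooth_sn us (F x) * _]mulrC mulrCA; apply: (@le_lt_trans _ _ (smooth_sn us (G y - G x) * (C * m))).
    by rewrite ler_wpM2l// ler_pM2l// /m -addrA lerDl addr_ge0.
  by rewrite ltr_pM2r// mulr_gt0.
apply: le_lt_trans (cabsD _ _) _.
apply: le_lt_trans (lerD (cabsD _ _) (lexx _)) _.
apply: lt_le_trans dK.
rewrite (_ : d * (3 * C * m) = d * (C * m) + d * (C * m) + d * (C * m)); last by ring.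
by apply: ler_ltD => //; apply: lerD.
Qed.

Lemma weight_dominated (F : Xi -> R[i]) (c : R) N : cmeasurable (F : borel Xi -> R[i]) ->
  (forall X, cabs (F X) <= c * poly_weight N X) ->
  (\int[dX]_x (poly_weight N x)%:E < +oo)%E ->
  cintegrable dX F /\
  cabs (cint dX F) <= 2 * (c * fine (\int[dX]_x (poly_weight N x)%:E)%E).
Proof.
move=> mF hF iN.
have c0 : 0 <= c.
  have := le_trans (cabs_ge0 _) (hF 0); rewrite pmulr_lge0//; exact: poly_weight_gt0.
have I0 : (0 <= \int[dX]_x (poly_weight N x)%:E)%E.
  by apply: integral_ge0 => x _; rewrite lee_fin poly_weight_ge0.
have fI : (\int[dX]_x (poly_weight N x)%:E)%E \is a fin_num by rewrite ge0_fin_numE.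
have IE : (\int[dX]_x (c * poly_weight N x)%:E = (c * fine (\int[dX]_x (poly_weight N x)%:E))%:E)%E.
  rewrite EFinM fineK//; under eq_integral do rewrite EFinM.
  rewrite ge0_integralZl ?lee_fin//.
  - by apply/measurable_EFinP; exact: measurable_poly_weight.
  - by move=> x _; rewrite lee_fin poly_weight_ge0.
split.
  by apply: (@cintegrable_le _ (borel Xi) R dX _ _ mF hF); rewrite IE ltry.
have := @cabs_cint_le _ (borel Xi) R dX _ _ hF.
by rewrite IE ltry => /(_ isT mF); rewrite -EFinM lee_fin.
Qed.

End WeylEstimates.

(** * The reproducing formula *)

Section Reproducing.
Variables (R : realType) (W : weyl_data R) (setting : standing_setting W).
Local Notation H := (wH W).
Local Notation ip := (wIp W).
Local Notation Xi := (wXi W).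
Local Notation dX := (wdX W).
Local Notation smooth := (@smooth R W).
Implicit Types (f g h phi : H) (k : R[i]).

Let hN : forall f : H, `|f| ^+ 2 = ip f f := setting_ip_norm setting.
Let hleb := ss_lebesgue setting.

(** The rapid decay of the ambiguity function absorbs the polynomial growth of
    the seminorms along the orbit. *)
Lemma ambiguity_growth N us phi : smooth phi -> exists vs (C : R), 0 < C /\
  forall f, smooth f -> forall X : Xi,
    cabs (ambiguity phi f X) * smooth_sn us (piX X phi) <=
      C * smooth_sn vs f * poly_weight N X.
Proof.
move=> sp; have [C1 [N1 [C10 h1]]] := piX_growth setting us sp.
have [vs [C2 [C20 h2]]] := ambiguity_decay setting (N + N1).
exists vs, (C2 * (smooth_sn vs phi + 1) * C1).
have s0 : 0 < smooth_sn vs phi + 1 by rewrite ltr_wpDl ?smooth_sn_ge0.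
split=> [|f sf X]; first by rewrite !mulr_gt0.
apply: le_trans (ler_pM (cabs_ge0 _) (smooth_sn_ge0 _ _) (h2 f phi sf sp X) (h1 X)) _.
rewrite poly_weightD.
rewrite (_ : C2 * (smooth_sn vs f * smooth_sn vs phi) * (poly_weight N X * poly_weight N1 X)
    * (C1 * (1 + `|X|) ^+ N1) = (C2 * C1 * smooth_sn vs f * poly_weight N X) *
    smooth_sn vs phi * ((1 + `|X|) ^+ N1 * poly_weight N1 X)); last by ring.
rewrite poly_weightK mulr1.
rewrite (_ : C2 * _ * C1 * _ * _ = (C2 * C1 * smooth_sn vs f * poly_weight N X) *
    (smooth_sn vs phi + 1)); last by ring.
apply: ler_wpM2l; last by rewrite lerDl.
by rewrite !mulr_ge0 ?poly_weight_ge0 ?smooth_sn_ge0// ltW.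
Qed.

Lemma bounded_functional_ccontinuous (T : topologicalType) (l : H -> R[i]) us (C : R)
    (F : T -> H) :
  (forall k f g, smooth f -> smooth g -> l (k *: f + g) = k * l f + l g) ->
  (forall f, smooth f -> cabs (l f) <= C * smooth_sn us f) ->
  (forall x, smooth (F x)) ->
  (forall x (e : R), 0 < e -> \forall y \near x, smooth_sn us (F y - F x) < e) ->
  ccontinuous (fun x => l (F x)).
Proof.
move=> lL lC sF cF x e e0; have C1 : 0 < `|C| + 1 by rewrite ltr_wpDl.
apply: filterS (cF x _ (divr_gt0 e0 C1)) => y hy.
rewrite (_ : l (F y) - l (F x) = l (F y - F x)); last first.
  by rewrite [F y - F x]addrC -(scaleN1r (F x)) lL// mulN1r addrC.
apply: le_lt_trans (lC _ _) _; first exact: smoothB.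
apply: (@le_lt_trans _ _ ((`|C| + 1) * smooth_sn us (F y - F x))).
  by rewrite ler_wpM2r ?smooth_sn_ge0// (le_trans (ler_norm C))// lerDl.
by rewrite mulrC -ltr_pdivlMr.
Qed.

Let Q us f h := \sum_(u <- us) ip (@dpi R W u f) (dpi u h).
Let q us f := \sum_(u <- us) hnorm (@dpi R W u f) ^+ 2.

Let Q_adjoint us h : smooth h -> exists2 h', smooth h' &
  forall f, smooth f -> Q us f h = ip f h'.
Proof.
move=> sh; elim: us => [|u us [h' sh' IH]].
  exists 0; first exact: smooth0.
  by move=> f sf; rewrite /Q big_nil ip0r.
have [u' hu'] := dpi_adjoint setting u.
exists (dpi u' (dpi u h) + h').
  by apply: smoothD => //; apply: dpi_smooth => //; exact: dpi_smooth.
move=> f sf; rewrite /Q big_cons -/(Q us f h) IH// ipDr hu'//.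
exact: dpi_smooth.
Qed.

Let q_ge0 us f : 0 <= q us f.
Proof. by apply: sumr_ge0 => u _; rewrite sqr_ge0. Qed.

Let sn_le_q us f : smooth_sn us f <= (size us)%:R * Num.sqrt (q us f).
Proof.
have : forall vs r, q vs f <= r -> smooth_sn vs f <= (size vs)%:R * Num.sqrt r.
  elim=> [|u vs IH] r; first by rewrite /smooth_sn big_nil mul0r.
  rewrite /q /smooth_sn !big_cons => hr.
  have a0 := sqr_ge0 (hnorm (@dpi R W u f)); have b0 := q_ge0 vs f.
  rewrite -[size (u :: vs)]/((size vs).+1) -nat1r mulrDl mul1r; apply: lerD.
    rewrite -(ger0_norm (hnorm_ge0 (dpi u f))) -sqrtr_sqr ler_sqrt; last first.
      by apply: le_trans hr; rewrite addr_ge0.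
    by apply: le_trans hr; rewrite lerDl.
  by apply: IH; apply: le_trans hr; rewrite lerDr.
by apply.
Qed.

Let q_le_sn us f : Num.sqrt (q us f) <= smooth_sn us f.
Proof.
rewrite -(ger0_norm (smooth_sn_ge0 us f)) -sqrtr_sqr ler_sqrt ?sqr_ge0//.
elim: us => [|u vs IH]; first by rewrite /q /smooth_sn !big_nil expr0n.
rewrite /q /smooth_sn !big_cons -/(q vs f) -/(smooth_sn vs f).
have a0 := hnorm_ge0 (@dpi R W u f); have b0 := smooth_sn_ge0 vs f.
apply: le_trans (lerD (lexx _) IH) _.
rewrite sqrrD addrAC lerDl mulrn_wge0// mulr_ge0//.
Qed.

(** For a functional given by an inner product this is the orthogonality
    relation; up to a small error in one of the seminorms defining the topology
    of the smooth vectors, every continuous functional is of this form. *)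
Lemma reproducing phi (l : H -> R[i]) us (C : R) f0 : smooth phi ->
  (forall k f g, smooth f -> smooth g -> l (k *: f + g) = k * l f + l g) ->
  (forall f, smooth f -> cabs (l f) <= C * smooth_sn us f) -> smooth f0 ->
  cintegrable dX (fun X : Xi => ip f0 (piX X phi) * l (piX X phi)) /\
  creal (hnorm phi ^+ 2) * l f0 =
    cint dX (fun X : Xi => ip f0 (piX X phi) * l (piX X phi)).
Proof.
move=> sp lL lC sf0.
have {C lC} [C [C0 lC0]] : exists C', 0 <= C' /\ forall f, smooth f -> cabs (l f) <= C' * smooth_sn us f.
  exists `|C|; split=> // f sf; apply: le_trans (lC f sf) _.
  by rewrite ler_wpM2r ?smooth_sn_ge0// ler_norm.
have [N iN] := exists_weight setting.
have [vs [A [A0 hA]]] := ambiguity_growth N us sp.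
have sX X := piX_smooth setting X sp.
have ml : @cmeasurable _ (borel Xi) R (fun X => l (piX X phi)).
  apply: ccontinuous_cmeasurable; apply: (bounded_functional_ccontinuous lL lC0) => //.
  by move=> X e e0; exact: piX_cvg_smooth.
have ma : @cmeasurable _ (borel Xi) R (ambiguity phi f0).
  by apply: ccontinuous_cmeasurable; exact: ambiguity_ccontinuous.
pose B := A * smooth_sn vs f0.
have bnd (r : R) (F : Xi -> R[i]) : 0 <= r ->
    (forall X, cabs (F X) <= r * smooth_sn us (piX X phi)) ->
    forall X, cabs (ambiguity phi f0 X * F X) <= (r * B) * poly_weight N X.
  move=> r0 hF X; rewrite cabsM.
  apply: le_trans (ler_wpM2l (cabs_ge0 _) (hF X)) _.
  by rewrite mulrCA -mulrA ler_wpM2l//; exact: hA.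
have m1 : @cmeasurable _ (borel Xi) R (fun X => ambiguity phi f0 X * l (piX X phi)).
  exact: (@cmeasurableM _ (borel Xi) R).
have [i1 _] := weight_dominated m1 (bnd C _ C0 (fun X => lC0 _ (sX X))) iN.
split; first exact: i1.
have B0 : 0 <= B by rewrite mulr_ge0 ?smooth_sn_ge0// ltW.
pose I0 := fine (\int[dX]_x (poly_weight N x)%:E)%E.
have I00 : 0 <= I0.
  by apply: fine_ge0; apply: integral_ge0 => x _; rewrite lee_fin poly_weight_ge0.
pose K := hnorm phi ^+ 2 * Num.sqrt (q us f0) + 2 * (B * I0).
have K0 : 0 <= K.
  apply: addr_ge0; apply: mulr_ge0 => //; first exact: sqr_ge0.
  exact: mulr_ge0.
apply: subr0_eq; apply: cabs_eq0; apply/eqP.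
rewrite eq_le cabs_ge0 andbT; apply/ler_addgt0Pl => e e0; rewrite ?addr0.
have K1 : 0 < K + 1 by rewrite ltr_wpDl.
have d0 : 0 < e / (K + 1) by rewrite divr_gt0.
have Q1 k f g h : smooth f -> smooth g -> smooth h ->
    Q us (k *: f + g) h = k * Q us f h + Q us g h.
  move=> sf sg sh; rewrite /Q mulr_sumr -big_split; apply: eq_bigr => u _ /=.
  by rewrite (dpi_linear setting)// ipPl.
have Q2 f g : smooth f -> smooth g -> Q us f g = ((Q us g f)^*)%C.
  by move=> sf sg; rewrite /Q rmorph_sum; apply: eq_bigr => u _; exact: (ipC ip).
have Q3 f : smooth f -> Q us f f = creal (q us f).
  move=> sf; rewrite /Q /q /creal -[RHS]/(real_complex R _) rmorph_sum.
  by apply: eq_bigr => u _; rewrite (ip_self hN).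
have lQ f : smooth f -> cabs (l f) <= (C * (size us)%:R) * Num.sqrt (q us f).
  by move=> sf; apply: le_trans (lC0 f sf) _; rewrite -mulrA ler_wpM2l//; exact: sn_le_q.
have [h sh hh] := approximate_riesz (smooth0 setting) (smoothP setting) Q1 Q2 Q3
  (fun f _ => q_ge0 us f) lL lQ d0.
have [h' sh' hh'] := Q_adjoint us sh.
have La := ambiguity_L2 setting.
have dotE := ambiguity_dot setting f0 h' phi phi.
have i2 := L2_cintegrable hleb (La phi f0) (La phi h').
have QX X : ((ambiguity phi h' X)^*)%C = Q us (piX X phi) h.
  by rewrite hh'// /ambiguity -ipC.
have E2 : cint dX (fun X => ambiguity phi f0 X * l (piX X phi)) -
    creal (hnorm phi ^+ 2) * Q us f0 h =
    cint dX (fun X => ambiguity phi f0 X * (l (piX X phi) - Q us (piX X phi) h)).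
  rewrite hh'// mulrC -(ip_self hN) -dotE /L2dot.
  rewrite -(@cintB _ (borel Xi) R dX _ _ i1 i2); congr cint; apply/funext => X.
  by rewrite QX mulrBr.
set d := e / (K + 1) in d0 hh.
have m3 : @cmeasurable _ (borel Xi) R
    (fun X => ambiguity phi f0 X * (l (piX X phi) - Q us (piX X phi) h)).
  have [[m2 _] _] := (@cintegrableP _ (borel Xi) R _ _).1 (@cintegrableB _ (borel Xi) R dX _ _ i1 i2).
  have /(@cintegrableP _ (borel Xi) R)[+ _] := @cintegrableB _ (borel Xi) R dX _ _ i1 i2.
  by congr cmeasurable; apply/funext => X; rewrite QX mulrBr.
have [_ b3] := weight_dominated m3 (bnd d _ (ltW d0)
  (fun X => le_trans (hh _ (sX X)) (ler_wpM2l (ltW d0) (q_le_sn us _)))) iN.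
rewrite -/I0 -E2 in b3.
have -> : creal (hnorm phi ^+ 2) * l f0 -
    cint dX (fun X => ambiguity phi f0 X * l (piX X phi)) =
    creal (hnorm phi ^+ 2) * (l f0 - Q us f0 h) -
    (cint dX (fun X => ambiguity phi f0 X * l (piX X phi)) - creal (hnorm phi ^+ 2) * Q us f0 h).
  by ring.
apply: le_trans (cabsD _ _) _; rewrite cabsN.
apply: le_trans (lerD (lexx _) b3) _.
rewrite cabsM cabs_creal ger0_norm ?sqr_ge0//.
apply: le_trans (lerD (ler_wpM2l (sqr_ge0 _) (hh f0 sf0)) (lexx _)) _.
rewrite (_ : _ + _ = d * K); last by rewrite /K; ring.
by rewrite /d mulrAC ler_pdivrMr// ler_wpM2l ?(ltW e0)// lerDl.
Qed.

End Reproducing.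

(** * Functionals and extensions to the antidual *)

Lemma sup_le_nonneg (R : realType) (A : set R) (c : R) : 0 <= c ->
  (forall x, A x -> x <= c) -> sup A <= c.
Proof.
move=> c0 Ac; have [->|/set0P A0] := eqVneq A set0; first by rewrite sup0.
exact: ge_sup.
Qed.

Section Functionals.
Variable R : realType.
Implicit Types E : lcs R.

Lemma scalar_nbhsP (z : R[i]) (A : set R[i]) : @lnbhs R (scalar_lcs R) z A <->
  exists2 e : R, 0 < e & forall y, cabs (y - z) < e -> A y.
Proof.
split=> [[n [s [e [e0 h]]]]|[e e0 h]].
  by exists e => // y hy; apply: h.
by exists 1%N, (fun=> tt), e; split=> // y _ /(_ ord0); exact: h.
Qed.

Lemma antilinear_continuous E (l : E -> R[i]) :
  (forall k x y, ldom x -> ldom y -> l (k *: x + y) = (k^*)%C * l x + l y) ->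
  (forall e : R, 0 < e -> @lnbhs R E 0 [set x | cabs (l x) < e]) ->
  @lcontinuous R E (scalar_lcs R) l.
Proof.
move=> lP lc x dx A /scalar_nbhsP[e e0 hA].
have := lnbhs_translate x (lnbhs0_ldom (lc e e0)).
apply: (@filterS _ _ (@lcs_filter R E x)) => y [/= ye dyx]; apply: hA.
have := lP 1 (y - x) x dyx dx.
by rewrite scale1r subrK rmorph1 mul1r => ->; rewrite addrK.
Qed.

Lemma antidual_linear E (k : R[i]) (l l' : E -> R[i]) :
  @ldom R (antidual E) l -> @ldom R (antidual E) l' -> @ldom R (antidual E) (k *: l + l').
Proof.
move=> [lP l0 lc] [lP' l0' lc'].
have E1 x : (k *: l + l') x = k * l x + l' x by [].
split=> [c x y dx dy|x dx|x dx A /scalar_nbhsP[e e0 hA]].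
- by rewrite !E1 lP// lP'//; ring.
- by rewrite E1 l0// l0'// mulr0 addr0.
have d0 : 0 < e / (2 * (cabs k + 1)).
  by rewrite divr_gt0// mulr_gt0// ltr_wpDl// cabs_ge0.
have e2 : 0 < e / 2 by rewrite divr_gt0.
have h1 : @lnbhs R E x [set y | cabs (l y - l x) < e / (2 * (cabs k + 1))].
  apply: (lc x dx [set z | cabs (z - l x) < e / (2 * (cabs k + 1))]).
  by apply/scalar_nbhsP; exists (e / (2 * (cabs k + 1))).
have h2 : @lnbhs R E x [set y | cabs (l' y - l' x) < e / 2].
  apply: (lc' x dx [set z | cabs (z - l' x) < e / 2]).
  by apply/scalar_nbhsP; exists (e / 2).
apply: (@filterS2 _ _ (@lcs_filter R E x) _ _ _ _ h1 h2) => y /= hy hy'; apply: hA.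
rewrite !E1 (_ : _ - _ = k * (l y - l x) + (l' y - l' x)); last by ring.
apply: le_lt_trans (cabsD _ _) _; rewrite (splitr e); apply: ler_ltD => //.
rewrite cabsM; apply: le_trans (ler_wpM2l (cabs_ge0 k) (ltW hy)) _.
have k1 : 0 < cabs k + 1 by rewrite ltr_wpDl// cabs_ge0.
rewrite [leLHS](_ : _ = e / 2 * (cabs k / (cabs k + 1))); last first.
  by field; rewrite gt_eqF.
by rewrite ler_piMr ?(ltW e2)// ler_pdivrMr// mul1r lerDl.
Qed.

Lemma antidual0 E : @ldom R (antidual E) 0.
Proof.
split=> [k x y _ _||] //; first by rewrite mulr0 addr0.
apply: antilinear_continuous => [k x y _ _|e e0]; first by rewrite mulr0 addr0.
exists 0%N, (fun i : 'I_0 => match i with Ordinal _ h => False_rect _ (notF h) end), 1.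
by split=> // y _ _; rewrite /= cabs0.
Qed.

End Functionals.

Section Kernel.
Variables (R : realType) (W : weyl_data R) (setting : standing_setting W).
Local Notation H := (wH W).
Local Notation ip := (wIp W).
Local Notation Xi := (wXi W).
Local Notation Xis := (wXis W).
Local Notation smooth := (@smooth R W).
Implicit Types (f g h phi : H) (k : R[i]).

Let hN : forall f : H, `|f| ^+ 2 = ip f f := setting_ip_norm setting.

Lemma antidual_of_bound (l : H -> R[i]) us (C : R) :
  (forall k f g, smooth f -> smooth g -> l (k *: f + g) = (k^*)%C * l f + l g) ->
  (forall f, ~ smooth f -> l f = 0) ->
  (forall f, smooth f -> cabs (l f) <= C * smooth_sn us f) ->
  @ldom R (antidual (Hinf W)) l.
Proof.
move=> lP l0 lC; split=> //; apply: antilinear_continuous => // e e0.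
have C1 : 0 < `|C| + 1 by rewrite ltr_wpDl.
apply/Hinf_nbhsP; exists us, (e / (`|C| + 1)); split; first by rewrite divr_gt0.
move=> f; rewrite subr0 => sf hf; apply: le_lt_trans (lC f sf) _.
apply: (@le_lt_trans _ _ ((`|C| + 1) * smooth_sn us f)).
  by rewrite ler_wpM2r ?smooth_sn_ge0// (le_trans (ler_norm C))// lerDl.
by rewrite mulrC -ltr_pdivlMr.
Qed.

Lemma smooth_sn_hnorm f : smooth_sn [:: [:: (1, [::])]] f = hnorm f.
Proof. by rewrite /smooth_sn big_seq1 dpi_id. Qed.

Lemma embHE f g : smooth g -> @embH R W f g = ip f g.
Proof. by move=> sg; rewrite /embH asboolT. Qed.

Lemma embH_antidual f : @ldom R (antidual (Hinf W)) (embH f).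
Proof.
apply: (@antidual_of_bound _ [:: [:: (1, [::])]] (hnorm f)).
- by move=> k g h sg sh; rewrite !embHE ?ipPr//; exact: smoothP.
- by move=> g ng; rewrite /embH asboolF.
- by move=> g sg; rewrite smooth_sn_hnorm embHE//; exact: cauchy_schwarz.
Qed.

Lemma lbounded_smooth_sn (B : set H) us : @lbounded R (Hinf W) B ->
  exists c, 0 <= c /\ forall f, B f -> smooth_sn us f <= c.
Proof.
move=> [_ hB]; elim: us => [|u us [c [c0 hc]]].
  by exists 0; split=> // f _; rewrite /smooth_sn big_nil.
have [c' hc'] := hB (tt, u); exists (`|c'| + c); split; first by rewrite addr_ge0.
move=> f Bf; rewrite /smooth_sn big_cons; apply: lerD; last exact: hc.
by apply: le_trans (ler_norm _); exact: hc'.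
Qed.

(** Sets of functionals that are uniformly bounded on bounded sets are mapped to
    bounded sets by continuous linear maps. *)
Lemma Lb_bounded (T : (H -> R[i]) -> H) (B : set (H -> R[i])) u :
  @ldom R (Lb (antidual (Hinf W)) (Hinf W)) T ->
  B `<=` @ldom R (antidual (Hinf W)) ->
  (forall A, @lbounded R (Hinf W) A ->
     exists c : R, 0 <= c /\ forall l f, B l -> A f -> cabs (l f) <= c) ->
  exists K : R, forall l, B l -> hnorm (@dpi R W u (T l)) <= K.
Proof.
move=> [TL Tdom _ Tc] Bd hB.
have d0 := antidual0 (Hinf W).
have T0 : T 0 = 0.
  by have := TL (-1) 0 0 d0 d0; rewrite scaler0 addr0 scaleN1r addNr.
have : @lnbhs R (Hinf W) (T 0) [set f | hnorm (@dpi R W u f) < 1].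
  rewrite T0; apply/Hinf_nbhsP; exists [:: u], 1; split=> // f _.
  by rewrite subr0 /smooth_sn big_seq1.
move=> /(Tc 0 d0)[n [s [e [e0 hs]]]].
have /choice[c hc] : forall j, exists c : R, 0 <= c /\
    forall l f, B l -> proj1_sig (s j) f -> cabs (l f) <= c.
  by move=> j; apply: hB; exact: proj2_sig (s j).
pose cc := \sum_j c j.
have c_le j : c j <= cc.
  by rewrite /cc (bigD1 j)//= lerDl sumr_ge0// => i _; case: (hc i).
have cc0 : 0 <= cc by apply: sumr_ge0 => i _; case: (hc i).
exists (2 * (cc / e)) => l Bl; apply: scaling_bound => [|t t0 ts].
  by rewrite divr_ge0// ltW.
have dl : @ldom R (antidual (Hinf W)) (creal t *: l).
  by have := antidual_linear (creal t) (Bd _ Bl) d0; rewrite addr0.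
have /ltW : hnorm (@dpi R W u (T (creal t *: l))) < 1.
  apply: hs; rewrite subr0// => j.
  apply: (@le_lt_trans _ _ (t * cc)).
    apply: sup_le_nonneg; first by rewrite mulr_ge0// ltW.
    move=> _ [f Af <-]; rewrite -[(_ *: _) f]/(creal t * l f) cabsM cabs_creal.
    rewrite (ger0_norm (ltW t0)) ler_pM2l//; apply: le_trans (c_le j).
    by have [_] := hc j; apply.
  by move: ts; rewrite mulrA ltr_pdivrMr// mul1r.
have := TL (creal t) l 0 (Bd _ Bl) d0; rewrite !addr0 T0 addr0 => ->.
by rewrite dpiZ// hnormZ cabs_creal (ger0_norm (ltW t0)).
Qed.

(** The orbit of [phi], rescaled by a power of its parameter. As the ambiguity
    functions decay rapidly, it remains bounded in the antidual, and the bound of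
    a continuous map on it is a decay estimate along the orbit. *)
Definition orbit_functionals N phi : set (H -> R[i]) :=
  [set l | exists X : Xi, l = creal ((1 + `|X|) ^+ N) *: embH (piX X phi)].

Lemma orbit_functionals_dom N phi :
  orbit_functionals N phi `<=` @ldom R (antidual (Hinf W)).
Proof.
move=> _ [X ->]; have := antidual_linear (creal ((1 + `|X|) ^+ N))
  (embH_antidual (piX X phi)) (antidual0 (Hinf W)).
by rewrite addr0.
Qed.

Lemma orbit_functionals_equibounded N phi : smooth phi ->
  forall A, @lbounded R (Hinf W) A -> exists c : R, 0 <= c /\
    forall l f, orbit_functionals N phi l -> A f -> cabs (l f) <= c.
Proof.
move=> sp A bA; have [us [C [C0 hC]]] := ambiguity_decay setting N.
have [c [c0 hc]] := lbounded_smooth_sn us bA.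
exists (C * (c * smooth_sn us phi)); split.
  by rewrite !mulr_ge0 ?(ltW C0)// smooth_sn_ge0.
move=> _ f [X ->] Af; have sf : smooth f by case: bA => + _; apply.
rewrite -[(_ *: _) f]/(creal ((1 + `|X|) ^+ N) * embH (piX X phi) f) embHE//.
have P0 : 0 <= (1 + `|X|) ^+ N by rewrite exprn_ge0// addr_ge0.
rewrite cabsM cabs_creal (ger0_norm P0) (ipC ip) cabsJ.
apply: le_trans (ler_wpM2l P0 (hC f phi sf sp X)) _.
rewrite mulrCA poly_weightK mulr1 ler_pM2l// ler_wpM2r ?smooth_sn_ge0//.
exact: hc.
Qed.

Lemma orbit_functionals_bounded N phi : smooth phi ->
  @lbounded R (antidual (Hinf W)) (orbit_functionals N phi).
Proof.
move=> sp; split; first exact: orbit_functionals_dom.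
move=> [A bA]; have [c [c0 hc]] := orbit_functionals_equibounded N sp bA.
exists c => l Bl; apply: sup_le_nonneg => // _ [f Af <-]; exact: hc.
Qed.

Definition orbit_index N phi (sp : smooth phi) u :
    lidx (Lb (antidual (Hinf W)) (Hinf W)) :=
  (exist _ (orbit_functionals N phi) (orbit_functionals_bounded N sp), (tt, u)).

Lemma orbit_decay N phi (sp : smooth phi) u (T : (H -> R[i]) -> H) (X : Xi) :
  @ldom R (Lb (antidual (Hinf W)) (Hinf W)) T ->
  hnorm (@dpi R W u (T (embH (piX X phi)))) <=
    lsn (orbit_index N sp u) T * poly_weight N X.
Proof.
move=> dT; have [K hK] := Lb_bounded u dT (@orbit_functionals_dom N phi)
  (orbit_functionals_equibounded N sp).
have W0 := poly_weight_gt0 N X.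
have P0 : 0 < (1 + `|X|) ^+ N by rewrite exprn_gt0// poly_weight_base_gt0.
have : (1 + `|X|) ^+ N * hnorm (@dpi R W u (T (embH (piX X phi)))) <=
    lsn (orbit_index N sp u) T.
  apply: ub_le_sup.
    by exists K => _ [l Bl <-]; exact: hK.
  exists (creal ((1 + `|X|) ^+ N) *: embH (piX X phi)); first by exists X.
  have [TL _ _ _] := dT; have d0 := antidual0 (Hinf W).
  have T0 : T 0 = 0.
    by have := TL (-1) 0 0 d0 d0; rewrite scaler0 addr0 scaleN1r addNr.
  have := TL (creal ((1 + `|X|) ^+ N)) _ 0 (embH_antidual (piX X phi)) d0.
  rewrite !addr0 T0 addr0 => ->.
  by rewrite -[LHS]/(hnorm (@dpi R W u _)) dpiZ// hnormZ cabs_creal (ger0_norm (ltW P0)).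
move=> h; rewrite -ler_pdivrMr// mulrC; apply: le_trans h.
by rewrite /poly_weight invrK.
Qed.

Lemma orbit_continuous phi us (T : (H -> R[i]) -> H) (X : Xi) (e : R) :
  @ldom R (Lb (antidual (Hinf W)) (Hinf W)) T -> 0 < e ->
  \forall Y \near X, smooth_sn us (T (embH (piX Y phi)) - T (embH (piX X phi))) < e.
Proof.
move=> [TL _ _ Tc] e0; have dE f := embH_antidual f.
have : @lnbhs R (Hinf W) (T (embH (piX X phi)))
    [set y | smooth_sn us (y - T (embH (piX X phi))) < e].
  by apply/Hinf_nbhsP; exists us, e.
move=> /(Tc _ (dE _))[n [s [d [d0 hs]]]].
have /choice[c hc] : forall j, exists c : R, 0 <= c /\
    forall f, proj1_sig (s j) f -> hnorm f <= c.
  move=> j; have [c [c0 hc]] := lbounded_smooth_sn [:: [:: (1, [::])]] (proj2_sig (s j)).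
  by exists c; split=> // f /hc; rewrite smooth_sn_hnorm.
pose cc := \sum_j c j.
have c_le j : c j <= cc.
  by rewrite /cc (bigD1 j)//= lerDl sumr_ge0// => i _; case: (hc i).
have cc0 : 0 <= cc by apply: sumr_ge0 => i _; case: (hc i).
have cc1 : 0 < cc + 1 by rewrite ltr_wpDl.
apply: filterS (piX_cvg setting phi X (divr_gt0 d0 cc1)) => Y hY.
apply: hs => [|j].
  by have := antidual_linear (-1) (dE (piX X phi)) (dE (piX Y phi)); rewrite scaleN1r addrC.
apply: (@le_lt_trans _ _ (hnorm (piX Y phi - piX X phi) * cc)).
  apply: sup_le_nonneg; first by rewrite mulr_ge0// hnorm_ge0.
  move=> _ [f Af <-]; have sf : smooth f by have [+ _] := proj2_sig (s j); apply.
  rewrite -[(_ - _) f]/(embH (piX Y phi) f - embH (piX X phi) f) !embHE// -ipBl.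
  apply: le_trans (cauchy_schwarz hN _ _) _; rewrite ler_wpM2l ?hnorm_ge0//.
  by apply: le_trans (c_le j); have [_] := hc j; apply.
apply: (@le_lt_trans _ _ (hnorm (piX Y phi - piX X phi) * (cc + 1))).
  by rewrite ler_wpM2l ?hnorm_ge0// lerDl.
by rewrite -ltr_pdivlMr.
Qed.

(** This extension to the antidual is what makes the seminorms of
    [Op a (piX X phi)] decay rapidly in [X]. *)
Lemma Op_functional (a : Xis -> R[i]) : @ldom R (SXis W) a ->
  exists2 T, @ldom R (Lb (antidual (Hinf W)) (Hinf W)) T & Op a = (fun f => T (embH f)).
Proof.
move=> sa; have [_ _ [_ _ _ _ [[_ _ surj] _ _ _]]] := ss_twice_nuclearly_smooth setting.
have [[sub _ _] _ _ _] := ss_regularity setting.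
by have [T dT <-] := surj _ (sub a sa); exists T.
Qed.

Lemma Op_smooth (a : Xis -> R[i]) f : @ldom R (SXis W) a -> smooth (Op a f).
Proof.
move=> sa; have [T [_ Tdom _ _] ->] := Op_functional sa.
exact: Tdom (embH_antidual f).
Qed.

End Kernel.

(** * The kernel theorem *)

Section KernelTheorem.
Variables (R : realType) (W : weyl_data R) (setting : standing_setting W).
Local Notation H := (wH W).
Local Notation ip := (wIp W).
Local Notation Xi := (wXi W).
Local Notation Xis := (wXis W).
Local Notation dX := (wdX W).
Local Notation smooth := (@smooth R W).
Implicit Types (f g h phi : H) (k : R[i]).


(** A kernel theorem: the tempered distribution with kernel [w] pairs the
    operator [Op a] with [w] along a resolution of the identity, as a trace
    would do. *)
Lemma kernel_theorem phi (w : H -> H -> R[i]) : smooth phi -> phi <> 0 ->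
  bounded_form w ->
  exists2 a, @ldom R (tempered W) a & forall f g, smooth f -> smooth g ->
    Opd a f g = w f g.
Proof.
move=> sp pN0 bw; have [wl wr [us [C [C0 wC]]]] := bw.
have n0 : 0 < hnorm phi.
  rewrite lt_neqAle hnorm_ge0 andbT eq_sym; apply/eqP => /hnorm_eq0; exact: pN0.
have sX X := piX_smooth setting X sp.
have [C1 [N1 [C10 hC1]]] := piX_growth setting us sp.
have [N iN] := exists_weight setting.
(* the integrand, and the seminorms of the extended operator which govern its decay *)
pose J (a : Xis -> R[i]) (X : Xi) := w (piX X phi) (Op a (piX X phi)).
pose L T := \sum_(u <- us) lsn (orbit_index setting (N1 + N) sp u) T.
have Jbound a T : @ldom R (Lb (antidual (Hinf W)) (Hinf W)) T ->
    Op a = (fun f => T (embH f)) -> forall X, cabs (J a X) <= (C * C1 * L T) * poly_weight N X.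
  move=> dT Oa X; rewrite /J Oa.
  have sT : smooth (T (embH (piX X phi))).
    by have [_ Td _ _] := dT; apply: Td; exact: embH_antidual.
  apply: le_trans (wC _ _ (sX X) sT) _; rewrite -!mulrA ler_pM2l//.
  have h2 : smooth_sn us (T (embH (piX X phi))) <= L T * poly_weight (N1 + N) X.
    rewrite /L mulr_suml; apply: ler_sum => u _; exact: orbit_decay.
  apply: le_trans (ler_pM (smooth_sn_ge0 _ _) (smooth_sn_ge0 _ _) (hC1 X) h2) _.
  rewrite poly_weightD (_ : C1 * (1 + `|X|) ^+ N1 * (L T * (poly_weight N1 X * poly_weight N X))
     = C1 * (L T * (((1 + `|X|) ^+ N1 * poly_weight N1 X) * poly_weight N X))); last by ring.
  by rewrite poly_weightK mul1r.
have Jm a : @ldom R (SXis W) a -> @cmeasurable _ (borel Xi) R (J a).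
  move=> sa; have [T dT Oa] := Op_functional setting sa.
  apply: ccontinuous_cmeasurable; rewrite /J.
  apply: (bounded_form_ccontinuous setting bw (F := fun X => piX X phi)
    (G := fun X => Op a (piX X phi))) => //.
  - by move=> X; exact: Op_smooth.
  - by move=> vs X e e0; exact: piX_cvg_smooth.
  - by move=> vs X e e0; rewrite Oa; exact: orbit_continuous.
have Ji a : @ldom R (SXis W) a -> cintegrable dX (J a).
  move=> sa; have [T dT Oa] := Op_functional setting sa.
  by have [] := weight_dominated (Jm a sa) (Jbound a T dT Oa) iN.
pose r : R := hnorm phi ^- 2.
pose a b := if `[< @ldom R (SXis W) b >] then creal r * cint dX (J b) else 0.
have aE b : @ldom R (SXis W) b -> a b = creal r * cint dX (J b).
  by move=> sb; rewrite /a asboolT.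
have aP k b c : @ldom R (SXis W) b -> @ldom R (SXis W) c ->
    a (k *: b + c) = (k^*)%C * a b + a c.
  move=> sb sc; rewrite !aE//; last exact: SXis_linear.
  rewrite mulrCA -mulrDr -(@cint_linear _ (borel Xi) R dX _ _ _ (Ji b sb) (Ji c sc)).
  congr (_ * cint _ _); apply/funext => X; rewrite /J (Op_linear setting)//.
  by rewrite -[(_ *: _ + _) _]/(k *: Op b (piX X phi) + Op c (piX X phi)) wr//; exact: Op_smooth.
pose I0 := fine (\int[dX]_x (poly_weight N x)%:E)%E.
have I00 : 0 <= I0.
  by apply: fine_ge0; apply: integral_ge0 => x _; rewrite lee_fin poly_weight_ge0.
exists a; first split=> //.
- by move=> b nb; rewrite /a asboolF.
- apply: antilinear_continuous => // e e0.
  pose K := r * (2 * (C * C1 * ((size us)%:R * I0))).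
  have K0 : 0 <= K.
    apply: mulr_ge0; first by rewrite invr_ge0 exprn_ge0// hnorm_ge0.
    by rewrite !mulr_ge0// ltW.
  have K1 : 0 < K + 1 by rewrite ltr_wpDl.
  pose d := e / (K + 1); have d0 : 0 < d by rewrite divr_gt0.
  pose S : set ((H -> R[i]) -> H) := [set T | forall u, u \in us ->
    lsn (orbit_index setting (N1 + N) sp u) T < d].
  have nS : @lnbhs R (Lb (antidual (Hinf W)) (Hinf W)) 0 S.
    exists (size us), (fun j : 'I_(size us) => orbit_index setting (N1 + N) sp (nth [::] us j)), d.
    split=> // T; rewrite subr0 => _ hT u uus.
    have iu : (index u us < size us)%N by rewrite index_mem.
    by have := hT (Ordinal iu); rewrite /= nth_index.
  have [_ _ [_ _ _ _ [_ _ _ iso]]] := ss_twice_nuclearly_smooth setting.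
  have d00 : @ldom R (Lb (antidual (Hinf W)) (Hinf W)) 0.
    split=> [k x y _ _|x _||x _ A /Hinf_nbhsP[vs [e' [e'0 hA]]]] //.
    + by rewrite scaler0 addr0.
    + exact: smooth0.
    + apply: (@filterS _ _ (@lcs_filter R _ x) setT) => [y _ /=|].
        apply: hA; rewrite subrr; first exact: smooth0.
        by rewrite -(scale0r (0 : H)) (smooth_snZ setting) cabs0 mul0r.
      exact: (@filterT _ _ (@lcs_filter R _ x)).
  (* operators with small seminorms form a neighbourhood; [Op] pulls it back *)
  have := iso 0 _ d00 (lnbhs0_ldom nS).
  rewrite -[(fun f => (0 : (H -> R[i]) -> H) (embH f))]/(0 : H -> H) -(Op_zero setting).
  have [_ _ Oc _] := ss_regularity setting.
  move=> /(Oc 0 (SXis0 setting))/lnbhs0_ldom.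
  apply: (@filterS _ _ (@lcs_filter R (SXis W) 0)) => b [/= [T [ST dT] TE] sb].
  have Ob : Op b = (fun f => T (embH f)) by rewrite TE.
  have [_ hb] := weight_dominated (Jm b sb) (Jbound b T dT Ob) iN.
  have LT : L T <= (size us)%:R * d.
    rewrite /L -(sum1_size us) natr_sum mulr_suml big_seq [leRHS]big_seq.
    by apply: ler_sum => u uus; rewrite mul1r ltW// ST.
  rewrite aE// cabsM cabs_creal ger0_norm ?invr_ge0 ?exprn_ge0 ?hnorm_ge0//.
  apply: (@le_lt_trans _ _ (K * d)).
    rewrite /K -mulrA; apply: ler_wpM2l; first by rewrite invr_ge0 exprn_ge0// hnorm_ge0.
    apply: le_trans hb _; rewrite -/I0.
    rewrite [leRHS](_ : _ = 2 * (C * C1 * ((size us)%:R * d) * I0)); last by ring.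
    by rewrite ler_pM2l// ler_wpM2r// ler_pM2l// mulr_gt0.
  rewrite /d mulrCA -[ltRHS]mulr1 ltr_pM2l// ltr_pdivrMr// mul1r ltrDl//.
- move=> f g sf sg; rewrite OpdE//.
  have [_ sW OW] := ambiguity_wigner setting sg sf.
  rewrite aE//.
  have wlC f' : smooth f' -> cabs (w f' g) <= (C * smooth_sn us g) * smooth_sn us f'.
    by move=> sf'; apply: le_trans (wC _ _ sf' sg) _; rewrite -mulrA [smooth_sn us f' * _]mulrC.
  have [_] := reproducing setting sp (fun k f1 f2 s1 s2 => wl k f1 f2 g s1 s2 sg) wlC sf.
  rewrite (_ : (fun X => _) = J (wigner g f)).
    by move=> <-; rewrite mulrA -crealM /r mulVf ?mul1r// gt_eqF// exprn_gt0.
  apply/funext => X; rewrite /J OW /rank1.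
  have := wr (ip (piX X phi) f) (piX X phi) g 0 (sX X) sg (smooth0 setting).
  have w0 f' : smooth f' -> w f' 0 = 0.
    move=> sf'; have := wr (-1) f' 0 0 sf' (smooth0 setting) (smooth0 setting).
    by rewrite scaler0 addr0 rmorphN1 mulN1r addNr.
  by rewrite w0// !addr0 => ->; rewrite -(ipC ip).
Qed.

(** The Wigner distributions are total in the Schwartz space, because the finite
    rank operators are dense. *)
Lemma tempered_ext (a b : (Xis -> R[i]) -> R[i]) :
  @ldom R (tempered W) a -> @ldom R (tempered W) b ->
  (forall f g, smooth f -> smooth g -> a (wigner f g) = b (wigner f g)) -> a = b.
Proof.
move=> ta tb ab; have a0 := tempered0 setting ta; have b0 := tempered0 setting tb.
have [aP aout ac] := ta; have [bP bout bc] := tb.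
apply/funext => c; have [sc|nc] := pselect (@ldom R (SXis W) c); last first.
  by rewrite aout// bout.
have eqW n (f g : 'I_n -> H) : (forall i, smooth (f i) /\ smooth (g i)) ->
    exists c', [/\ @ldom R (SXis W) c', Op c' = (fun h => \sum_(i < n) rank1 ip (f i) (g i) h) &
      a c' = b c'].
  elim: n f g => [|n IH] f g sfg.
    exists 0; split; [exact: SXis0| |by rewrite a0 b0].
    by rewrite (Op_zero setting); apply/funext => h; rewrite big_ord0.
  have [c' [sc' Oc' abc']] := IH (f \o lift ord0) (g \o lift ord0) (fun i => sfg _).
  have [sf sg] := sfg ord0.
  have [_ sW OW] := ambiguity_wigner setting sf sg.
  exists (1 *: wigner (f ord0) (g ord0) + c'); split.
  - exact: SXis_linear.
  - rewrite (Op_linear setting)// OW Oc' scale1r; apply/funext => h.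
    by rewrite big_ord_recl.
  - by rewrite aP// bP// ab// abc'.
apply: subr0_eq; apply: cabs_eq0; apply/eqP; rewrite eq_le cabs_ge0 andbT.
apply/ler_addgt0Pl => e e0; rewrite addr0.
have e2 : 0 < e / 2 by rewrite divr_gt0.
have h1 : @lnbhs R (SXis W) c [set y | cabs (a y - a c) < e / 2].
  apply: (ac c sc [set z | cabs (z - a c) < e / 2]).
  by apply/scalar_nbhsP; exists (e / 2).
have h2 : @lnbhs R (SXis W) c [set y | cabs (b y - b c) < e / 2].
  apply: (bc c sc [set z | cabs (z - b c) < e / 2]).
  by apply/scalar_nbhsP; exists (e / 2).
have h3 : @lnbhs R (SXis W) c [set y | @ldom R (SXis W) y].
  exists 0%N, (fun i : 'I_0 => match i with Ordinal _ h => False_rect _ (notF h) end), 1.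
  split=> // y dy _; have := SXis_linear 1 dy sc.
  by rewrite scale1r subrK.
have h12 := @filterI _ _ (@lcs_filter R (SXis W) c) _ _ h1 h2.
have := Op_open setting sc (@filterI _ _ (@lcs_filter R (SXis W) c) _ _ h12 h3).
have [_ _ [_ dns _ _ _]] := ss_twice_nuclearly_smooth setting.
have [[sub _ _] _ _ _] := ss_regularity setting.
move=> /(dns _ (sub c sc))[T [n [f [g [sfg TE]]]] [y [[/= y1 y2] sy] OT]].
have [c' [sc' Oc' abc']] := eqW n f g sfg.
have yc : y = c' by apply: (Op_inj setting) => //; rewrite OT TE Oc'.
rewrite yc in y1 y2.
rewrite (_ : a c - b c = (b c' - b c) - (a c' - a c)); last by rewrite abc'; ring.
apply: le_trans (cabsD _ _) _; rewrite cabsN (splitr e).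
by apply: lerD; exact: ltW.
Qed.

End KernelTheorem.

(** * Composition of bounded forms *)

Section Composition.
Variables (R : realType) (W : weyl_data R) (setting : standing_setting W).
Local Notation H := (wH W).
Local Notation ip := (wIp W).
Local Notation Xi := (wXi W).
Local Notation dX := (wdX W).
Local Notation smooth := (@smooth R W).
Implicit Types (f g h : H) (k : R[i]) (w : H -> H -> R[i]).

Let hfd := ss_finite_dimensional setting.
Let hleb := ss_lebesgue setting.
Let sf := lebesgue_sigma_finite hfd hleb.

Variables (phi : H) (sp : smooth phi) (pN0 : phi <> 0).

Let n0 : 0 < hnorm phi.
Proof.
rewrite lt_neqAle hnorm_ge0 andbT eq_sym; apply/eqP => /hnorm_eq0; exact: pN0.
Qed.

Let r : R := hnorm phi ^- 2.
Let r0 : 0 < r. Proof. by rewrite invr_gt0 exprn_gt0. Qed.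

Let sX X : smooth (piX X phi).
Proof. exact: piX_smooth. Qed.

Definition form_kernel w (X Y : Xi) : R := cabs (w (piX X phi) (piX Y phi)).

Definition form_norm (p q : \bar R) w : \bar R :=
  mixed_norm dX p q (fun X U : Xi => form_kernel w X (X + U)).

Lemma form_kernel_continuous w : bounded_form w ->
  continuous (fun z : Xi * Xi => form_kernel w z.1 z.2).
Proof.
move=> bw; apply: ccontinuous_cabs.
apply: (bounded_form_ccontinuous setting bw (F := fun z : Xi * Xi => piX z.1 phi)
  (G := fun z : Xi * Xi => piX z.2 phi)) => //.
- move=> us z e e0; have h := piX_cvg_smooth setting us z.1 sp e0.
  exact: (@cvg_fst _ _ (nbhs z.1) (nbhs z.2) _ _ h).
- move=> us z e e0; have h := piX_cvg_smooth setting us z.2 sp e0.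
  exact: (@cvg_snd _ _ (nbhs z.1) (nbhs z.2) _ _ h).
Qed.

Lemma form_kernel_ge0 w X Y : 0 <= form_kernel w X Y.
Proof. exact: cabs_ge0. Qed.

Lemma functional_integral_bound (l : H -> R[i]) us (C : R) f :
  (forall k f g, smooth f -> smooth g -> l (k *: f + g) = k * l f + l g) ->
  (forall f, smooth f -> cabs (l f) <= C * smooth_sn us f) -> smooth f ->
  ((cabs (l f))%:E <=
     (2 * r)%:E * \int[dX]_X (cabs (ambiguity phi f X) * cabs (l (piX X phi)))%:E)%E.
Proof.
move=> lL lC sf0; have [+ E] := reproducing setting sp lL lC sf0.
move=> /(@cintegrableP _ (borel Xi) R)[m i].
have -> : l f = creal r * cint dX (fun X : Xi => ip f (piX X phi) * l (piX X phi)).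
  by rewrite -E mulrA -crealM /r mulVf ?mul1r// gt_eqF// exprn_gt0.
rewrite cabsM cabs_creal (ger0_norm (ltW r0)) EFinM [(2 * r)%R]mulrC EFinM -muleA.
apply: lee_wpmul2l; first by rewrite lee_fin ltW.
have := @cabs_cint_le _ (borel Xi) R dX _ _ (fun X => lexx _) i m.
by move/le_trans; apply; apply: lee_wpmul2l => //; apply: le_ge0_integral => X;
  rewrite ?lee_fin ?cabs_ge0// cabsM.
Qed.

Let form_left w g : bounded_form w -> smooth g -> exists us (C : R),
  (forall k f1 f2, smooth f1 -> smooth f2 -> w (k *: f1 + f2) g = k * w f1 g + w f2 g) /\
  (forall f, smooth f -> cabs (w f g) <= C * smooth_sn us f).
Proof.
move=> [wl _ [us [C [_ wC]]]] sg; exists us, (C * smooth_sn us g); split.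
  by move=> k f1 f2 s1 s2; exact: wl.
by move=> f sf0; apply: le_trans (wC f g sf0 sg) _; rewrite mulrA mulrAC.
Qed.

Let form_right w f : bounded_form w -> smooth f -> exists us (C : R),
  (forall k g1 g2, smooth g1 -> smooth g2 ->
     ((w f (k *: g1 + g2))^*)%C = k * ((w f g1)^*)%C + ((w f g2)^*)%C) /\
  (forall g, smooth g -> cabs ((w f g)^*)%C <= C * smooth_sn us g).
Proof.
move=> [_ wr [us [C [_ wC]]]] sf0; exists us, (C * smooth_sn us f); split.
  by move=> k g1 g2 s1 s2; rewrite wr// rmorphD rmorphM /= conjcK.
by move=> g sg; rewrite cabsJ; apply: le_trans (wC f g sf0 sg) _; rewrite mulrA.
Qed.

Definition composition_integrand w1 w2 f g (Y : Xi) : R[i] :=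
  w2 f (piX Y phi) * w1 (piX Y phi) g.

Lemma composition_integrand_measurable w1 w2 f g : bounded_form w1 -> bounded_form w2 ->
  smooth f -> smooth g -> @cmeasurable _ (borel Xi) R (composition_integrand w1 w2 f g).
Proof.
move=> b1 b2 sf0 sg.
have cst h : smooth h -> forall us (X : Xi) (e : R), 0 < e -> \forall Y \near X, smooth_sn us (h - h) < e.
  move=> sh us X e e0; apply: nearW => Y.
  by rewrite subrr -(scale0r (0 : H)) (smooth_snZ setting) cabs0 mul0r.
have pX us (X : Xi) (e : R) : 0 < e -> \forall Y \near X, smooth_sn us (piX Y phi - piX X phi) < e.
  by move=> e0; exact: piX_cvg_smooth.
apply: (@cmeasurableM _ (borel Xi) R); apply: ccontinuous_cmeasurable.
- by apply: (bounded_form_ccontinuous setting b2 (F := fun=> f) (G := fun X : Xi => piX X phi)) => //; exact: cst.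
- by apply: (bounded_form_ccontinuous setting b1 (F := fun X : Xi => piX X phi) (G := fun=> g)) => //; exact: cst.
Qed.

Variables (p1 p2 p q1 q2 q : \bar R).
Hypotheses (hp1 : (1 <= p1)%E) (hp2 : (1 <= p2)%E) (hp : (1 <= p)%E).
Hypotheses (hq1 : (1 <= q1)%E) (hq2 : (1 <= q2)%E) (hq : (1 <= q)%E).
Hypotheses (hpp : (p1^-1 + p2^-1 = p^-1)%E) (hqq : (q1^-1 + q2^-1 = 1 + q^-1)%E).

(** The values of the forms at smooth vectors are superpositions of their values
    along the orbit of [phi], with rapidly decreasing coefficients. *)
Lemma composition_integrand_bound : exists us (C : R), 0 <= C /\
  forall w1 w2, bounded_form w1 -> bounded_form w2 ->
  forall f g, smooth f -> smooth g ->
  (\int[dX]_Y (cabs (composition_integrand w1 w2 f g Y))%:E <=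
    (C * (smooth_sn us f * smooth_sn us g))%:E * (form_norm p1 q1 w1 * form_norm p2 q2 w2))%E.
Proof.
have [N iN] := exists_weight setting.
have [us [D [D0 hD]]] := ambiguity_decay setting (N + N).
have [C' [C'0 hC']] := weighted_composition_bound hfd hleb iN hp1 hp2 hp hq1 hq2 hq hpp hqq.
pose a f := D * (smooth_sn us f * smooth_sn us phi).
have a0 f : 0 <= a f by rewrite mulr_ge0 ?(ltW D0)// mulr_ge0 ?smooth_sn_ge0.
pose c := 2 * r; have c0 : 0 <= c by rewrite mulr_ge0// ltW.
exists us, ((c * (D * smooth_sn us phi)) ^+ 2 * C'); split.
  by rewrite mulr_ge0 ?sqr_ge0// ltW.
move=> w1 w2 b1 b2 f g sf0 sg.
have k1 := form_kernel_continuous b1; have k2 := form_kernel_continuous b2.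
have k10 := form_kernel_ge0 w1; have k20 := form_kernel_ge0 w2.
pose k := @poly_weight R Xi (N + N).
have kk0 x : 0 <= k x by exact: poly_weight_ge0.
pose F2 Y := (\int[dX]_X (k X * form_kernel w2 X Y)%:E)%E.
pose F1 Y := (\int[dX]_X (k X * form_kernel w1 Y X)%:E)%E.
have F20 Y : (0 <= F2 Y)%E by apply: integral_ge0 => X _; rewrite lee_fin mulr_ge0.
have F10 Y : (0 <= F1 Y)%E by apply: integral_ge0 => X _; rewrite lee_fin mulr_ge0.
have csnd : continuous (fun z : Xi * Xi => k z.2).
  move=> z; apply: (@continuous_comp _ _ _ snd k); first exact: cvg_snd.
  exact: poly_weight_continuous.
have mk (B : Xi -> Xi -> R) : continuous (fun z : Xi * Xi => B z.1 z.2) ->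
   measurable_fun setT ((fun z => (k z.2 * B z.1 z.2)%:E) : borel Xi * borel Xi -> \bar R).
  move=> cB; apply/measurable_EFinP; apply: (continuous_measurable_prod hfd) => z.
  by apply: cvgM; [exact: csnd|exact: cB].
have mk' (B : Xi -> R) : continuous B ->
   measurable_fun setT ((fun x => (k x * B x)%:E) : borel Xi -> \bar R).
  move=> cB; apply/measurable_EFinP; apply: continuous_measurable_borel => z.
  by apply: cvgM; [exact: poly_weight_continuous|exact: cB].
have mF1 : measurable_fun setT (F1 : borel Xi -> \bar R).
  apply: (measurable_partial_integral sf (f := fun z : borel Xi * borel Xi =>
    (k z.2 * form_kernel w1 z.1 z.2)%:E)); first exact: mk.
  by move=> z; rewrite lee_fin mulr_ge0.
have mF2 : measurable_fun setT (F2 : borel Xi -> \bar R).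
  apply: (measurable_partial_integral sf (f := fun z : borel Xi * borel Xi =>
    (k z.2 * form_kernel w2 z.2 z.1)%:E)); last by move=> z; rewrite lee_fin mulr_ge0.
  apply: (mk (fun x y => form_kernel w2 y x)) => z.
  apply: (@continuous_comp _ _ _ (fun z : Xi * Xi => (z.2, z.1)) (fun z : Xi * Xi => form_kernel w2 z.1 z.2)).
    by apply: cvg_pair; [exact: cvg_snd|exact: cvg_fst].
  exact: k2.
(* the coefficient at [X] is replaced by its rapidly decreasing bound *)
have pull (B : Xi -> R) h : continuous B -> (forall x, 0 <= B x) -> smooth h ->
    (c%:E * \int[dX]_X (cabs (ambiguity phi h X) * B X)%:E <=
     (c * a h)%:E * \int[dX]_X (k X * B X)%:E)%E.
  move=> cB B0 sh; rewrite (EFinM c) -muleA; apply: lee_wpmul2l; first by rewrite lee_fin.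
  rewrite -ge0_integralZl ?lee_fin//; last 2 first.
  - exact: mk'.
  - by move=> X _; rewrite lee_fin mulr_ge0.
  apply: le_ge0_integral => X; first by rewrite lee_fin mulr_ge0// cabs_ge0.
  by rewrite -EFinM lee_fin mulrA ler_wpM2r//; exact: hD.
have h2 Y : ((cabs (w2 f (piX Y phi)))%:E <= (c * a f)%:E * F2 Y)%E.
  have [vs [C [lL lC]]] := form_left b2 (sX Y).
  apply: le_trans (functional_integral_bound lL lC sf0) _.
  apply: (pull (fun X => form_kernel w2 X Y)) => //.
  exact: (@continuous_cosection _ _ (form_kernel w2)).
have h1 Y : ((cabs (w1 (piX Y phi) g))%:E <= (c * a g)%:E * F1 Y)%E.
  have [vs [C [lL lC]]] := form_right b1 (sX Y).
  have := functional_integral_bound lL lC sg; rewrite cabsJ => /le_trans; apply.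
  under eq_integral do rewrite cabsJ.
  apply: (pull (fun X => form_kernel w1 Y X)) => //.
  exact: (@continuous_section _ _ (form_kernel w1)).
apply: (@le_trans _ _ (\int[dX]_Y (((c * a f) * (c * a g))%:E * (F2 Y * F1 Y)))%E).
  apply: le_ge0_integral => Y; first by rewrite lee_fin cabs_ge0.
  rewrite cabsM (EFinM (cabs _)) (EFinM (c * a f)) muleACA.
  by apply: lee_pmul; rewrite ?lee_fin ?cabs_ge0.
have caa : 0 <= (c * a f) * (c * a g) by rewrite mulr_ge0// mulr_ge0.
rewrite ge0_integralZl ?lee_fin//; last 2 first.
- exact: emeasurable_funM.
- by move=> Y _; exact: mule_ge0.
apply: le_trans (lee_wpmul2l _ (hC' _ _ k1 k2 k10 k20)) _.
  by rewrite lee_fin.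
rewrite muleA -(EFinM (c * a f * (c * a g))); apply: lee_wpmul2r.
  by rewrite mule_ge0// mixed_norm_ge0.
by rewrite lee_fin /a le_eqVlt; apply/orP; left; apply/eqP; ring.
Qed.

Definition composition w1 w2 f g : R[i] :=
  creal r * cint dX (composition_integrand w1 w2 f g).

Variables (w1 w2 : H -> H -> R[i]).
Hypotheses (b1 : bounded_form w1) (b2 : bounded_form w2).
Hypotheses (n1 : (form_norm p1 q1 w1 < +oo)%E) (n2 : (form_norm p2 q2 w2 < +oo)%E).

Let product_fin : exists2 m : R, 0 <= m &
  (form_norm p1 q1 w1 * form_norm p2 q2 w2 = m%:E)%E.
Proof.
have f1 : form_norm p1 q1 w1 \is a fin_num by rewrite ge0_fin_numE// mixed_norm_ge0.
have f2 : form_norm p2 q2 w2 \is a fin_num by rewrite ge0_fin_numE// mixed_norm_ge0.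
exists (fine (form_norm p1 q1 w1) * fine (form_norm p2 q2 w2)).
  by rewrite mulr_ge0// fine_ge0// mixed_norm_ge0.
by rewrite EFinM !fineK.
Qed.

Lemma composition_integrable f g : smooth f -> smooth g ->
  cintegrable dX (composition_integrand w1 w2 f g).
Proof.
move=> sf0 sg; have [us [C [C0 h]]] := composition_integrand_bound.
apply/(@cintegrableP _ (borel Xi) R); split.
  exact: composition_integrand_measurable.
apply: le_lt_trans (h _ _ b1 b2 f g sf0 sg) _.
by have [m _ ->] := product_fin; rewrite -EFinM ltry.
Qed.

Lemma composition_bounded_form : bounded_form (composition w1 w2).
Proof.
have ci := composition_integrable.
have [wl1 wr1 _] := b1; have [wl2 wr2 _] := b2.
split.
- move=> k f1 f2 g s1 s2 sg; rewrite /composition mulrCA -mulrDr.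
  rewrite -(@cint_linear _ (borel Xi) R dX _ _ _ (ci f1 g s1 sg) (ci f2 g s2 sg)).
  congr (_ * cint _ _); apply/funext => Y; rewrite /composition_integrand wl2//.
  by rewrite mulrDl mulrA.
- move=> k f g1 g2 sf0 s1 s2; rewrite /composition mulrCA -mulrDr.
  rewrite -(@cint_linear _ (borel Xi) R dX _ _ _ (ci f g1 sf0 s1) (ci f g2 sf0 s2)).
  congr (_ * cint _ _); apply/funext => Y; rewrite /composition_integrand wr1//.
  by rewrite mulrDr mulrCA.
have [us [C [C0 h]]] := composition_integrand_bound.
have [m m0 mE] := product_fin.
exists us, (r * (2 * (C * m)) + 1); split.
  by rewrite ltr_wpDl// mulr_ge0 ?(ltW r0)// !mulr_ge0.
move=> f g sf0 sg; rewrite /composition cabsM cabs_creal (ger0_norm (ltW r0)).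
have S0 : 0 <= smooth_sn us f * smooth_sn us g by rewrite mulr_ge0 ?smooth_sn_ge0.
apply: (@le_trans _ _ (r * (2 * (C * m)) * (smooth_sn us f * smooth_sn us g))); last first.
  by rewrite ler_wpM2r// lerDl.
rewrite -mulrA ler_pM2l// -lee_fin.
have hb := h _ _ b1 b2 f g sf0 sg.
have /(@cintegrableP _ (borel Xi) R)[mi ii] := ci f g sf0 sg.
have := @cabs_cint_le _ (borel Xi) R dX _ _ (fun X => lexx _) ii mi.
move/le_trans; apply; apply: le_trans (lee_wpmul2l _ hb) _ => //.
rewrite mE -!EFinM lee_fin le_eqVlt; apply/orP; left; apply/eqP; ring.
Qed.

Lemma form_norm_composition : (form_norm p q (composition w1 w2) <=
  (2 * r)%:E * (form_norm p1 q1 w1 * form_norm p2 q2 w2))%E.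
Proof.
apply: (mixed_norm_composition hfd hleb hp1 hp2 hp hq1 hq2 hq hpp hqq) => //.
- by rewrite mulr_ge0// ltW.
- exact: form_kernel_continuous.
- exact: form_kernel_continuous.
1-3: by move=> x u; exact: form_kernel_ge0.
move=> X U; rewrite /form_kernel /composition cabsM cabs_creal (ger0_norm (ltW r0)).
have /(@cintegrableP _ (borel Xi) R)[mi ii] := composition_integrable (sX X) (sX (X + U)).
have hb := @cabs_cint_le _ (borel Xi) R dX _ _ (fun X => lexx _) ii mi.
rewrite EFinM [(2 * r)%R]mulrC EFinM -muleA.
apply: lee_wpmul2l; first by rewrite lee_fin ltW.
apply: le_trans hb _; apply: lee_wpmul2l => //; apply: le_ge0_integral => Y.
  by rewrite lee_fin cabs_ge0.
by rewrite lee_fin cabsM.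
Qed.

End Composition.

(** * The Moyal product on modulation spaces *)

Section Moyal.
Variables (R : realType) (W : weyl_data R) (setting : standing_setting W).
Local Notation mm := (wLie W).
Local Notation H := (wH W).
Local Notation ip := (wIp W).
Local Notation expM := (@wExp R W).
Local Notation theta := (wTheta W).
Local Notation Xi := (wXi W).
Local Notation Xis := (wXis W).
Local Notation dX := (wdX W).
Local Notation smooth := (@smooth R W).
Implicit Types (f g h : H) (k : R[i]) (w : H -> H -> R[i]).
Implicit Types (a b : (Xis -> R[i]) -> R[i]).

Let hfd := ss_finite_dimensional setting.
Let hleb := ss_lebesgue setting.

Variables (phi : H) (sp : smooth phi) (pN0 : phi <> 0).

Let Phi := wigner phi phi.

(** The representation of the semidirect product moves the two arguments of the
    Wigner distribution along their orbits. *)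
Lemma rep_sharp_wigner (X1 X2 : Xi) :
  rep_sharp (sdexp expM (theta X1, theta X2)) Phi =
    wigner (piX (X1 + X2) phi) (piX X1 phi).
Proof.
have [_ sPhi OPhi] := ambiguity_wigner setting sp sp.
have [_ sW OW] := ambiguity_wigner setting (piX_smooth setting (X1 + X2) sp)
  (piX_smooth setting X1 sp).
have key : Op (wigner (piX (X1 + X2) phi) (piX X1 phi)) =
    rep_sd (sdexp expM (theta X1, theta X2)) (Op Phi).
  rewrite OW OPhi; apply/funext => h; rewrite /rep_sd /rank1 /sdexp /=.
  rewrite (piZ setting) -linearD /=.
  have -> : (expM (theta X1) * (expM (- theta X1) * expM (theta (X1 + X2))))%g
      = expM (theta (X1 + X2)).
    by rewrite -{2}(scale1r (theta X1)) (expMN setting) scale1r mulVKg.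
  congr (_ *: _); rewrite -[RHS](pi_ip setting (expM (theta X1))).
  by rewrite -(piM setting) mulgV (pi1 setting).
rewrite /rep_sharp; case: xgetP => [F _ [sF OF]|/(_ (wigner (piX (X1 + X2) phi) (piX X1 phi)))[]].
  by apply: (Op_inj setting) => //; rewrite OF -key.
by split.
Qed.

Lemma modulation_norm_form (p q : \bar R) a :
  modulation_norm p q Phi a = form_norm phi p q (Opd a).
Proof.
rewrite /modulation_norm /form_norm /mixed_norm; congr Lnorm; apply/funext => U.
congr Lnorm; apply/funext => X; rewrite /form_kernel /ambiguity_sharp rep_sharp_wigner.
by rewrite OpdE//; exact: piX_smooth.
Qed.

Lemma bounded_form_Lb w : bounded_form w ->
  (forall f g, ~ (smooth f /\ smooth g) -> w f g = 0) ->
  @ldom R (Lb (Hinf W) (antidual (Hinf W))) w.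
Proof.
move=> [wl wr [us [C [C0 wC]]]] w0.
have wdom f : smooth f -> @ldom R (antidual (Hinf W)) (w f).
  move=> sf; apply: (antidual_of_bound (us := us) (C := C * smooth_sn us f)).
  - by move=> k g1 g2 s1 s2; exact: wr.
  - by move=> g ng; apply: w0 => -[].
  - by move=> g sg; apply: le_trans (wC f g sf sg) _; rewrite mulrA.
have wL : @llinear R (Hinf W) (antidual (Hinf W)) w.
  move=> k f1 f2 s1 s2; apply/funext => g.
  rewrite -[RHS]/(k * w f1 g + w f2 g); have [sg|ng] := pselect (smooth g).
    exact: wl.
  by rewrite !w0 ?mulr0 ?addr0// => -[].
split=> // [f nf|f sf A [n [s [e [e0 hA]]]]].
  by apply/funext => g; apply: w0 => -[].
have /choice[c hc] : forall j, exists c : R, 0 <= c /\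
    forall g, proj1_sig (s j) g -> smooth_sn us g <= c.
  by move=> j; exact: lbounded_smooth_sn (proj2_sig (s j)).
pose cc := \sum_j c j.
have c_le j : c j <= cc.
  by rewrite /cc (bigD1 j)//= lerDl sumr_ge0// => i _; case: (hc i).
have cc0 : 0 <= cc by apply: sumr_ge0 => i _; case: (hc i).
have K1 : 0 < C * cc + 1 by rewrite ltr_wpDl// mulr_ge0// ltW.
apply/Hinf_nbhsP; exists us, (e / (C * cc + 1)); split; first by rewrite divr_gt0.
move=> g sgf hg.
have E : w g - w f = w (g - f).
  have := wL 1 (g - f) f sgf sf; rewrite !scale1r subrK => ->.
  by rewrite addrK.
apply: hA => [|j]; rewrite E; first exact: wdom.
apply: (@le_lt_trans _ _ (smooth_sn us (g - f) * (C * cc))).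
  apply: sup_le_nonneg; first by rewrite !mulr_ge0 ?smooth_sn_ge0// ltW.
  move=> _ [h Ah <-]; have sh : smooth h by have [+ _] := proj2_sig (s j); apply.
  apply: le_trans (wC _ _ sgf sh) _; rewrite mulrCA ler_wpM2l ?smooth_sn_ge0//.
  by rewrite ler_pM2l//; apply: le_trans (c_le j); have [_] := hc j; apply.
apply: (@le_lt_trans _ _ (smooth_sn us (g - f) * (C * cc + 1))).
  by rewrite ler_wpM2l ?smooth_sn_ge0// lerDl.
by rewrite -ltr_pdivlMr.
Qed.

Lemma Opd_linear k a b f g : Opd (k *: a + b) f g = k * Opd a f g + Opd b f g.
Proof. by rewrite /Opd; case: asboolP => _ //; rewrite mulr0 addr0. Qed.

Lemma Opd_inj a b : @ldom R (tempered W) a -> @ldom R (tempered W) b ->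
  Opd a = Opd b -> a = b.
Proof.
move=> ta tb E; apply: (tempered_ext setting) => // f g sf sg.
by rewrite -(OpdE a sg sf) -(OpdE b sg sf) E.
Qed.

Lemma form_norm_quasi_triangle (p q : \bar R) k w1 w2 w : (1 <= p)%E -> (1 <= q)%E ->
  bounded_form w1 -> bounded_form w2 ->
  (forall f g, smooth f -> smooth g -> w f g = k * w1 f g + w2 f g) ->
  (form_norm phi p q w <=
     16%:E * ((cabs k)%:E * form_norm phi p q w1 + form_norm phi p q w2))%E.
Proof.
move=> p1 q1 b1 b2 wE.
have c1 := continuous_displacement (form_kernel_continuous setting sp b1).
have c2 := continuous_displacement (form_kernel_continuous setting sp b2).
rewrite /form_norm -(mixed_normZ hfd hleb p1 q1 (cabs_ge0 k) (A := fun X U => form_kernel phi w1 X (X + U)) c1).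
apply: (mixed_norm_quasi_triangle hfd hleb p1 q1) => //.
- by move=> z; apply: cvgM; [exact: cvg_cst|exact: c1].
- by move=> x u; exact: cabs_ge0.
- by move=> x u; rewrite mulr_ge0 ?cabs_ge0.
- by move=> x u; exact: cabs_ge0.
move=> X U; rewrite /form_kernel wE; [|exact: piX_smooth..].
by apply: le_trans (cabsD _ _) _; rewrite cabsM.
Qed.

Section Exponents.
Variables (p q : \bar R) (hp : (1 <= p)%E) (hq : (1 <= q)%E).
Local Notation Mod := (@modulation_space R W p q Phi).

Lemma modulationP a : @ldom R Mod a <->
  @ldom R (tempered W) a /\ (form_norm phi p q (Opd a) < +oo)%E.
Proof. by rewrite -modulation_norm_form. Qed.

Lemma modulation_snE a : @ldom R Mod a ->
  form_norm phi p q (Opd a) = (lsn (tt : lidx Mod) a)%:E.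
Proof.
move=> /modulationP[_ fa]; rewrite /= modulation_norm_form fineK//.
by rewrite ge0_fin_numE// mixed_norm_ge0.
Qed.

Lemma modulation_sn_ge0 a : 0 <= lsn (tt : lidx Mod) a.
Proof. by rewrite /= fine_ge0// modulation_norm_form mixed_norm_ge0. Qed.

Lemma modulation_quasi_triangle k a b : @ldom R Mod a -> @ldom R Mod b ->
  @ldom R Mod (k *: a + b) /\
  lsn (tt : lidx Mod) (k *: a + b) <=
    16 * (cabs k * lsn (tt : lidx Mod) a + lsn (tt : lidx Mod) b).
Proof.
move=> ma mb; have [ta _] := (modulationP a).1 ma; have [tb _] := (modulationP b).1 mb.
have h := form_norm_quasi_triangle hp hq (Opd_bounded_form setting ta)
  (Opd_bounded_form setting tb) (fun f g _ _ => Opd_linear k a b f g).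
rewrite (modulation_snE ma) (modulation_snE mb) -(EFinM (cabs k)) -EFinD -EFinM in h.
have mab : @ldom R Mod (k *: a + b).
  apply/modulationP; split; first exact: antidual_linear.
  by apply: le_lt_trans h _; rewrite ltry.
by split=> //; rewrite -lee_fin -modulation_snE.
Qed.

Lemma modulation_nbhsP a (A : set ((Xis -> R[i]) -> R[i])) : @lnbhs R Mod a A <->
  exists2 e : R, 0 < e & forall b, @ldom R Mod (b - a) -> lsn (tt : lidx Mod) (b - a) < e -> A b.
Proof.
split=> [[n [s [e [e0 h]]]]|[e e0 h]].
  by exists e => // b db hb; apply: h => // j; case: (s j).
by exists 1%N, (fun=> tt), e; split=> // b db /(_ ord0); exact: h.
Qed.

End Exponents.

Variables (p1 p2 p q1 q2 q : \bar R).
Hypotheses (hp1 : (1 <= p1)%E) (hp2 : (1 <= p2)%E) (hp : (1 <= p)%E).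
Hypotheses (hq1 : (1 <= q1)%E) (hq2 : (1 <= q2)%E) (hq : (1 <= q)%E).
Hypotheses (hpp : (p1^-1 + p2^-1 = p^-1)%E) (hqq : (q1^-1 + q2^-1 = 1 + q^-1)%E).
Local Notation M1 := (@modulation_space R W p1 q1 Phi).
Local Notation M2 := (@modulation_space R W p2 q2 Phi).
Local Notation M3 := (@modulation_space R W p q Phi).

Let weak_productE a1 a2 f g : smooth f -> smooth g ->
  weak_product phi a1 a2 f g = composition phi (Opd a1) (Opd a2) f g.
Proof. by move=> sf sg; rewrite /weak_product asboolT. Qed.

Let integrable a1 a2 f g : @ldom R M1 a1 -> @ldom R M2 a2 -> smooth f -> smooth g ->
  cintegrable dX (weak_integrand phi a1 a2 f g).
Proof.
move=> /modulationP[t1 n1] /modulationP[t2 n2] sf sg.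
exact: (composition_integrable setting sp pN0 hp1 hp2 hp hq1 hq2 hq hpp hqq
  (Opd_bounded_form setting t1) (Opd_bounded_form setting t2) n1 n2 sf sg).
Qed.

Let weak_product_form a1 a2 : @ldom R M1 a1 -> @ldom R M2 a2 ->
  bounded_form (weak_product phi a1 a2).
Proof.
move=> /modulationP[t1 n1] /modulationP[t2 n2].
have [wl wr [us [C [C0 wC]]]] := composition_bounded_form setting sp pN0 hp1 hp2 hp hq1 hq2 hq
  hpp hqq (Opd_bounded_form setting t1) (Opd_bounded_form setting t2) n1 n2.
split.
- by move=> k f1 f2 g s1 s2 sg; rewrite !weak_productE ?wl//; exact: smoothP.
- by move=> k f g1 g2 sf s1 s2; rewrite !weak_productE ?wr//; exact: smoothP.
- by exists us, C; split=> // f g sf sg; rewrite weak_productE ?wC.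
Qed.

Lemma modulation_product_defined a1 a2 : @ldom R M1 a1 -> @ldom R M2 a2 ->
  weak_product_defined phi a1 a2.
Proof.
move=> m1 m2; split=> [f g sf sg|]; first exact: integrable.
apply: bounded_form_Lb; first exact: weak_product_form.
by move=> f g nfg; rewrite /weak_product asboolF.
Qed.

(** The kernel theorem provides the distribution, the totality of the Wigner
    distributions its uniqueness. *)
Lemma exists_moyal a1 a2 : @ldom R M1 a1 -> @ldom R M2 a2 ->
  exists! a, is_moyal phi a1 a2 a.
Proof.
move=> m1 m2.
have [a ta aE] := kernel_theorem setting sp pN0 (weak_product_form m1 m2).
have Ea : Opd a = weak_product phi a1 a2.
  apply/funext => f; apply/funext => g; have [[sf sg]|nfg] := pselect (smooth f /\ smooth g).
    exact: aE.
  by rewrite /Opd /weak_product !asboolF.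
exists a; split=> // b [tb Eb]; apply: Opd_inj => //.
by rewrite Eb.
Qed.

Lemma moyalP a1 a2 : @ldom R M1 a1 -> @ldom R M2 a2 ->
  is_moyal phi a1 a2 (moyal phi a1 a2).
Proof.
move=> m1 m2; have [a [ha _]] := exists_moyal m1 m2.
rewrite /moyal; case: xgetP => [b _ //|/(_ a)]; by case.
Qed.

Lemma moyal_bound : exists2 C : R, 0 <= C & forall a1 a2, @ldom R M1 a1 -> @ldom R M2 a2 ->
  @ldom R M3 (moyal phi a1 a2) /\
  lsn (tt : lidx M3) (moyal phi a1 a2) <= C * (lsn (tt : lidx M1) a1 * lsn (tt : lidx M2) a2).
Proof.
exists (2 * hnorm phi ^- 2); first by rewrite mulr_ge0// invr_ge0 exprn_ge0// hnorm_ge0.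
move=> a1 a2 m1 m2; have [ta Ea] := moyalP m1 m2.
have [t1 n1] := (modulationP p1 q1 a1).1 m1; have [t2 n2] := (modulationP p2 q2 a2).1 m2.
have := form_norm_composition setting sp pN0 hp1 hp2 hp hq1 hq2 hq
  hpp hqq (Opd_bounded_form setting t1) (Opd_bounded_form setting t2) n1 n2.
have -> : form_norm phi p q (composition phi (Opd a1) (Opd a2)) =
    form_norm phi p q (Opd (moyal phi a1 a2)).
  rewrite Ea /form_norm /mixed_norm; congr Lnorm; apply/funext => U.
  by congr Lnorm; apply/funext => X; rewrite /form_kernel weak_productE//; exact: piX_smooth.
rewrite (modulation_snE m1) (modulation_snE m2) -EFinM => h.
have mm : @ldom R M3 (moyal phi a1 a2).
  by apply/modulationP; split=> //; apply: le_lt_trans h _; rewrite ltry.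
by split=> //; rewrite -lee_fin -(modulation_snE mm).
Qed.

Lemma moyal_linearl k a1 b1 a2 : @ldom R M1 a1 -> @ldom R M1 b1 -> @ldom R M2 a2 ->
  moyal phi (k *: a1 + b1) a2 = k *: moyal phi a1 a2 + moyal phi b1 a2.
Proof.
move=> ma mb m2; have [mab _] := modulation_quasi_triangle hp1 hq1 k ma mb.
have [t Et] := moyalP mab m2; have [ta Ea] := moyalP ma m2; have [tb Eb] := moyalP mb m2.
apply: (Opd_inj t (antidual_linear k ta tb)).
rewrite Et; apply/funext => f; apply/funext => g; rewrite Opd_linear Ea Eb.
rewrite /weak_product; case: asboolP => [[sf sg]|_]; last by rewrite mulr0 addr0.
rewrite mulrCA -mulrDr -(@cint_linear _ (borel Xi) R dX _ _ _ (integrable ma m2 sf sg) (integrable mb m2 sf sg)).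
congr (_ * cint _ _); apply/funext => Y; rewrite /weak_integrand Opd_linear; ring.
Qed.

Lemma moyal_linearr k a1 a2 b2 : @ldom R M1 a1 -> @ldom R M2 a2 -> @ldom R M2 b2 ->
  moyal phi a1 (k *: a2 + b2) = k *: moyal phi a1 a2 + moyal phi a1 b2.
Proof.
move=> m1 ma mb; have [mab _] := modulation_quasi_triangle hp2 hq2 k ma mb.
have [t Et] := moyalP m1 mab; have [ta Ea] := moyalP m1 ma; have [tb Eb] := moyalP m1 mb.
apply: (Opd_inj t (antidual_linear k ta tb)).
rewrite Et; apply/funext => f; apply/funext => g; rewrite Opd_linear Ea Eb.
rewrite /weak_product; case: asboolP => [[sf sg]|_]; last by rewrite mulr0 addr0.
rewrite mulrCA -mulrDr -(@cint_linear _ (borel Xi) R dX _ _ _ (integrable m1 ma sf sg) (integrable m1 mb sf sg)).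
congr (_ * cint _ _); apply/funext => Y; rewrite /weak_integrand Opd_linear; ring.
Qed.

Lemma moyal_continuous_bilinear : @continuous_bilinear R M1 M2 M3 (moyal phi).
Proof.
have [C C0 hC] := moyal_bound.
split.
- by move=> x y mx my; have [] := hC x y mx my.
- by move=> y my k x x' mx mx'; exact: moyal_linearl.
- by move=> x mx k y y' my my'; exact: moyal_linearr.
move=> x y mx my A /modulation_nbhsP[e e0 hA].
pose nx := lsn (tt : lidx M1) x; pose ny := lsn (tt : lidx M2) y.
have nx0 : 0 <= nx := modulation_sn_ge0 _ _ x.
have ny0 : 0 <= ny := modulation_sn_ge0 _ _ y.
pose K := 16 * (C * (16 * (1 + ny)) + C * nx) + 1.
have K0 : 0 < K.
  by rewrite ltr_wpDl// !(mulr_ge0, addr_ge0).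
pose d := Num.min 1 (e / K).
have d0 : 0 < d by rewrite lt_min ltr01 divr_gt0.
exists ([set x' | @ldom R M1 (x' - x) /\ lsn (tt : lidx M1) (x' - x) < d],
        [set y' | @ldom R M2 (y' - y) /\ lsn (tt : lidx M2) (y' - y) < d]).
  split; apply/modulation_nbhsP; exists d => // z dz hz; by split.
move=> [x' y'] /= [[dx hx] [dy hy]]; rewrite -/(moyal phi x' y').
have my' : @ldom R M2 y'.
  by have [] := modulation_quasi_triangle hp2 hq2 1 dy my; rewrite scale1r subrK.
have [ma ha] := hC _ _ dx my'; have [mb hb] := hC _ _ mx dy.
have [mab hab] := modulation_quasi_triangle hp hq 1 ma mb.
have addrDK (V : zmodType) (u v t : V) : u + (v + t) - t = u + v by rewrite addrA addrK.
(* the increment of a bilinear map in both arguments *)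
have E : moyal phi x' y' - moyal phi x y =
    1 *: moyal phi (x' - x) y' + moyal phi x (y' - y).
  have h1 := moyal_linearl 1 dx mx my'; have h2 := moyal_linearr 1 mx dy my.
  rewrite !scale1r !subrK in h1 h2; rewrite h1 h2 scale1r.
  exact: addrDK.
apply: hA; rewrite E; first exact: mab.
apply: le_lt_trans hab _; rewrite cabs1 mul1r.
have hy' : lsn (tt : lidx M2) y' <= 16 * (1 + ny).
  have [_] := modulation_quasi_triangle hp2 hq2 1 dy my.
  rewrite scale1r subrK cabs1 mul1r => /le_trans; apply.
  rewrite ler_pM2l// lerD2r; apply: le_trans (ltW hy) _; by rewrite ge_min lexx.
have b1 : lsn (tt : lidx M3) (moyal phi (x' - x) y') <= d * (C * (16 * (1 + ny))).
  apply: le_trans ha _; rewrite mulrCA; apply: ler_pM => //.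
  - exact: modulation_sn_ge0.
  - by rewrite mulr_ge0// modulation_sn_ge0.
  - exact: ltW.
  - by rewrite ler_wpM2l.
have b2 : lsn (tt : lidx M3) (moyal phi x (y' - y)) <= d * (C * nx).
  apply: le_trans hb _; rewrite [_ * lsn _ (y' - y)]mulrC mulrCA; apply: ler_pM => //.
  - exact: modulation_sn_ge0.
  - by rewrite mulr_ge0// modulation_sn_ge0.
  - exact: ltW.
apply: (@le_lt_trans _ _ (d * (16 * (C * (16 * (1 + ny)) + C * nx)))).
  rewrite [leRHS]mulrCA ler_pM2l// mulrDr; exact: lerD.
apply: (@lt_le_trans _ _ (d * K)); first by rewrite ltr_pM2l// ltrDl.
by rewrite -ler_pdivlMr// ge_min lexx orbT.
Qed.

End Moyal.

Local Open Scope ereal_scope.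

Theorem corollary2p14 (R : realType) (W : weyl_data R)
    (setting : standing_setting W)
    (phi : wH W) (hphi : @ldom R (Hinf W) phi) (phi0 : phi <> 0%R)
    (p1 p2 p q1 q2 q : \bar R)
    (hp1 : 1 <= p1) (hp2 : 1 <= p2) (hp : 1 <= p)
    (hq1 : 1 <= q1) (hq2 : 1 <= q2) (hq : 1 <= q)
    (hpp : p1^-1 + p2^-1 = p^-1) (hqq : q1^-1 + q2^-1 = 1 + q^-1) :
  let Phi := wigner phi phi in
  [/\ @ldom R (SXis W) Phi,
      (forall a1 a2,
         @ldom R (modulation_space p1 q1 Phi) a1 ->
         @ldom R (modulation_space p2 q2 Phi) a2 ->
         weak_product_defined phi a1 a2 /\ exists! a, is_moyal phi a1 a2 a) &
      @continuous_bilinear R (modulation_space p1 q1 Phi)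
        (modulation_space p2 q2 Phi) (modulation_space p q Phi) (moyal phi)].
Proof.
move=> Phi; split.
- by have [] := ambiguity_wigner setting hphi hphi.
- move=> a1 a2 m1 m2; split.
    exact: (modulation_product_defined setting hphi phi0 hp1 hp2 hp hq1 hq2 hq hpp hqq).
  exact: (exists_moyal setting hphi phi0 hp1 hp2 hp hq1 hq2 hq hpp hqq).
- exact: (moyal_continuous_bilinear setting hphi phi0).
Qed.
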